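(* There exists a sequence $(\Gamma_l)_{l\in\mathbb{N}}$ of finite graphs of uniformly bounded degree such that all of the following hold true. (1) The sequence $(\Gamma_l)_l$ forms an expander family. (2) The disjoint union $\bigsqcup_{l\in\mathbb{N}}\Gamma_l$ does not admit a fibred coarse embedding as a disjoint union into $\mathcal{CAT}(0)_{<1}$. Neither does it admit a fibred coarse embedding as a disjoint union into Banach spaces that are sphere equivalent to a Hilbert space. (3) There exists a complete $\mathrm{CAT}(0)$ space $M$ such that $\bigsqcup_{l\in\mathbb{N}}\Gamma_l$ admits a biLipschitz embedding into $M$, namely, it admits a coarse embedding into $M$ with control pair $(\rho,\omega)$, where $\rho$ and $\omega$ are both linear functions.
   Context: Connected graphs are regarded as their vertex sets with the shortest path metric; the disjoint union of metric spaces carries the generalized metric equal to the given one on each component and $+\infty$ between different components. Isometries (of a space onto a space) are surjective. **Expander family**: a sequence of finite connected graphs $(\Gamma_l)_l$ of uniformly bounded degree, with $\sharp(V(\Gamma_l))\to\infty$, such that for every Hilbert space $E$ there is $C_E>0$ with $\sum_{v\in V(\Gamma_l)}\|f(v)-m(f)\|^2\le C_E\sum_{e=(v,w)\in E(\Gamma_l)}\|f(v)-f(w)\|^2$ for every $l$ and every $f:V(\Gamma_l)\to E$, where $m(f)=\frac{1}{\sharp(V(\Gamma_l))}\sum_vf(v)$. **Coarse embedding with control pair** $(\rho,\omega)$ of a generalized metric space $(X,d)$ into $M$: a map $f:X\to M$ with $\rho(d(x_1,x_2))\le d_M(f(x_1),f(x_2))\le\omega(d(x_1,x_2))$ whenever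 $d(x_1,x_2)<+\infty$, where $\rho,\omega:[0,\infty)\to[0,\infty)$ are non-decreasing and tend to $+\infty$ at $+\infty$. **Fibred coarse embeddings.** Let $X=\bigsqcup_mX_m$ with $(X_m)_m$ equi-uniformly locally finite (for every $R$, closed $R$-balls have cardinality bounded by a constant independent of center and $m$). $X$ admits a fibred coarse embedding into a metric space $M$ as a disjoint union if there are non-decreasing $\rho,\omega:[0,\infty)\to[0,\infty)$ tending to $+\infty$ at $+\infty$, a field $(M_x)_{x\in X}$ of metric spaces each isometric to $M$, and a section $s$ with $s(x)\in M_x$, such that for every $R\ge0$ there is $m^{(R)}\in\mathbb{N}_{\ge1}$ such that each non-empty $C\subseteq X\setminus\bigsqcup_{m<m^{(R)}}X_m$ of diameter at most $R$ has a trivialization $t_{C,R}$, i.e. isometries $t_{C,R}(x):M_x\to M$ ($x\in C$), with (1) $\rho(d(x_1,x_2))\le d_M(t_{C,R}(x_1)(s(x_1)),t_{C,R}(x_2)(s(x_2)))\le\omega(d(x_1,x_2))$ for all $x_1,x_2\in C$; (2) for any two such $C_1,C_2$ with $C_1\cap C_2\neq\emptyset$ there is an isometry $t_{C_1,C_2,R}:M\to M$ with $t_{C_1,R}(x)\circ t_{C_2,R}(x)^{-1}=t_{C_1,C_2,R}$ for all $x\in C_1\cap C_2$. (Trivializations for different $R$ need not be compatible; if $M$ is a Banach space, these isometries are assumed affine.) It admits one into a class if it does so into some member of the class. Two Banach spaces are sphere equivalent if there is a bijection $\Phi$ between their unit spheres with $\Phi$ and $\Phi^{-1}$ uniformly continuous.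 $\mathcal{CAT}(0)_{<1}$ is the class of complete $\mathrm{CAT}(0)$ spaces $M$ with Izeki--Nayatani invariant $\delta(M)<1$, defined as follows. For a finitely supported probability measure $\mu=\sum_{i=1}^kt_i\mathrm{Dirac}_{p_i}$ on $M$ ($t_i>0$, support of more than one point) let $\overline{\mu}\in M$ be its barycenter, the unique minimizer of $x\mapsto\sum_it_id_M(p_i,x)^2$. Put $\delta(\mu)=\inf_f\frac{\|\sum_it_if(p_i)\|^2}{\sum_it_i\|f(p_i)\|^2}$, over all maps $f:\mathrm{supp}(\mu)\to L_2([0,1])$ with $\|f(p_i)\|=d_M(p_i,\overline{\mu})$ and $\|f(p_i)-f(p_j)\|\le d_M(p_i,p_j)$ for all $i,j$. Then $\delta(M)=\sup_\mu\delta(\mu)\in[0,1]$. *)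

(* Defs.v *)
From HB Require Import structures.
From mathcomp Require Import all_boot all_order all_algebra.
From mathcomp Require Import all_classical all_reals all_analysis.

Set Implicit Arguments.
Unset Strict Implicit.
Unset Printing Implicit Defensive.

Import Order.TTheory GRing.Theory Num.Theory.
Import numFieldNormedType.Exports.

Local Open Scope classical_set_scope.
Local Open Scope ring_scope.

(** * Finite graphs *)

Record graph := Graph {
  vertex :> finType;
  adj : rel vertex;
  adj_sym : symmetric adj;
  adj_irr : irreflexive adj }.

Definition connected_graph (G : graph) : Prop :=
  (0 < #|G|)%N /\ forall x y : G, connect (@adj G) x y.

Definition degree (G : graph) (v : G) : nat := #|[set w | adj v w]%SET|.

Definition bounded_degree (G : nat -> graph) : Prop :=
  exists D : nat, forall (l : nat) (v : G l), (degree v <= D)%N.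

(* The infimum of the empty set is [+oo], so vertices in different connected
   components are at infinite distance. *)
Definition graph_dist (R : realType) (G : graph) (x y : G) : \bar R :=
  ereal_inf [set (size p)%:R%:E
            | p in [set p : seq G | path (@adj G) x p /\ last x p = y]].

(** * Hilbert spaces and expander families *)

(* Scalars are real: a complex Banach or Hilbert space is in particular a real
   one, with the same norm. *)
Definition hilbert (R : realType) (E : completeNormedModType R) : Prop :=
  exists dot : {dot E for (idfun : R -> R)},
    forall x : E, dot x x = `|x| ^+ 2.

Definition vertex_mean (R : realType) (G : graph) (E : lmodType R)
    (f : G -> E) : E :=
  (#|G|%:R)^-1 *: \sum_(v : G) f v.

(* The sum over ordered pairs counts each edge twice. *)
Definition edge_energy (R : realType) (G : graph) (E : normedModType R)
    (f : G -> E) : R :=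
  2^-1 * \sum_(v : G) \sum_(w : G | adj v w) `|f v - f w| ^+ 2.

Definition expander_family (R : realType) (G : nat -> graph) : Prop :=
  [/\ forall l, connected_graph (G l),
      bounded_degree G,
      #|G l| @[l --> \oo] --> \oo &
      forall E : completeNormedModType R, hilbert E ->
        exists2 C : R, 0 < C &
          forall (l : nat) (f : G l -> E),
            \sum_(v : G l) `|f v - vertex_mean f| ^+ 2 <= C * edge_energy f].

(** * Disjoint unions and coarse embeddings *)

Definition disj_dist (R : realType) (X : nat -> Type)
    (d : forall m, X m -> X m -> \bar R) (x y : {m : nat & X m}) : \bar R :=
  if tag y == tag x then d (tag x) (tagged x) (tagged_as x y) else +oo%E.

(* Only the values on [[0, +oo[] matter. *)
Definition control_function (R : realType) (rho : R -> R) : Prop :=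
  [/\ forall r, 0 <= r -> 0 <= rho r,
      forall r1 r2, 0 <= r1 -> r1 <= r2 -> rho r1 <= rho r2 &
      rho r @[r --> +oo] --> +oo].

Definition coarse_embedding (R : realType) (X : Type) (d : X -> X -> \bar R)
    (M : metricType R) (rho omega : R -> R) (f : X -> M) : Prop :=
  [/\ control_function rho, control_function omega &
      forall x1 x2 : X, (d x1 x2 < +oo)%E ->
        rho (fine (d x1 x2)) <= mdist (f x1) (f x2) <= omega (fine (d x1 x2))].

Definition linear_control (R : realType) (rho : R -> R) : Prop :=
  exists a : R, forall r, 0 <= r -> rho r = a * r.

Definition bilipschitz_embeddable (R : realType) (X : Type)
    (d : X -> X -> \bar R) (M : metricType R) : Prop :=
  exists (rho omega : R -> R) (f : X -> M),
    [/\ linear_control rho, linear_control omega &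
        coarse_embedding d rho omega f].

(** * Fibred coarse embeddings *)

Definition diam_le (R : realType) (X : Type) (d : X -> X -> \bar R)
    (C : set X) (r : R) : Prop :=
  forall x y, C x -> C y -> (d x y <= r%:E)%E.

(* [K] is a kind of target spaces, with underlying metric spaces [U], and
   [iso A B t] says that [t] is an admissible isometry from [A] onto [B].
   It is used below for metric spaces, and for Banach spaces with affine
   isometries. The standing assumption that the [X m] are equi-uniformly
   locally finite is not part of the definition. *)
Definition fibred_coarse_embedding_of (R : realType) (K : Type)
    (U : K -> metricType R) (iso : forall A B : K, (U A -> U B) -> Prop)
    (X : nat -> Type) (d : forall m, X m -> X m -> \bar R) (M : K) : Prop :=
  exists (rho omega : R -> R) (Mx : {m : nat & X m} -> K)
    (s : forall x, U (Mx x)),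
  [/\ control_function rho, control_function omega,
      forall x, exists t : U (Mx x) -> U M, iso (Mx x) M t &
      forall r : R, 0 <= r ->
        exists m : nat, (0 < m)%N /\
        let admissible (C : set {m : nat & X m}) :=
          [/\ C !=set0, forall x, C x -> (m <= tag x)%N
            & diam_le (disj_dist d) C r] in
        exists t : set {m : nat & X m} -> forall x, U (Mx x) -> U M,
        (forall C, admissible C ->
          (forall x, C x -> iso (Mx x) M (t C x)) /\
          (forall x1 x2, C x1 -> C x2 ->
            rho (fine (disj_dist d x1 x2))
            <= mdist (t C x1 (s x1)) (t C x2 (s x2))
            <= omega (fine (disj_dist d x1 x2))))
        /\
        (forall C1 C2, admissible C1 -> admissible C2 ->
          C1 `&` C2 !=set0 ->
          exists t12 : U M -> U M, iso M M t12 /\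
            (* t12 = t C1 x \o (t C2 x)^-1 *)
            forall x, C1 x -> C2 x -> t C1 x = t12 \o t C2 x)].

Definition surj_isometry (R : realType) (A B : metricType R) (t : A -> B)
  : Prop :=
  (forall x y, mdist (t x) (t y) = mdist x y) /\ range t = setT.

Definition fibred_coarse_embedding (R : realType) (X : nat -> Type)
    (d : forall m, X m -> X m -> \bar R) (M : metricType R) : Prop :=
  @fibred_coarse_embedding_of R (metricType R) (fun A => A)
    (@surj_isometry R) X d M.

Section normed_metric.
Context (R : realType).

Definition normed_metric (V : normedModType R) : Type := V.

Variable V : normedModType R.

HB.instance Definition _ := PseudoMetric.copy (normed_metric V) V.

Let dist (x y : normed_metric V) : R := `|(x : V) - (y : V)|.

Let dist_ge0 x y : 0 <= dist x y.
Proof. exact: normr_ge0. Qed.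

Let dist_positivity x y : dist x y = 0 -> x = y.
Proof. by move/normr0_eq0/eqP; rewrite subr_eq0 => /eqP. Qed.

Let ballEdist (x : normed_metric V) e : ball x e = [set y | dist x y < e].
Proof. by rewrite -[LHS]/(ball (x : V) e) -ball_normE. Qed.

HB.instance Definition _ := @PseudoMetric_isMetric.Build R (normed_metric V)
  dist dist_ge0 dist_positivity ballEdist.

End normed_metric.

Definition banach_metric (R : realType) (E : completeNormedModType R)
  : metricType R := normed_metric E.

Definition affine_isometry (R : realType) (E F : completeNormedModType R)
    (t : banach_metric E -> banach_metric F) : Prop :=
  surj_isometry t /\
  forall (a : R) (x y : E),
    (t (a *: x + (1 - a) *: y) : F) = a *: (t x : F) + (1 - a) *: (t y : F).

Definition banach_fibred_coarse_embedding (R : realType) (X : nat -> Type)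
    (d : forall m, X m -> X m -> \bar R) (E : completeNormedModType R)
  : Prop :=
  @fibred_coarse_embedding_of R (completeNormedModType R) (@banach_metric R)
    (@affine_isometry R) X d E.

(** * Sphere equivalence *)

Definition unit_sphere (R : realType) (E : normedModType R) : set E :=
  [set x | `|x| = 1].

Definition unif_continuous_on (R : realType) (E F : normedModType R)
    (A : set E) (f : E -> F) : Prop :=
  forall e : R, 0 < e -> exists2 delta : R, 0 < delta &
    forall x y, A x -> A y -> `|x - y| < delta -> `|f x - f y| < e.

Definition sphere_equivalent (R : realType) (E F : normedModType R) : Prop :=
  exists (Phi : E -> F) (Psi : F -> E),
    [/\ forall x, unit_sphere x -> unit_sphere (Phi x) /\ Psi (Phi x) = x,
        forall y, unit_sphere y -> unit_sphere (Psi y) /\ Phi (Psi y) = y,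
        unif_continuous_on (@unit_sphere R E) Phi &
        unif_continuous_on (@unit_sphere R F) Psi].

(** * Complete CAT(0) spaces *)

(* The library's [completeType] is pointed; this is its axiom. *)
Definition complete_metric (R : realType) (M : metricType R) : Prop :=
  forall F : set_system M, ProperFilter F -> cauchy F -> exists x : M, F --> x.

Section CAT0.
Context (R : realType).

Definition geodesic (M : metricType R) (x y : M) (c : R -> M) : Prop :=
  [/\ c 0 = x, c (mdist x y) = y &
      forall s t, 0 <= s <= mdist x y -> 0 <= t <= mdist x y ->
        mdist (c s) (c t) = `|s - t|].

Definition euclid_dist (a b : 'rV[R]_2) : R :=
  Num.sqrt (\sum_(i < 2) (a 0 i - b 0 i) ^+ 2).

Definition in_segment (a b z : 'rV[R]_2) : Prop :=
  exists2 l : R, 0 <= l <= 1 & z = (1 - l) *: a + l *: b.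

(* A geodesic triangle has vertices [v i] and sides [c i] from [v i] to
   [v (ordS i)], where [ordS] is the cyclic successor; [w] is a comparison
   triangle. *)
Definition cat0_inequality (M : metricType R) : Prop :=
  forall (v : 'I_3 -> M) (c : 'I_3 -> R -> M) (w : 'I_3 -> 'rV[R]_2),
    (forall i, geodesic (v i) (v (ordS i)) (c i)) ->
    (forall i j, euclid_dist (w i) (w j) = mdist (v i) (v j)) ->
    forall (i j : 'I_3) (s t : R) (x y : 'rV[R]_2),
      0 <= s <= mdist (v i) (v (ordS i)) ->
      0 <= t <= mdist (v j) (v (ordS j)) ->
      in_segment (w i) (w (ordS i)) x -> euclid_dist (w i) x = s ->
      in_segment (w j) (w (ordS j)) y -> euclid_dist (w j) y = t ->
      mdist (c i s) (c j t) <= euclid_dist x y.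

Definition cat0 (M : metricType R) : Prop :=
  (forall x y : M, exists c : R -> M, geodesic x y c) /\ cat0_inequality M.

Definition complete_cat0 (M : metricType R) : Prop :=
  complete_metric M /\ cat0 M.

End CAT0.

(** * The Izeki-Nayatani invariant *)

Section Izeki_Nayatani.
Context (R : realType).

(* L_2([0,1]) before the quotient by almost everywhere equality: the norm is a
   seminorm here, and the invariant only involves norms. *)
Definition lebesgue01 : {measure set (measurableTypeR R) -> \bar R} :=
  mrestr (@lebesgue_measure R) (measurable_itv `[(0 : R), 1]).

Local Notation L2 := (LfunType lebesgue01 (lee1n 2)).

Definition L2_norm (f : L2) : R :=
  fine ('N[lebesgue01]_(2%:R%:E)[EFin \o (f : R -> R)])%E.

Variable M : metricType R.

(* Finitely supported probability measures whose support, enumerated by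
   [fs_point], has more than one point. *)
Record fs_prob := FsProb {
  fs_n : nat;
  fs_point : 'I_fs_n.+2 -> M;
  fs_weight : 'I_fs_n.+2 -> R;
  fs_point_inj : injective fs_point;
  fs_weight_gt0 : forall i, 0 < fs_weight i;
  fs_weight_sum : \sum_i fs_weight i = 1 }.

Arguments fs_point : clear implicits.
Arguments fs_weight : clear implicits.

Definition fs_energy (mu : fs_prob) (x : M) : R :=
  \sum_i fs_weight mu i * mdist (fs_point mu i) x ^+ 2.

(* The value is meaningful when the unique minimizer exists, in particular when
   [M] is a complete CAT(0) space. *)
Definition barycenter (mu : fs_prob) : M :=
  xget (fs_point mu ord0)
    [set b | forall x, x != b -> fs_energy mu b < fs_energy mu x].

Definition IN_delta_measure (mu : fs_prob) : R :=
  inf [set r : R | exists f : 'I_(fs_n mu).+2 -> L2,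
    [/\ forall i, L2_norm (f i) = mdist (fs_point mu i) (barycenter mu),
        forall i j,
          L2_norm (f i - f j) <= mdist (fs_point mu i) (fs_point mu j) &
        r = L2_norm (\sum_i fs_weight mu i *: f i) ^+ 2
            / \sum_i fs_weight mu i * L2_norm (f i) ^+ 2]].

(* The real supremum of the empty set is [0], the value for a one-point [M]. *)
Definition IN_delta : R := sup [set IN_delta_measure mu | mu in setT].

End Izeki_Nayatani.

Definition CAT0_lt1 (R : realType) (M : metricType R) : Prop :=
  complete_cat0 M /\ IN_delta M < 1.

(* Main.v *)
Require Import Defs.
From HB Require Import structures.
From mathcomp Require Import all_boot all_order all_algebra.
From mathcomp Require Import all_classical all_reals all_analysis.
From mathcomp Require Import measurable_realfun.
From mathcomp Require Import zify ring lra.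

(** The graphs are box products [L l] x [L (kappa l)], where the graphs [L k] are
    expanders of bounded degree whose girth exceeds [2 k + 8] and whose diameter
    is at most [K (k + 1)], and where [kappa] takes every value infinitely
    often.

    The graphs [L k] come from random edge sets ([edge_set_exists]). With
    positive probability there are many edges between any two large disjoint
    sets of vertices but few short cycles and few edges at vertices of large
    degree. Deleting one edge of every short cycle and the edges at vertices of
    large degree, and then a largest set of vertices with a small boundary,
    leaves an edge expander of large girth ([expander_core]). In an edge
    expander balls grow exponentially, so that the diameter is logarithmic in
    the number of vertices, hence proportional to the girth
    ([expander_high_girth]). Edge expansion gives a Poincare inequality
    ([poincare_expander]), which is inherited by box products ([poincare_box])
    and by functions with values in a Hilbert space ([hilbert_poincare]).

    Obstruction: a fibred coarse embedding trivializes on bounded sets that are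
    far out. Since [L k] is a factor of infinitely many of the products, a copy
    of it lies far out for every [k], and the trivialization over this copy
    embeds [L k] with controls that do not depend on [k]
    ([fibred_embedding_obstruction]). This is impossible if the target
    [concentrates]: then half of the vertices of [L k] are mapped into a ball of
    a radius independent of [k], whereas a bounded part of [L k] has a bounded
    number of vertices. For a CAT(0) space with invariant less than one, the
    images of the vertices are replaced by vectors whose mean is small compared
    to their norms, and the Poincare inequality bounds the mean squared distance
    from the barycentre ([CAT0_lt1_concentrates]). For a Banach space, the sphere
    equivalence with a Hilbert space is extended radially, and the Poincare
    inequality allows one to halve the radius of a ball that contains three
    quarters of the images as long as this radius is large ([ball_count_half]).

    Embedding: give all edges of [L k] the length [pi / (k + 1)] and truncate the
    path metric at [pi]. As the girth is large, all closed geodesics have length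
    at least [2 pi], and the Euclidean cone is a CAT(0) space
    ([graph_link_link], [cone_bruhat_tits]). The graphs [L k] are taken at mutual
    distance [pi], so that one cone contains all of them. The vertices of [L k]
    are put on the sphere of radius [(k + 1) / pi], where edges have length about
    one. Truncation and chords shorten distances at most by a bounded factor,
    because the ratio of diameter and girth is bounded
    ([cone_dist_bilipschitz]). Box products embed into the product of two copies
    of the cone ([box_union_embeds]). The CAT(0) condition is treated in the form
    of the inequality of Bruhat and Tits, which is easily seen to pass to
    products and quotients and which implies the existence of geodesics and the
    comparison of triangles ([cat0_bruhat_tits]). *)

Set Implicit Arguments.
Unset Strict Implicit.
Unset Printing Implicit Defensive.

Import Order.TTheory GRing.Theory Num.Theory.
Import numFieldNormedType.Exports.

Local Open Scope ring_scope.

(** * Random sets of edges *)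

Section BernoulliSubsets.
Variables (R : realFieldType) (T : finType) (p : R).
Hypotheses (p_ge0 : 0 <= p) (p_le1 : p <= 1).
Implicit Types (F S : {set T}) (X Y : {set T} -> R).

(** The law of a random subset to which every element belongs independently with
    probability [p]. *)
Definition bernoulli_weight F : R := \prod_e (if e \in F then p else 1 - p).

Definition expect X : R := \sum_(F : {set T}) bernoulli_weight F * X F.

Lemma bernoulli_weight_ge0 F : 0 <= bernoulli_weight F.
Proof. by apply: prodr_ge0 => e _; case: ifP => _ //; rewrite subr_ge0. Qed.

Lemma expect_prod (phi : T -> bool -> R) :
  expect (fun F => \prod_e phi e (e \in F))
  = \prod_e (p * phi e true + (1 - p) * phi e false).
Proof.
rewrite bigA_distr; apply: eq_bigr => F _.
by rewrite -big_split; apply: eq_bigr => e _; case: (e \in F).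
Qed.

Lemma expect_cst c : expect (fun=> c) = c.
Proof.
rewrite /expect -mulr_suml -[RHS]mul1r; congr (_ * _).
have := expect_prod (fun _ _ => 1); rewrite [RHS]big1 => [<-|e _]; last ring.
by apply: eq_bigr => F _; rewrite big1 ?mulr1.
Qed.

Lemma expect_sum (I : Type) (r : seq I) (P : pred I) (X : I -> {set T} -> R) :
  expect (fun F => \sum_(i <- r | P i) X i F)
  = \sum_(i <- r | P i) expect (X i).
Proof.
by rewrite /expect exchange_big; apply: eq_bigr => F _; rewrite mulr_sumr.
Qed.

Lemma expectZ c X : expect (fun F => c * X F) = c * expect X.
Proof. by rewrite /expect mulr_sumr; apply: eq_bigr => F _; rewrite mulrCA. Qed.

Lemma expectD X Y : expect (fun F => X F + Y F) = expect X + expect Y.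
Proof. by rewrite /expect -big_split; apply: eq_bigr => F _; rewrite mulrDr. Qed.

Lemma exists_expect_lt1 X : expect X < 1 -> exists F, X F < 1.
Proof.
move=> X1; apply/existsP; apply: contraLR X1 => /existsPn nX.
rewrite -leNgt -[leLHS](expect_cst 1); apply: ler_sum => F _.
by apply: ler_wpM2l; [exact: bernoulli_weight_ge0|rewrite leNgt nX].
Qed.

Lemma expect_subset S : expect (fun F => (S \subset F)%:R) = p ^+ #|S|.
Proof.
have := expect_prod (fun e b => (b || (e \notin S))%:R).
rewrite [RHS](_ : _ = p ^+ #|S|) => [<-|].
  apply: eq_bigr => F _; congr (_ * _).
  case: (boolP (S \subset F)) => [/fintype.subsetP SF|/subsetPn[e eS eF]].
    rewrite big1// => e _; case: (boolP (e \in S)) => [/SF ->//|_].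
    by rewrite orbT.
  by rewrite (bigD1 e)//= (negbTE eF) eS mul0r.
rewrite -prodr_const [RHS]big_mkcond /=; apply: eq_bigr => e _.
by case: (e \in S) => /=; ring.
Qed.

Lemma expect_expr x S :
  expect (fun F => x ^+ #|S :&: F|) = (1 - p + p * x) ^+ #|S|.
Proof.
have := expect_prod (fun e b => if b && (e \in S) then x else 1).
rewrite [RHS](_ : _ = (1 - p + p * x) ^+ #|S|) => [<-|].
  apply: eq_bigr => F _; congr (_ * _).
  rewrite -prodr_const [LHS]big_mkcond /=; apply: eq_bigr => e _.
  by rewrite inE andbC.
rewrite -prodr_const [RHS]big_mkcond /=; apply: eq_bigr => e _.
by case: (e \in S) => /=; ring.
Qed.

End BernoulliSubsets.

Section EdgeSets.
Variable V : finType.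
Implicit Types (F : {set {set V}}) (A B : {set V}).

Definition edge_adj F : rel V :=
  fun v w => (v != w) && ([set v; w]%SET \in F).

Lemma edge_adj_sym F : symmetric (edge_adj F).
Proof. by move=> v w; rewrite /edge_adj eq_sym finset.setUC. Qed.

Lemma edge_adj_irr F : irreflexive (edge_adj F).
Proof. by move=> v; rewrite /edge_adj eqxx. Qed.

Definition edge_graph F : graph := Graph (edge_adj_sym F) (edge_adj_irr F).

Definition join_edges A B : {set {set V}} :=
  [set [set ab.1; ab.2]%SET | ab in finset.setX A B]%SET.

Lemma pair_set_inj (A B : {set V}) a b a' b' : [disjoint A & B] ->
  a \in A -> b \in B -> a' \in A -> b' \in B ->
  [set a; b]%SET = [set a'; b']%SET -> (a, b) = (a', b').
Proof.
move=> dAB aA bB a'A b'B E.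
have : a \in [set a'; b']%SET by rewrite -E !inE eqxx.
rewrite !inE => /orP[/eqP <-|/eqP ab']; last first.
  by move: (disjointFr dAB aA); rewrite ab' b'B.
have : b \in [set a'; b']%SET by rewrite -E !inE eqxx orbT.
rewrite !inE => /orP[/eqP ba'|/eqP <-//].
by move: (disjointFr dAB a'A); rewrite -ba' bB.
Qed.

Lemma card_join_edges A B : [disjoint A & B] ->
  #|join_edges A B| = (#|A| * #|B|)%N.
Proof.
move=> dAB; rewrite card_in_imset ?cardsX// => -[a b] [a' b'].
rewrite !inE /= => /andP[aA bB] /andP[a'A b'B]; exact: (pair_set_inj dAB).
Qed.

End EdgeSets.

Definition cut_size (G : graph) (A B : {set G}) : nat :=
  #|[set ab in finset.setX A B | adj ab.1 ab.2]%SET|.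

Lemma cut_size_edge_graph (V : finType) (F : {set {set V}}) (A B : {set V}) :
  [disjoint A & B] ->
  @cut_size (edge_graph F) A B = #|join_edges A B :&: F|.
Proof.
move=> dAB; rewrite /cut_size.
rewrite -(@card_in_imset _ _ (fun ab : V * V => [set ab.1; ab.2]%SET)); last first.
  move=> -[a b] [a' b'].
  rewrite !inE /= => /andP[/andP[aA bB] _] /andP[/andP[a'A b'B] _].
  exact: (pair_set_inj dAB).
apply: eq_card => e; rewrite inE; apply/imsetP/andP => [[[a b]]|[]].
  rewrite !inE /= => /andP[abAB /andP[_ abF]] ->; split=> //.
  by apply/imsetP; exists (a, b) => //; rewrite inE.
move=> /imsetP[[a b]]; rewrite !inE/= => /andP[aA bB] -> abF.
exists (a, b) => //; rewrite !inE/= aA bB /edge_adj abF !andbT/=.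
by apply/eqP => ab; move: bB; rewrite -ab (disjointFr dAB).
Qed.

(** * Short cycles and vertices of large degree *)

(** A path between the ends of an edge that avoids this edge closes up to a
    cycle, so that all cycles have more than [g] edges. Paths with repeated
    vertices are allowed, which does not change the condition and makes it
    easier to use. *)
Definition girth_ge (G : graph) (g : nat) : Prop :=
  forall (v w : G) (p : seq G), adj v w ->
    path (fun x y => adj x y && ([set x; y]%SET != [set v; w]%SET)) v p ->
    last v p = w -> (g <= size p)%N.

Section ShortCycles.
Variable V : finType.
Implicit Types (F : {set {set V}}).

Definition path_edges (v : V) (p : seq V) : seq {set V} :=
  pairmap (fun x y => [set x; y]%SET) v p.

Definition cycle_edges (c : seq V) : seq {set V} :=
  if c is v :: p then [set v; last v p]%SET :: path_edges v p else [::].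

Lemma size_cycle_edges c : size (cycle_edges c) = size c.
Proof. by case: c => //= v p; rewrite size_pairmap. Qed.

Lemma path_edges_sub v p e : e \in path_edges v p -> e \subset v :: p.
Proof.
elim: p v => [|w p IH] v //=; rewrite inE => /orP[/eqP ->|/IH ep].
  by apply/fintype.subsetP => x; rewrite !inE => /orP[->//|->]; rewrite orbT.
apply: fintype.subset_trans ep _; apply/fintype.subsetP => x xp.
by rewrite inE xp orbT.
Qed.

Lemma uniq_path_edges v p : uniq (v :: p) -> uniq (path_edges v p).
Proof.
elim: p v => [|w p IH] v //= /andP[vp wp]; rewrite IH// andbT.
apply/negP => /path_edges_sub /fintype.subsetP /(_ v).
by rewrite !inE eqxx => /(_ isT); rewrite -in_cons (negbTE vp).
Qed.

Lemma all_path_edges (P : pred {set V}) v p :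
  all P (path_edges v p) = path (fun x y => P [set x; y]%SET) v p.
Proof. by elim: p v => //= w p IH v; rewrite IH. Qed.

Definition short_cycles F k : {set k.+1.-tuple V} :=
  [set c : k.+1.-tuple V |
    uniq (cycle_edges c) && all (mem F) (cycle_edges c)]%SET.

(** The closing edge heads the list of edges of a cycle. Deleting it from every
    short cycle destroys all of them. *)
Definition short_cycle_edges F g : {set {set V}} :=
  (\bigcup_(k < g) [set head finset.set0 (cycle_edges c)
                   | c : k.+1.-tuple V in short_cycles F k])%SET.

Lemma card_bigcup_le (T I : finType) (P : pred I) (F : I -> {set T}) :
  (#|\bigcup_(i | P i) F i| <= \sum_(i | P i) #|F i|)%N.
Proof.
elim/big_ind2 : _ => [|m S n T' mS nT|//]; first by rewrite cards0.
by apply: leq_trans (leq_add mS nT); rewrite cardsU leq_subr.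
Qed.

Lemma card_short_cycle_edges F g :
  (#|short_cycle_edges F g| <= \sum_(k < g) #|short_cycles F k|)%N.
Proof.
apply: leq_trans (card_bigcup_le _ _) _; apply: leq_sum => k _.
exact: leq_imset_card.
Qed.

(** A path that avoids an edge and joins its ends contains a simple one. If it
    is short, it forms with the edge a short cycle of [F], whose closing edge is
    this edge and has been deleted. *)
Lemma girth_edge_graph F F' g : F' \subset F ->
  [disjoint F' & short_cycle_edges F g] -> girth_ge (edge_graph F') g.
Proof.
move=> F'F dF' v w p /= /andP[vw vwF'] vp; rewrite leqNgt.
case/shortenP: vp => p' vp' up' p'p lp; apply/negP => pg.
have {p'p} p'g : (size p' < g)%N.
  by apply: leq_ltn_trans pg; apply: uniq_leq_size => //; case/andP: up'.
suff : [set v; w]%SET \in short_cycle_edges F g.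
  by rewrite (disjointFr dF' vwF').
apply/bigcupP; exists (Ordinal p'g) => //; apply/imsetP.
exists (@Tuple (size p').+1 V (v :: p') (eqxx _)); last by rewrite /= lp.
rewrite inE /= lp uniq_path_edges// andbT !all_path_edges.
rewrite (fintype.subsetP F'F)//=; apply/andP; split; last first.
  by apply: sub_path vp' => x y /andP[/andP[_ /(fintype.subsetP F'F)]].
rewrite -has_pred1 -all_predC all_path_edges.
by apply: sub_path vp' => x y /andP[].
Qed.

End ShortCycles.

Section HeavyVertices.
Variable V : finType.
Implicit Types (F : {set {set V}}).

Definition forks F : {set V * V * V} :=
  [set t | [&& edge_adj F t.1.1 t.1.2, edge_adj F t.1.1 t.2
             & t.1.2 != t.2]]%SET.

Definition heavy_darts F D : {set V * V} :=
  [set vw | edge_adj F vw.1 vw.2 & (D < #|[set w | edge_adj F vw.1 w]|)%N]%SET.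

Definition heavy_edges F D : {set {set V}} :=
  [set [set vw.1; vw.2] | vw in heavy_darts F D]%SET.

(** Every edge at a vertex of degree larger than [D] is the first edge of at
    least [D] forks, and forks are easily counted on average. *)
Lemma card_forks_ge F D : (D * #|heavy_edges F D| <= #|forks F|)%N.
Proof.
apply: (@leq_trans (D * #|heavy_darts F D|)).
  by rewrite leq_mul2l leq_imset_card orbT.
rewrite -[#|forks F|]sum1_card.
rewrite (eq_bigl (fun t : V * V * V => edge_adj F t.1.1 t.1.2 &&
   (edge_adj F t.1.1 t.2 && (t.1.2 != t.2)))); last by move=> t; rewrite inE.
rewrite -(pair_big_dep (fun vw : V * V => edge_adj F vw.1 vw.2)
  (fun vw w => edge_adj F vw.1 w && (vw.2 != w)) (fun _ _ => 1%N)) /=.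
rewrite mulnC -sum_nat_const.
rewrite [leqRHS](bigID (mem (heavy_darts F D))) /= -[leqLHS]addn0 leq_add//.
rewrite [leqRHS](eq_bigl (mem (heavy_darts F D))); last first.
  by move=> vw; rewrite !inE andbA andbb.
apply: leq_sum => -[v w]; rewrite inE /= => /andP[vw Dv].
rewrite sum1_card -ltnS (leq_trans Dv)//.
rewrite (cardD1 w) inE vw add1n ltnS; apply: subset_leq_card.
apply/fintype.subsetP => x; rewrite !inE => /andP[xw vx].
by rewrite unfold_in /= vx eq_sym.
Qed.

Lemma degree_edge_graph F F' D (v : V) : F' \subset F ->
  [disjoint F' & heavy_edges F D] -> (@degree (edge_graph F') v <= D)%N.
Proof.
move=> F'F dF'; rewrite leqNgt; apply/negP => Dv.
have : (0 < @degree (edge_graph F') v)%N by apply: leq_ltn_trans Dv.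
case/card_gt0P => w; rewrite inE /= => /andP[vw vwF'].
suff : [set v; w]%SET \in heavy_edges F D by rewrite (disjointFr dF' vwF').
apply/imsetP; exists (v, w) => //; rewrite inE /= /edge_adj vw.
rewrite (fintype.subsetP F'F)//=; apply: leq_trans Dv _.
apply: subset_leq_card; apply/fintype.subsetP => x.
by rewrite !inE => /andP[-> /(fintype.subsetP F'F)].
Qed.

End HeavyVertices.

Section Expectations.
Variables (R : realFieldType) (V : finType) (p : R).
Hypotheses (p_ge0 : 0 <= p) (p_le1 : p <= 1).
Let n := #|V|.

(** The [k + 1] different edges of a cycle are present with probability [p ^+
    k.+1]. *)
Lemma expect_short_cycles k :
  expect p (fun F => #|@short_cycles V F k|%:R) <= (n%:R * p) ^+ k.+1.
Proof.
have -> : (fun F => #|@short_cycles V F k|%:R) = (fun F : {set {set V}} =>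
    \sum_(c : k.+1.-tuple V | uniq (cycle_edges c))
      ([set:: cycle_edges c]%SET \subset F)%:R) :> (_ -> R).
  apply/funext => F; rewrite -sum1_card natr_sum.
  rewrite (eq_bigl (fun c : k.+1.-tuple V => uniq (cycle_edges c) &&
    all (mem F) (cycle_edges c))); last by move=> c; rewrite inE.
  rewrite big_mkcondr /=; apply: eq_bigr => c _.
  rewrite (_ : all _ _ = ([set:: cycle_edges c]%SET \subset F)); first by case: ifP.
  apply/allP/fintype.subsetP => [cF e|cF e ec]; first by rewrite inE => /cF.
  by apply: cF; rewrite inE.
rewrite expect_sum exprMn.
have -> : (n%:R ^+ k.+1 : R) = #|{: k.+1.-tuple V}|%:R.
  by rewrite card_tuple natrX.
rewrite mulr_natl -sumr_const.
rewrite [leRHS](bigID (fun c : k.+1.-tuple V => uniq (cycle_edges c))) /=.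
rewrite -[leLHS]addr0 lerD//; last by apply: sumr_ge0 => c _; exact: exprn_ge0.
apply: ler_sum => c uc; rewrite expect_subset// cardsE.
by rewrite (card_uniqP uc) size_cycle_edges size_tuple.
Qed.

Lemma expect_forks :
  expect p (fun F => #|@forks V F|%:R) <= n%:R ^+ 3 * p ^+ 2.
Proof.
have -> : (fun F => #|@forks V F|%:R) = (fun F : {set {set V}} =>
    \sum_(t : V * V * V | [&& t.1.1 != t.1.2, t.1.1 != t.2 & t.1.2 != t.2])
      ([set [set t.1.1; t.1.2]; [set t.1.1; t.2]]%SET \subset F)%:R) :> (_ -> R).
  apply/funext => F; rewrite -sum1_card natr_sum.
  rewrite (eq_bigl (fun t : V * V * V =>
    [&& t.1.1 != t.1.2, t.1.1 != t.2 & t.1.2 != t.2] &&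
    ([set [set t.1.1; t.1.2]; [set t.1.1; t.2]]%SET \subset F))).
    by rewrite big_mkcondr /=; apply: eq_bigr => t _; case: ifP.
  move=> t; rewrite inE /edge_adj finset.subUset !finset.sub1set.
  by case: (_ == _); case: (_ == _); case: (_ == _); case: (_ \in _);
    case: (_ \in _).
rewrite expect_sum.
have -> : (n%:R ^+ 3 : R) = #|{: V * V * V}|%:R.
  by rewrite !card_prod !natrM !exprS expr0 mulr1 mulrA.
rewrite mulr_natl -sumr_const.
rewrite [leRHS](bigID (fun t : V * V * V =>
    [&& t.1.1 != t.1.2, t.1.1 != t.2 & t.1.2 != t.2])) /=.
rewrite -[leLHS]addr0 lerD//; last by apply: sumr_ge0 => t _; exact: exprn_ge0.
apply: ler_sum => -[[v w] w'] /= /and3P[vw vw' ww']; rewrite expect_subset//.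
rewrite cards2 (_ : [set v; w]%SET != [set v; w']%SET)//.
apply/eqP => /setP /(_ w); rewrite !inE eqxx orbT => /esym /orP[]; last first.
  exact/negP.
by rewrite eq_sym; exact/negP.
Qed.

(** The expectation of [2 ^- X], where [X] is the number of edges between [A]
    and [B], detects that few edges are unlikely. *)
Lemma expect_cut (A B : {set V}) (m : nat) (q : R) : [disjoint A & B] ->
  (1 - p / 2) ^+ m <= q -> (m <= #|A| * #|B|)%N ->
  expect p (fun F => 2^-1 ^+ #|join_edges A B :&: F|) <= q.
Proof.
move=> dAB pq mAB; rewrite expect_expr// card_join_edges//.
apply: le_trans pq; rewrite (_ : 1 - p + _ = 1 - p / 2); last by field.
by apply: ler_wiXn2l mAB; move: p_ge0 p_le1; lra.
Qed.

End Expectations.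

(** * Sparse graphs with many edges between large sets *)

(** The first moment method for [p = d / n], applied to the sum of three
    suitably scaled random variables: the numbers of short cycles and of forks,
    and the sum of [2 ^ (n - X)] over all pairs of large sets, where [X] is the
    number of edges between them. The expectation of the latter is at most [4 ^
    n * 2 ^ n * 2 ^ (- 4 n)], as there are at least [n ^ 2 / 64 = n N] possible
    edges and [(1 - p / 2) ^ n <= (1 + d / 2)^-1 <= 2 ^ (- 256)]. The constants
    are variables subject to equations because [2 ^ 256] must not be evaluated
    in [nat]. *)
Lemma edge_set_exists (V : finType) (d e g N D : nat) (n := #|V|) :
  e = 256%N -> n = (64 * N)%N -> (0 < N)%N -> (d <= n)%N -> (2 ^ e * 2 <= 2 + d)%N ->
  (12 * (g * d ^ g) <= n)%N -> (0 < d)%N -> (0 < g)%N -> D = (12 * d ^ 2)%N ->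
  exists F : {set {set V}},
    [/\ forall A B : {set V}, [disjoint A & B] -> (n <= 8 * #|A|)%N ->
          (n <= 8 * #|B|)%N -> (n < #|join_edges A B :&: F|)%N,
        (4 * #|short_cycle_edges F g| < n)%N &
        (4 * #|heavy_edges F D| < n)%N].
Proof.
move=> e256 nN N0 dn d256 gdn d0 g0 DE.
have {d256} h256 : (2 : rat) ^+ e <= 1 + d%:R / 2.
  rewrite -(ler_pM2r (ltr0n _ 2)) mulrDl mul1r divfK// -natrX -natrM -natrD.
  exact: etrans (ler_nat _ _ _) d256.
have n0 : (0 < n)%N by lia.
pose p : rat := d%:R / n%:R.
have nR : (0 : rat) < n%:R by rewrite ltr0n.
have p0 : 0 <= p by rewrite divr_ge0.
have p1 : p <= 1 by rewrite ler_pdivrMr// mul1r ler_nat.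
have np : n%:R * p = d%:R by rewrite mulrC divfK// gt_eqF.
pose big (AB : {set V} * {set V}) := [&& [disjoint AB.1 & AB.2],
  (n <= 8 * #|AB.1|)%N & (n <= 8 * #|AB.2|)%N].
pose X1 (F : {set {set V}}) : rat :=
  \sum_(AB | big AB) 2 ^+ n * 2^-1 ^+ #|join_edges AB.1 AB.2 :&: F|.
pose X2 (F : {set {set V}}) : rat := \sum_(k < g) #|short_cycles F k|%:R.
pose X3 (F : {set {set V}}) : rat := #|forks F|%:R.
pose c2 : rat := (3 * (g * d ^ g))%:R^-1.
pose c3 : rat := (3 * (d ^ 2 * n))%:R^-1.
have EX1 : expect p X1 <= 4^-1.
  have pow n' : (1 - p / 2) ^+ n' * (1 + p / 2 *+ n') <= 1.
    have : (1 - p / 2) ^+ n' * (1 + p / 2) ^+ n' <= 1.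
      rewrite -exprMn exprn_ile1//; first by nra.
      by move: (sqr_ge0 p); nra.
    apply: le_trans; apply: ler_wpM2l; first by apply: exprn_ge0; lra.
    elim: n' => [|k IHk]; first by rewrite mulr0n addr0 expr0.
    rewrite exprS mulrS; have pk : 0 <= p / 2 *+ k by rewrite mulrn_wge0 ?divr_ge0.
    by apply: (@le_trans _ _ ((1 + p / 2) * (1 + p / 2 *+ k)));
      [nra|rewrite ler_wpM2l//; lra].
  have powN : (1 - p / 2) ^+ (n * N) <= 2^-1 ^+ (4 * n).
    have -> : (4 * n = e * N)%N by rewrite nN e256; lia.
    rewrite !exprM; apply: lerXn2r; rewrite ?nnegrE ?exprn_ge0//; first lra.
    have := pow n; rewrite -(mulr_natl (p / 2)) mulrA np => pown.
    have q0 : 0 <= (1 - p / 2) ^+ n by apply: exprn_ge0; lra.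
    rewrite exprVn -[leRHS]mul1r ler_pdivlMr ?exprn_gt0//.
    by apply: le_trans pown; apply: ler_wpM2l.
  rewrite expect_sum; apply: (@le_trans _ _ (\sum_(AB | big AB) 2^-1 ^+ (3 * n))).
    apply: ler_sum => -[A B] /and3P[/= dAB nA nB]; rewrite expectZ.
    rewrite (_ : 2^-1 ^+ (3 * n) = 2 ^+ n * 2^-1 ^+ (4 * n)).
      rewrite ler_wpM2l ?exprn_ge0//; apply: (expect_cut p0 p1 dAB powN).
      have nn : (n * n <= (8 * #|A|) * (8 * #|B|))%N by apply: leq_mul.
      by move: nn; rewrite {1}nN; lia.
    rewrite (_ : 4 * n = n + 3 * n)%N; last by lia.
    by rewrite exprD mulrA -exprMn mulfV// expr1n mul1r.
  apply: (@le_trans _ _ (2 ^+ (2 * n) * 2^-1 ^+ (3 * n))).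
    rewrite big_const iter_addr addr0 -[leLHS]mulr_natl ler_wpM2r ?exprn_ge0//.
    rewrite -natrX ler_nat (leq_trans (max_card _))//.
    by rewrite card_prod -!cardsT -!powersetT !card_powerset cardsT -expnD mul2n -addnn.
  rewrite (_ : 3 * n = 2 * n + n)%N; last by lia.
  rewrite exprD mulrA -exprMn mulfV// expr1n mul1r (_ : 4^-1 = 2^-1 ^+ 2 :> rat)//.
  by apply: ler_wiXn2l => //; lia.
have EX2 : c2 * expect p X2 <= 3^-1.
  rewrite expect_sum ler_pdivrMl ?ltr0n; last by rewrite !muln_gt0 g0 expn_gt0 d0.
  apply: (@le_trans _ _ (\sum_(k < g) d%:R ^+ g)).
    apply: ler_sum => k _; apply: le_trans (expect_short_cycles _ p0 k) _.
    by rewrite np -!natrX ler_nat leq_pexp2l.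
  by rewrite sumr_const card_ord -natrX natrM mulrAC divff// mul1r natrM [leRHS]mulr_natl.
have EX3 : c3 * expect p X3 <= 3^-1.
  rewrite ler_pdivrMl ?ltr0n; last by rewrite !muln_gt0 n0 d0.
  apply: le_trans (expect_forks V p0) _.
  by rewrite exprSr -mulrA mulrCA -exprMn np natrM mulrAC divff// mul1r natrM natrX mulrC.
have [F] : exists F, X1 F + (c2 * X2 F + c3 * X3 F) < 1.
  apply: (@exists_expect_lt1 _ _ p p0 p1 (fun F => X1 F + (c2 * X2 F + c3 * X3 F))).
  rewrite expectD expectD !expectZ -[expect p (fun F => X1 F)]/(expect p X1).
  rewrite -[expect p (fun F => X2 F)]/(expect p X2).
  rewrite -[expect p (fun F => X3 F)]/(expect p X3).
  by apply: le_lt_trans (lerD EX1 (lerD EX2 EX3)) _; lra.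
move=> XF; exists F.
have c20 : 0 < c2 by rewrite invr_gt0 ltr0n !muln_gt0 g0 expn_gt0 d0.
have c30 : 0 < c3 by rewrite invr_gt0 ltr0n !muln_gt0 n0 d0.
have t0 AB : 0 <= (2 : rat) ^+ n * 2^-1 ^+ #|join_edges AB.1 AB.2 :&: F|.
  by rewrite mulr_ge0 ?exprn_ge0.
have X10 : 0 <= X1 F by apply: sumr_ge0.
have X20 : 0 <= c2 * X2 F by rewrite mulr_ge0 ?(ltW c20)// sumr_ge0.
have X30 : 0 <= c3 * X3 F by rewrite mulr_ge0 ?(ltW c30).
split.
- move=> A B dAB nA nB; rewrite ltnNge; apply/negP => FK.
  suff : 1 <= X1 F by lra.
  rewrite /X1 (bigD1 (A, B)) /big/= ?dAB ?nA//.
  rewrite -[leLHS]addr0 lerD ?sumr_ge0// exprVn ler_pdivlMr ?exprn_gt0// mul1r.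
  by rewrite ler_weXn2l// ler1n.
- have : c2 * X2 F < 1 by lra.
  rewrite ltr_pdivrMl ?mulr1; last by rewrite ltr0n !muln_gt0 g0 expn_gt0 d0.
  rewrite /X2 -natr_sum ltr_nat => X2F.
  apply: leq_trans gdn; rewrite -[12%N]/(4 * 3)%N -mulnA ltn_pmul2l//.
  exact: leq_ltn_trans (card_short_cycle_edges F g) X2F.
- have : c3 * X3 F < 1 by lra.
  rewrite ltr_pdivrMl ?mulr1; last by rewrite ltr0n !muln_gt0 n0 d0.
  rewrite ltr_nat => X3F.
  have := card_forks_ge F D; rewrite DE => h.
  have : (12 * d ^ 2 * #|heavy_edges F D| < 3 * (d ^ 2 * n))%N.
    by apply: leq_ltn_trans X3F; rewrite -DE in h *.
  rewrite [X in (X < _)%N](_ : _ = 3 * (d ^ 2 * (4 * #|heavy_edges F D|)))%N; last first.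
    by move: (d ^ 2)%N #|_| => x y; clear; lia.
  by rewrite ltn_pmul2l// ltn_pmul2l -?DE// muln_gt0 d0.
Qed.

Definition edge_expander (G : graph) : Prop :=
  forall S : {set G}, (0 < #|S|)%N -> (2 * #|S| <= #|G|)%N ->
    (#|S| < 2 * cut_size S (~: S))%N.

(** The deleted edges, those closing short cycles and those at vertices of large
    degree, number less than [n / 2], while there are more than [n] edges
    between any two large sets. *)
Lemma sparse_expanding_graph : exists D b : nat,
  [/\ (0 < D)%N, (0 < b)%N & forall g, (0 < g)%N -> exists G : graph,
  let n := #|G| in
  [/\ n = (2 ^ (b * g))%N, girth_ge G g, forall v : G, (degree v <= D)%N &
    forall A B : {set G}, [disjoint A & B] -> (n <= 8 * #|A|)%N ->
      (n <= 8 * #|B|)%N -> (n < 2 * cut_size A B)%N]].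
Proof.
have [e eE] : exists e, e = 256%N by exists 256%N.
have [d dE] : exists d, d = (2 ^ e.+1)%N by exists (2 ^ e.+1)%N.
have [b bE] : exists b, b = 262%N by exists 262%N.
have d0 : (0 < d)%N by rewrite dE expn_gt0.
(* The power [b * g] of 2 has room for [2 ^ (4 + (g + 257 * g))], which bounds
   [12 * (g * d ^ g)]. *)
exists (12 * d ^ 2)%N, b; split=> [||g g0]; first by rewrite muln_gt0 expn_gt0 d0.
  by rewrite bE.
pose V := 'I_(2 ^ (b * g)).
have cV : #|V| = (2 ^ (b * g))%N by rewrite card_ord.
have bg : (262 * g <= b * g)%N by rewrite leq_mul2r bE leqnn orbT.
have [|||||F [cF sF hF]] :=
  @edge_set_exists V d e g (2 ^ (b * g - 6)) (12 * d ^ 2) eE _ _ _ _ _ d0 g0 erefl.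
- by rewrite cV -[64%N]/(2 ^ 6)%N -expnD; congr expn; lia.
- by rewrite expn_gt0.
- by rewrite cV dE leq_pexp2l//; lia.
- by rewrite dE expnSr leq_addl.
- rewrite cV; apply: (@leq_trans (2 ^ (4 + (g + e.+1 * g)))).
    have -> : (2 ^ (4 + (g + e.+1 * g)) = 16 * (2 ^ g * d ^ g))%N.
      by rewrite dE -expnM -[16%N]/(2 ^ 4)%N -!expnD.
    apply: leq_mul; [by []|apply: leq_mul; [|exact: leqnn]].
    exact: ltnW (ltn_expl g (ltnSn 1)).
  by rewrite leq_pexp2l//; lia.
pose F' := (F :\: (short_cycle_edges F g :|: heavy_edges F (12 * d ^ 2)))%SET.
have F'F : F' \subset F by apply: finset.subsetDl.
exists (edge_graph F'); split => //.
- apply: (@girth_edge_graph _ F) => //.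
  rewrite -setI_eq0; apply/eqP/setP => f; rewrite !inE.
  by case: (f \in short_cycle_edges _ _); rewrite ?andbF.
- move=> v; apply: (@degree_edge_graph _ F) => //.
  rewrite -setI_eq0; apply/eqP/setP => f; rewrite !inE.
  by case: (f \in heavy_edges _ _); rewrite ?orbT ?andbF.
move=> A B dAB nA nB; rewrite cut_size_edge_graph//.
have := cF A B dAB nA nB.
have : (#|join_edges A B :&: F| <= #|join_edges A B :&: F'| +
    (#|short_cycle_edges F g| + #|heavy_edges F (12 * d ^ 2)|))%N.
  apply: leq_trans (leq_add (leqnn _) (leq_card_setU _ _)).
  apply: leq_trans (leq_card_setU _ _); apply: subset_leq_card.
  apply/fintype.subsetP => f; rewrite !inE => /andP[-> ->]; rewrite andbT.
  by case: (_ \in _); case: (_ \in _).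
have arith n a c x z : (4 * a < n)%N -> (4 * c < n)%N ->
  (x <= z + (a + c))%N -> (n < x)%N -> (n < 2 * z)%N by clear; lia.
exact: arith sF hF.
Qed.

(** * Edge expanders as induced subgraphs *)

Section InducedGraph.
Variables (G : graph) (U : {set G}).

Definition induced_adj : rel {v : G | v \in U} := fun v w => adj (val v) (val w).

Lemma induced_adj_sym : symmetric induced_adj.
Proof. by move=> v w; exact: adj_sym. Qed.

Lemma induced_adj_irr : irreflexive induced_adj.
Proof. by move=> v; exact: adj_irr. Qed.

Definition induced_graph : graph := Graph induced_adj_sym induced_adj_irr.

Lemma girth_induced g : girth_ge G g -> girth_ge induced_graph g.
Proof.
move=> Gg v w p vw vp lp; have := Gg (val v) (val w) (map val p) vw.
rewrite size_map => -> //; last by rewrite last_map lp.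
rewrite path_map; apply: sub_path vp => x y /andP[xy xyvw] /=.
rewrite [adj _ _]xy /=; apply: contra_neq xyvw => E.
apply/setP => z; move/setP: E => /(_ (val z)).
by rewrite !inE.
Qed.

Lemma degree_induced D : (forall v : G, (degree v <= D)%N) ->
  forall v : induced_graph, (degree v <= D)%N.
Proof.
move=> GD v; apply: leq_trans (GD (val v)).
rewrite /degree -(card_imset _ val_inj); apply: subset_leq_card.
by apply/fintype.subsetP => _ /imsetP[w + ->]; rewrite !inE.
Qed.

Lemma cut_size_induced (S T : {set induced_graph}) :
  cut_size S T = @cut_size G (val @: S)%SET (val @: T)%SET.
Proof.
rewrite /cut_size -(card_imset (f := fun xy : induced_graph * induced_graph =>
  (val xy.1, val xy.2))); last by move=> [a b] [a' b'] [/val_inj -> /val_inj ->].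
apply: eq_card => -[a b]; apply/imsetP/idP => [[[v w]]|].
  by rewrite !inE /= => /andP[/andP[vS wT] vw] [-> ->]; rewrite !imset_f.
rewrite !inE /= => /andP[/andP[/imsetP[v vS ->] /imsetP[w wT ->]] vw].
by exists (v, w) => //; rewrite !inE /= vS wT.
Qed.

End InducedGraph.

Section ExpanderCore.
Variable G : graph.
Let n := #|G|.

Lemma cut_sizeUl (A A' B : {set G}) :
  (cut_size (A :|: A') B <= cut_size A B + cut_size A' B)%N.
Proof.
apply: leq_trans (leq_card_setU _ _); apply: subset_leq_card.
apply/fintype.subsetP => -[a b]; rewrite !inE /=.
by case: (a \in A); case: (a \in A'); case: (b \in B); case: (adj a b).
Qed.

Lemma cut_sizeSr (A B B' : {set G}) : B \subset B' ->
  (cut_size A B <= cut_size A B')%N.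
Proof.
move=> BB'; apply: subset_leq_card; apply/fintype.subsetP => -[a b].
by rewrite !inE /= => /andP[/andP[-> /(fintype.subsetP BB') ->] ->].
Qed.

Hypothesis large_cuts : forall A B : {set G}, [disjoint A & B] ->
  (n <= 8 * #|A|)%N -> (n <= 8 * #|B|)%N -> (n < 2 * cut_size A B)%N.

(** Let [Z] be a largest set with at most [5 n / 8] vertices and twice whose
    boundary is at most its size. By the hypothesis on large sets, [Z] has less
    than [n / 8] vertices. A set of at most half of the other vertices that
    violates expansion in the complement of [Z] could be added to [Z]. *)
Lemma expander_core :
  exists U : {set G}, (n <= 2 * #|U|)%N /\ edge_expander (induced_graph U).
Proof.
have [n0|n0] := posnP n.
  exists finset.set0; split; first by rewrite n0.
  move=> S S0 _; have := subset_leq_card (fintype.subset_predT (val @: S)%SET).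
  by rewrite [X in (_ <= X)%N -> _]n0 (card_imset _ val_inj); case: #|S| S0.
pose P (Z : {set G}) := (8 * #|Z| <= 5 * n)%N && (2 * cut_size Z (~: Z) <= #|Z|)%N.
have P0 : P finset.set0.
  rewrite /P cards0 muln0 leq0n /= leqn0 muln_eq0 /=.
  by apply/eqP/eq_card0 => -[a b]; rewrite !inE.
pose Z := [arg max_(Z > finset.set0 | P Z) #|Z|].
have [/andP[Zn Zc] Zmax] : P Z /\ forall Z', P Z' -> (#|Z'| <= #|Z|)%N.
  by rewrite /Z; case: arg_maxnP => // Z1 PZ1 h.
have cZ := cardsC Z; rewrite -/n in cZ.
have Z8 : (8 * #|Z| < n)%N.
  rewrite ltnNge; apply/negP => nZ.
  have := large_cuts (B := (~: Z)%SET) _ nZ.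
  rewrite -finset.setI_eq0 finset.setICr eqxx => /(_ isT); lia.
exists (~: Z)%SET; split; first lia.
move=> S S0 SU.
have cG : #|induced_graph (~: Z)| = #|(~: Z)%SET|.
  by rewrite card_sig; apply: eq_card => x; rewrite inE.
rewrite cG in SU; rewrite ltnNge; apply/negP => cS.
pose S' := (val @: S)%SET; have cS' : #|S'| = #|S| by apply: card_imset val_inj.
have dZS : [disjoint Z & S'].
  rewrite disjoint_sym; apply/pred0P => x /=; apply/negP => /andP[/imsetP[v _ ->]].
  by have := valP v; rewrite inE => /negbTE ->.
have cZS : #|(Z :|: S')%SET| = (#|Z| + #|S|)%N.
  by rewrite cardsU (disjoint_setI0 dZS) cards0 subn0 cS'.
suff /Zmax : P (Z :|: S')%SET by rewrite cZS; lia.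
rewrite /P cZS; apply/andP; split; first lia.
have := cut_sizeUl Z S' (~: (Z :|: S'))%SET.
have : (cut_size Z (~: (Z :|: S')) <= cut_size Z (~: Z))%N.
  by apply: cut_sizeSr; rewrite finset.setCS finset.subsetUl.
have : (cut_size S' (~: (Z :|: S')) <= cut_size S (~: S))%N.
  rewrite cut_size_induced; apply: cut_sizeSr; apply/fintype.subsetP => x.
  rewrite !inE negb_or => /andP[xZ xS].
  have xU : x \in (~: Z)%SET by rewrite inE.
  apply/imsetP; exists (exist _ x xU) => //; rewrite inE.
  by apply: contra xS => xS; apply/imsetP; exists (exist _ x xU).
by move: Zc cS; lia.
Qed.

End ExpanderCore.

(** * The diameter of edge expanders *)

Section BallGrowth.
Variables (G : graph) (D : nat).
Hypothesis degD : forall v : G, (degree v <= D)%N.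
Hypothesis expG : edge_expander G.

Definition ball_step (S : {set G}) : {set G} :=
  (S :|: [set w | [exists v in S, adj v w]])%SET.

Definition graph_ball (x : G) (r : nat) : {set G} :=
  iter r ball_step [set x]%SET.

Lemma graph_ball_path x r y : y \in graph_ball x r ->
  exists p, [/\ path (@adj G) x p, last x p = y & (size p <= r)%N].
Proof.
elim: r y => [|r IH] y; first by rewrite inE => /eqP ->; exists [::].
rewrite /graph_ball iterS !inE => /orP[/IH[p [px py pr]]|].
  by exists p; split=> //; apply: leqW.
case/existsP => v /andP[/IH[p [px py pr]] vy]; exists (rcons p y).
by rewrite rcons_path px py vy last_rcons size_rcons.
Qed.

Lemma cut_size_ball_step (S : {set G}) :
  (cut_size S (~: S) <= D * #|(ball_step S :\: S)%SET|)%N.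
Proof.
rewrite /cut_size -sum1_card
  (eq_bigl (fun ab : G * G => true && ((ab.1 \in S) && (ab.2 \in ~: S)%SET
     && adj ab.1 ab.2))); last by move=> ab; rewrite !inE.
rewrite -(pair_big_dep xpredT (fun a b => (a \in S) && (b \in ~: S)%SET && adj a b)
   (fun _ _ => 1%N)) /= (exchange_big_dep (mem (ball_step S :\: S)%SET)) /=.
  rewrite mulnC -sum_nat_const; apply: leq_sum => b _; rewrite sum1_card.
  apply: leq_trans (degD b); apply: subset_leq_card; apply/fintype.subsetP => a.
  by rewrite !inE unfold_in /= adj_sym => /andP[_ ->].
move=> a b _ /andP[/andP[aS bS] ab].
rewrite !inE in bS *; rewrite bS /=; apply/orP; right.
by apply/existsP; exists a; rewrite aS.
Qed.

(** The edges that leave a ball end in the next layer, whose vertices receive at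
    most [D] of them. By expansion every step increases the ball by the factor
    [1 + 1 / (2 D)]. *)
Lemma graph_ball_growth x r : (2 * #|graph_ball x r| <= #|G|)%N ->
  ((2 * D).+1 ^ r <= #|graph_ball x r| * (2 * D) ^ r)%N.
Proof.
elim: r => [|r IH] half; first by rewrite cards1.
have sub : graph_ball x r \subset graph_ball x r.+1 by apply: finset.subsetUl.
have le := subset_leq_card sub.
have {IH} := IH (leq_trans (leq_mul (leqnn 2) le) half).
have pos : (0 < #|graph_ball x r|)%N.
  apply/card_gt0P; exists x; elim: (r) => [|k IHk]; first by rewrite inE.
  by rewrite /graph_ball iterS inE IHk.
have := expG pos (leq_trans (leq_mul (leqnn 2) le) half).
have := cut_size_ball_step (graph_ball x r).
rewrite cardsD (finset.setIidPr sub) -/(graph_ball x r.+1).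
move: le; rewrite !expnS; set a := #|_|; set c := #|_|; set u := (_ ^ _)%N.
set v := (_ ^ _)%N; set k := cut_size _ _; clear; move=> ac ck kc uv.
have h : ((2 * D).+1 * a <= 2 * D * c)%N by nia.
apply: (@leq_trans ((2 * D).+1 * a * v)); first by rewrite -mulnA leq_mul2l uv.
by rewrite mulnA [(c * _)%N]mulnC leq_mul2r h orbT.
Qed.

(** [(1 + 1 / k) ^ k >= 2] by the inequality of Bernoulli, without denominators.
    *)
Lemma expnS_double k : (0 < k)%N -> (2 * k ^ k <= k.+1 ^ k)%N.
Proof.
move=> k0; have h j : (k ^ j * (k + j) <= k.+1 ^ j * k)%N.
  elim: j => [|j IH]; first by rewrite !expn0 addn0.
  rewrite !expnS; apply: (@leq_trans (k.+1 * (k ^ j * (k + j)))); last first.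
    by rewrite -mulnA leq_mul2l IH.
  by set x := (k ^ j)%N; nia.
rewrite -(leq_pmul2r k0); apply: leq_trans (h k).
by rewrite addnn -mul2n mulnAC mulnC mulnA.
Qed.

Lemma graph_ball_large x m : (#|G| <= 2 ^ m)%N -> (0 < D)%N ->
  (#|G| < 2 * #|graph_ball x (2 * D * m)|)%N.
Proof.
move=> Gm D0; rewrite ltnNge; apply/negP => half.
have := graph_ball_growth half.
set a := #|_|; have k0 : (0 < 2 * D)%N by rewrite muln_gt0.
have : (2 ^ m * (2 * D) ^ (2 * D * m) <= (2 * D).+1 ^ (2 * D * m))%N.
  move: k0; move: (2 * D)%N => k k0; rewrite !expnM -expnMn.
  case: m {Gm half a} => // m.
  by rewrite leq_exp2r//; apply: expnS_double.
move=> h1 h2; have := leq_trans h1 h2.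
rewrite leq_pmul2r ?expn_gt0 ?k0// => ma.
have G0 : (0 < #|G|)%N by apply/card_gt0P; exists x.
by move: half; rewrite -/a; move: (leq_trans Gm ma) G0; clear; lia.
Qed.

(** Two balls that contain more than half of the vertices intersect. *)
Lemma expander_short_paths x y m : (#|G| <= 2 ^ m)%N -> (0 < D)%N ->
  exists p, [/\ path (@adj G) x p, last x p = y & (size p <= 4 * D * m)%N].
Proof.
move=> Gm D0; pose r := (2 * D * m)%N.
have [z] : exists z, z \in (graph_ball x r :&: graph_ball y r)%SET.
  apply/card_gt0P; have := cardsUI (graph_ball x r) (graph_ball y r).
  have := graph_ball_large x Gm D0; have := graph_ball_large y Gm D0.
  rewrite -/r; have := max_card (mem (graph_ball x r :|: graph_ball y r)%SET).
  set a := #|_|; set b := #|_|; set c := #|_|; set d := #|_|; set e := #|_|; lia.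
rewrite inE => /andP[/graph_ball_path[p [px pz pr]] /graph_ball_path[q [qy qz qr]]].
exists (p ++ rev (belast y q)).
rewrite cat_path last_cat px pz -qz rev_path size_cat size_rev size_belast.
split=> //.
- by rewrite /= (eq_path (e' := @adj G))// => u v; rewrite adj_sym.
- by case: q {qy qz qr} => //= w q; rewrite rev_cons last_rcons.
- by move: pr qr; rewrite /r; clear; lia.
Qed.

End BallGrowth.

(** * Poincare inequalities on graphs and their box products *)

Section Cheeger.
Variables (R : realFieldType) (G : graph) (D : nat).
Hypothesis degD : forall v : G, (degree v <= D)%N.
Hypothesis expG : edge_expander G.
Implicit Types (f g : G -> R).

(** The sum runs over ordered pairs, so that it counts every edge twice. *)
Definition dirichlet f : R := \sum_v \sum_(w | adj v w) (f v - f w) ^+ 2.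

Definition mean f : R := (\sum_v f v) / #|G|%:R.

Lemma sum_cut (S : {set G}) :
  \sum_v \sum_(w | adj v w) ((v \in S) != (w \in S))%:R
  = (2 * cut_size S (~: S))%:R :> R.
Proof.
have cutE (A B : {set G}) : (cut_size A B)%:R =
    \sum_v \sum_(w | adj v w) ((v \in A) && (w \in B))%:R :> R.
  rewrite pair_big_dep /= /cut_size -sum1_card natr_sum.
  transitivity (\sum_(ab : G * G | adj ab.1 ab.2 &&
     ((ab.1 \in A) && (ab.2 \in B))) 1 : R).
    by apply: eq_bigl => ab; rewrite !inE andbC.
  by rewrite big_mkcondr /=; apply: eq_bigr => ab _; case: (_ && _).
rewrite mul2n -addnn natrD {2}(_ : cut_size _ _ = cut_size (~: S)%SET S).
  rewrite !cutE -big_split; apply: eq_bigr => v _ /=.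
  rewrite -big_split; apply: eq_bigr => w _ /=; rewrite !inE.
  by case: (v \in S); case: (w \in S); rewrite /= ?addr0 ?add0r.
have swap_inj : injective (fun ab : G * G => (ab.2, ab.1)).
  by move=> [a b] [a' b'] /= [-> ->].
rewrite /cut_size -(card_imset _ swap_inj); apply: eq_card => -[a b].
apply/imsetP/idP => [[[c d]]|].
  by rewrite !inE /= => /andP[/andP[cS dS] cd] [-> ->]; rewrite dS cS adj_sym cd.
rewrite !inE /= => /andP[/andP[aS bS] ab]; exists (b, a) => //.
by rewrite !inE /= bS aS adj_sym ab.
Qed.

(** Induction on the support of [f]. Subtracting the least non-zero value on the
    whole support decreases both sides in a controlled way, by expansion of the
    support, and makes the support smaller. *)
Lemma coarea f : (forall v, 0 <= f v) ->
  (2 * #|[set v | (f v != 0)%R]%SET| <= #|G|)%N ->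
  \sum_v f v <= \sum_v \sum_(w | adj v w) `|f v - f w|.
Proof.
have [k] := ubnP #|[set v | f v != 0]%SET|.
elim: k f => // k IH f; set S := [set v | f v != 0]%SET => kS f0 half.
have fS v : (v \in S) = (f v != 0) by rewrite inE.
have [S0|/finset.set0Pn[v0 v0S]] := eqVneq S finset.set0.
  rewrite big1 => [|v _]; last by apply/eqP/negPn; rewrite -fS S0 inE.
  by do 2 apply: sumr_ge0 => ? _.
pose u := [arg min_(v < v0 | v \in S) f v]%O.
have [uS umin] : u \in S /\ forall v, v \in S -> f u <= f v.
  by rewrite /u; case: arg_minP.
pose c := f u; have c0 : 0 < c by rewrite lt0r f0 andbT -fS.
pose f' v := f v - c * (v \in S)%:R.
have f'0 v : 0 <= f' v.
  rewrite /f'; case: (boolP (v \in S)) => vS; last by rewrite mulr0 subr0.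
  by rewrite mulr1 subr_ge0 umin.
have sub : [set v | f' v != 0]%SET \subset (S :\ u)%SET.
  apply/fintype.subsetP => v; rewrite in_setD1 fS inE; apply: contraR.
  rewrite negb_and !negbK /f' => /orP[/eqP ->|/eqP v0'].
    by rewrite uS mulr1 subrr.
  by rewrite fS v0' eqxx mulr0 subr0.
have lt : (#|[set v | (f' v != 0)%R]%SET| < #|S|)%N.
  by apply: leq_ltn_trans (subset_leq_card sub) _; rewrite [ltnRHS](cardsD1 u) uS.
have {IH} := IH f' _ f'0 _.
move=> /(_ (leq_trans lt kS)) /(_ (leq_trans (leq_mul (leqnn 2) (ltnW lt)) half)).
have -> : \sum_v f v = \sum_v f' v + c * #|S|%:R.
  rewrite -sum1_card natr_sum mulr_sumr [X in _ + X]big_mkcond -big_split /=.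
  apply: eq_bigr => v _; rewrite /f'; case: (v \in S) => /=; ring.
have -> : \sum_v \sum_(w | adj v w) `|f v - f w| =
  \sum_v \sum_(w | adj v w) `|f' v - f' w| +
  c * (\sum_v \sum_(w | adj v w) ((v \in S) != (w \in S))%:R).
  rewrite mulr_sumr -big_split; apply: eq_bigr => v _ /=.
  rewrite mulr_sumr -big_split; apply: eq_bigr => w _ /=.
  rewrite /f'; case: (boolP (v \in S)) => vS; case: (boolP (w \in S)) => wS /=.
  - by rewrite mulr0 addr0; congr `|_|; ring.
  - have := umin v vS; rewrite -/c => cv; rewrite inE negbK in wS.
    by rewrite (eqP wS) !(subr0, mulr0, mulr1) !ger0_norm ?subrK ?subr_ge0.
  - have := umin w wS; rewrite -/c => cw; rewrite inE negbK in vS.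
    rewrite (eqP vS) mulr0 !mulr1 subr0 !sub0r !normrN.
    by rewrite !ger0_norm ?subrK ?subr_ge0.
  - by rewrite !mulr0 !subr0 addr0.
rewrite sum_cut => IH; apply: lerD => //; rewrite ler_wpM2l ?(ltW c0)//.
by rewrite ler_nat ltnW// expG//; apply/card_gt0P; exists v0.
Qed.

(** The co-area inequality for [g ^+ 2], where [`|g v ^+ 2 - g w ^+ 2|] is the
    product of [`|g v - g w|] and [g v + g w]. The arithmetic-geometric mean
    inequality separates the factors, with weights for which the second part is
    at most half of the left-hand side. *)
Lemma dirichlet_half g : (forall v, 0 <= g v) ->
  (2 * #|[set v | (g v != 0)%R]%SET| <= #|G|)%N ->
  \sum_v g v ^+ 2 <= 4 * D%:R * dirichlet g.
Proof.
move=> g0 half.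
have [D0|Dpos] := posnP D.
  have [S0|/finset.set0Pn[v vS]] := eqVneq [set v | g v != 0]%SET finset.set0.
    rewrite big1 => [|v _]; last first.
      apply/eqP; rewrite expf_eq0 /=; apply/negPn/negP => gv.
      by move/setP/(_ v): S0; rewrite !inE gv.
    by rewrite D0 mulr0 mul0r.
  have S0 : (0 < #|[set v | (g v != 0)%R]%SET|)%N by apply/card_gt0P; exists v.
  have := expG S0 half; rewrite [cut_size _ _]eq_card0 ?muln0 ?ltn0// => -[a b].
  rewrite !inE; apply/negP => /andP[_ ab]; move: (degD a).
  by rewrite D0 leqn0 => /eqP/card0_eq/(_ b); rewrite inE ab.
have D0 : 0 < D%:R :> R by rewrite ltr0n.
have := @coarea (fun v => g v ^+ 2) (fun v => sqr_ge0 _).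
rewrite (_ : [set v | g v ^+ 2 != 0]%SET = [set v | g v != 0]%SET); last first.
  by apply/setP => v; rewrite !inE expf_eq0.
move=> /(_ half) h.
have {}h : \sum_v g v ^+ 2 <= 2 * D%:R * dirichlet g +
    (8 * D%:R)^-1 * \sum_v \sum_(w | adj v w) (g v + g w) ^+ 2.
  apply: le_trans h _; rewrite /dirichlet !mulr_sumr -big_split.
  apply: ler_sum => v _; rewrite !mulr_sumr -big_split; apply: ler_sum => w _ /=.
  rewrite subr_sqr normrM (ger0_norm (addr_ge0 (g0 v) (g0 w))).
  rewrite -[(g v - g w) ^+ 2]real_normK ?num_real//.
  set a := `|_|; set b := g v + g w.
  rewrite -subr_ge0.
  have -> : 2 * D%:R * a ^+ 2 + (8 * D%:R)^-1 * b ^+ 2 - a * b =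
     (8 * D%:R)^-1 * (4 * D%:R * a - b) ^+ 2 by field; rewrite gt_eqF.
  by apply: mulr_ge0; [rewrite invr_ge0 mulr_ge0 ?(ltW D0)|exact: sqr_ge0].
have deg_sum (F : G -> R) : (forall v, 0 <= F v) ->
    \sum_v \sum_(w | adj v w) F v <= D%:R * \sum_v F v.
  move=> F0; rewrite mulr_sumr; apply: ler_sum => v _.
  rewrite (eq_bigl (mem [set w | adj v w]%SET)); last by move=> w; rewrite /= inE.
  by rewrite sumr_const -[leLHS]mulr_natl ler_wpM2r// ler_nat; exact: degD.
have s0 v : 0 <= g v ^+ 2 by apply: sqr_ge0.
have h2 : \sum_v \sum_(w | adj v w) (g v + g w) ^+ 2 <=
    4 * D%:R * \sum_v g v ^+ 2.
  apply: (@le_trans _ _ (\sum_v \sum_(w | adj v w) (2 * g v ^+ 2) +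
                         \sum_v \sum_(w | adj v w) (2 * g w ^+ 2))).
    rewrite -big_split; apply: ler_sum => v _; rewrite -big_split.
    by apply: ler_sum => w _ /=; have := sqr_ge0 (g v - g w); nra.
  rewrite [X in _ + X](exchange_big_dep xpredT)//=.
  under [X in _ + X]eq_bigr do under eq_bigl do rewrite adj_sym.
  have t0 v : 0 <= 2 * g v ^+ 2 by rewrite mulr_ge0.
  have := deg_sum _ t0; rewrite -(mulr_sumr _ _ _ 2).
  by move=> ?; lra.
have : (8 * D%:R)^-1 * \sum_v \sum_(w | adj v w) (g v + g w) ^+ 2 <=
    2^-1 * \sum_v g v ^+ 2.
  rewrite ler_pdivrMl ?mulr_gt0//; apply: le_trans h2 _.
  by rewrite mulrA le_eqVlt; apply/orP; left; apply/eqP; congr (_ * _); field.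
by move=> h3; move: (le_trans h (lerD (lexx _) h3)); lra.
Qed.

Lemma exists_median f : (0 < #|G|)%N -> exists m : R,
  (2 * #|[set v | (m < f v)%R]%SET| <= #|G|)%N /\
  (2 * #|[set v | (f v < m)%R]%SET| <= #|G|)%N.
Proof.
case/card_gt0P => v0 _.
pose below (c : R) := [set v | f v <= c]%SET.
pose P v := (#|G| <= 2 * #|below (f v)|)%N.
pose top := [arg max_(v > v0) f v]%O.
have Ptop : P top.
  rewrite /P (_ : below _ = [set: G]%SET) ?cardsT ?leq_pmull//.
  apply/setP => v; rewrite !inE /top.
  by case: arg_maxP => // w _ wmax; apply/wmax.
pose u := [arg min_(v < top | P v) f v]%O.
have [Pu umin] : P u /\ forall v, P v -> f u <= f v.
  by rewrite /u; case: arg_minP.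
exists (f u); split.
  rewrite (_ : [set v | _]%SET = ~: below (f u))%SET; last first.
    by apply/setP => v; rewrite !inE ltNge.
  by move: Pu; rewrite /P; have := cardsC (below (f u)); lia.
set S := [set v | _]%SET.
have [->|/finset.set0Pn[v1 v1S]] := eqVneq S finset.set0; first by rewrite cards0.
pose w := [arg max_(v > v1 | v \in S) f v]%O.
have [wS wmax] : w \in S /\ forall v, v \in S -> f v <= f w.
  by rewrite /w; case: arg_maxP.
have SE : S = below (f w).
  apply/setP => v; apply/idP/idP => [/wmax|]; rewrite !inE// => vw.
  by apply: le_lt_trans vw _; rewrite inE in wS.
rewrite leqNgt; apply/negP => h.
have /umin : P w by rewrite /P -SE ltnW.
by rewrite leNgt; rewrite inE in wS; rewrite wS.
Qed.

End Cheeger.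

Section Poincare.
Variable R : realFieldType.

(** The parallel axis theorem of Steiner. *)
Lemma sum_sqr_mean (G : graph) (f : G -> R) c : (0 < #|G|)%N ->
  \sum_v (f v - c) ^+ 2 =
  \sum_v (f v - mean f) ^+ 2 + #|G|%:R * (mean f - c) ^+ 2.
Proof.
move=> G0; have nG : #|G|%:R != 0 :> R by rewrite pnatr_eq0 -lt0n.
have E : \sum_v f v = #|G|%:R * mean f by rewrite /mean mulrC divfK.
have exp (a : R) : \sum_v (f v - a) ^+ 2 =
    \sum_v f v ^+ 2 - 2 * a * \sum_v f v + #|G|%:R * a ^+ 2.
  rewrite -sum1_card natr_sum mulr_sumr mulr_suml -sumrB -big_split.
  by apply: eq_bigr => v _ /=; ring.
by rewrite !exp E; ring.
Qed.

Definition poincare (G : graph) (C : R) : Prop := forall f : G -> R,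
  \sum_v (f v - mean f) ^+ 2 <= C * dirichlet f.

(** The parts of [f] above and below a median have supports of at most half of
    the vertices. *)
Lemma poincare_expander (G : graph) (D : nat) : (0 < #|G|)%N ->
  (forall v : G, (degree v <= D)%N) -> edge_expander G ->
  poincare G (4 * D%:R).
Proof.
move=> G0 degD expG f; have [m [above below]] := exists_median f G0.
pose fp v := Num.max (f v - m) 0; pose fm v := Num.max (m - f v) 0.
have hp := @dirichlet_half R G D degD expG fp.
have hm := @dirichlet_half R G D degD expG fm.
apply: (@le_trans _ _ (\sum_v (f v - m) ^+ 2)).
  by rewrite (sum_sqr_mean f m)// lerDl mulr_ge0 ?sqr_ge0.
have -> : \sum_v (f v - m) ^+ 2 = \sum_v fp v ^+ 2 + \sum_v fm v ^+ 2.
  rewrite -big_split; apply: eq_bigr => v _ /=; rewrite /fp /fm /Num.max.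
  by case: (ltP (f v - m) 0) => h1; case: (ltP (m - f v) 0) => h2; nra.
have hsum : dirichlet fp + dirichlet fm <= dirichlet f.
  rewrite /dirichlet -big_split; apply: ler_sum => v _ /=.
  rewrite -big_split; apply: ler_sum => w _ /=; rewrite /fp /fm /Num.max.
  case: (ltP (f v - m) 0) => h1; case: (ltP (m - f v) 0) => h2;
    case: (ltP (f w - m) 0) => h3; case: (ltP (m - f w) 0) => h4; nra.
apply: (@le_trans _ _ (4 * D%:R * (dirichlet fp + dirichlet fm))); last first.
  by rewrite ler_wpM2l ?mulr_ge0.
rewrite mulrDr lerD//.
  apply: hp => [v|]; first by rewrite le_max lexx orbT.
  rewrite (_ : [set v | _]%SET = [set v | (m < f v)%R]%SET)//.
  apply/setP => v; rewrite !inE /fp /Num.max; case: (ltP (f v - m) 0) => h.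
    by rewrite eqxx; apply/esym/negbTE; rewrite -leNgt; lra.
  by rewrite subr_eq0 lt_neqAle eq_sym -(subr_ge0 m) h andbT.
apply: hm => [v|]; first by rewrite le_max lexx orbT.
rewrite (_ : [set v | _]%SET = [set v | (f v < m)%R]%SET)//.
apply/setP => v; rewrite !inE /fm /Num.max; case: (ltP (m - f v) 0) => h.
  by rewrite eqxx; apply/esym/negbTE; rewrite -leNgt; lra.
by rewrite subr_eq0 lt_neqAle eq_sym -(subr_ge0 (f v)) h andbT.
Qed.

End Poincare.

Section BoxProduct.
Variables A B : graph.

Definition box_adj : rel (A * B) := fun x y =>
  (adj x.1 y.1 && (x.2 == y.2)) || ((x.1 == y.1) && adj x.2 y.2).

Lemma box_adj_sym : symmetric box_adj.
Proof.
by move=> x y; rewrite /box_adj adj_sym [adj x.2 _]adj_sym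
  [x.1 == _]eq_sym [x.2 == _]eq_sym.
Qed.

Lemma box_adj_irr : irreflexive box_adj.
Proof. by move=> x; rewrite /box_adj !adj_irr andbF. Qed.

Definition box_graph : graph := Graph box_adj_sym box_adj_irr.

Lemma sum_box_adj (R : realFieldType) (F : A * B -> A * B -> R) (x : A * B) :
  \sum_(y | box_adj x y) F x y =
  \sum_(a | adj x.1 a) F x (a, x.2) + \sum_(b | adj x.2 b) F x (x.1, b).
Proof.
rewrite (bigID (fun y : A * B => x.2 == y.2)) /=; congr (_ + _).
  transitivity (\sum_(y : A * B | adj x.1 y.1 && (y.2 == x.2)) F x (y.1, y.2)).
    apply: eq_big => [y|[]//]; rewrite /box_adj [x.2 == _]eq_sym.
    case: (altP (y.2 =P x.2)) => [->|]; last by rewrite !andbF.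
    by rewrite !adj_irr !andbF !andbT orbF.
  rewrite -(pair_big_dep _ (fun _ b => b == x.2) (fun a b => F x (a, b))) /=.
  by apply: eq_bigr => a _; rewrite big_pred1_eq.
transitivity (\sum_(y : A * B | (y.1 == x.1) && adj x.2 y.2) F x (y.1, y.2)).
  apply: eq_big => [y|[]//]; rewrite /box_adj [x.2 == _]eq_sym [x.1 == _]eq_sym.
  case: (altP (y.2 =P x.2)) => [->|]; first by rewrite !adj_irr !andbF.
  by rewrite !andbF orFb andbT.
rewrite -(pair_big_dep (fun a => a == x.1) (fun _ b => adj x.2 b)
  (fun a b => F x (a, b))) /=.
by rewrite big_pred1_eq.
Qed.

(** The variance is the sum of the variances on the fibres and the variance of
    the fibre means. By convexity the fibre means have at most the energy of [f]
    along the other factor. *)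
Lemma poincare_box (R : realFieldType) (C : R) : (0 < #|A|)%N -> (0 < #|B|)%N ->
  0 <= C -> poincare A C -> poincare B C -> poincare box_graph C.
Proof.
move=> A0 B0 C0 pA pB f.
pose g b := mean (fun a : A => f (a, b)).
have nA : #|A|%:R != 0 :> R by rewrite pnatr_eq0 -lt0n.
have nB : #|B|%:R != 0 :> R by rewrite pnatr_eq0 -lt0n.
have pair (F : A * B -> R) : \sum_x F x = \sum_b \sum_a F (a, b).
  by rewrite exchange_big pair_bigA; apply: eq_bigr => -[].
have fg : mean f = mean (g : B -> R).
  by rewrite /mean pair card_prod natrM invfM mulrA mulr_suml.
have E1 : \sum_(v : box_graph) (f v - mean f) ^+ 2 =
    \sum_b \sum_a (f (a, b) - g b) ^+ 2 + #|A|%:R * \sum_b (g b - mean f) ^+ 2.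
  rewrite [LHS]pair mulr_sumr -big_split; apply: eq_bigr => b _ /=.
  exact: (sum_sqr_mean (fun a : A => f (a, b)) (mean f) A0).
have E2 : dirichlet f = \sum_b dirichlet (fun a : A => f (a, b)) +
    \sum_a dirichlet (fun b : B => f (a, b)).
  rewrite /dirichlet [LHS](eq_bigr _ (fun x _ =>
    sum_box_adj (fun x y => (f x - f y) ^+ 2) x)) big_split /= [X in X + _]pair.
  by congr (_ + _); rewrite pair exchange_big.
rewrite E2 E1.
rewrite mulrDr [X in _ <= X + _]mulr_sumr lerD//; first by apply: ler_sum => b _; exact: pA.
rewrite fg; apply: le_trans (ler_wpM2l (ler0n _ _) (pB g)) _.
rewrite mulrCA ler_wpM2l// /dirichlet mulr_sumr exchange_big /=.
apply: ler_sum => b _; rewrite mulr_sumr exchange_big /=; apply: ler_sum => b' _.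
have := sum_sqr_mean (fun a : A => f (a, b) - f (a, b')) 0 A0.
rewrite (_ : mean _ = g b - g b'); last by rewrite /g /mean -mulrBl sumrB.
rewrite (eq_bigr (fun a => (f (a, b) - f (a, b')) ^+ 2)) => [->|a _]; last first.
  by rewrite subr0.
by rewrite subr0 lerDr sumr_ge0// => a _; exact: sqr_ge0.
Qed.

End BoxProduct.

(** * The graph metric and expanders of large girth *)

Section GraphDistance.
Variable G : graph.

Definition reach (n : nat) (x y : G) : bool :=
  [exists p : n.-tuple G, path (@adj G) x p && (last x p == y)].

Lemma reachP n x y :
  reflect (exists p, [/\ path (@adj G) x p, last x p = y & size p = n])
          (reach n x y).
Proof.
apply: (iffP existsP) => [[p /andP[xp /eqP py]]|[p [xp py <-]]].
  by exists p; rewrite size_tuple.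
by exists (in_tuple p); rewrite xp py eqxx.
Qed.

(** Since a shortest path does not repeat vertices, lengths below the number of
    vertices suffice. *)
Definition gdist (x y : G) : nat := find (fun n => reach n x y) (iota 0 #|G|).

Lemma gdist_min x y p : path (@adj G) x p -> last x p = y ->
  (gdist x y <= size p)%N.
Proof.
move=> xp py; have [Gp|pG] := leqP #|G| (size p).
  by apply: leq_trans Gp; rewrite -[leqRHS](size_iota 0); apply: find_size.
rewrite leqNgt; apply/negP => h; have := before_find 0 h.
by rewrite nth_iota// add0n => /reachP; apply; exists p.
Qed.

Hypothesis cG : forall x y : G, connect (@adj G) x y.

Lemma gdist_path x y :
  exists p, [/\ path (@adj G) x p, last x p = y & size p = gdist x y].
Proof.
apply/reachP; have /connectP[p] := cG x y.
case/shortenP => p' xp' up' _ ->.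
have pG : (size p' < #|G|)%N.
  by rewrite -[X in (X <= _)%N]/(size (x :: p')) -(card_uniqP up') max_card.
have h : has (fun n => reach n x (last x p')) (iota 0 #|G|).
  by apply/hasP; exists (size p'); [rewrite mem_iota|apply/reachP; exists p'].
have := nth_find 0 h; rewrite -/(gdist _ _) nth_iota ?add0n//.
by rewrite -[ltnRHS](size_iota 0) -has_find.
Qed.

Lemma gdistxx x : gdist x x = 0%N.
Proof. by apply/eqP; rewrite -leqn0 (@gdist_min x x [::]). Qed.

Lemma gdist_eq0 x y : gdist x y = 0%N -> x = y.
Proof. by have [p [_ py <-]] := gdist_path x y; case: p py. Qed.

Lemma gdist_triangle y x z : (gdist x z <= gdist x y + gdist y z)%N.
Proof.
have [p [xp py <-]] := gdist_path x y; have [q [yq qz <-]] := gdist_path y z.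
by rewrite -size_cat; apply: gdist_min; rewrite ?cat_path ?last_cat ?py ?xp.
Qed.

Lemma gdist_sym_le x y : (gdist y x <= gdist x y)%N.
Proof.
have [p [xp py <-]] := gdist_path x y.
have <- : size (rev (belast x p)) = size p by rewrite size_rev size_belast.
apply: gdist_min.
  rewrite -py rev_path (eq_path (e' := @adj G))// => u v; exact: adj_sym.
by case: p {xp} py => //= w p _; rewrite rev_cons last_rcons.
Qed.

Lemma gdist_sym x y : gdist x y = gdist y x.
Proof. by apply/eqP; rewrite eqn_leq !gdist_sym_le. Qed.

Lemma gdist_adj x y : adj x y -> (gdist x y <= 1)%N.
Proof. by move=> xy; apply: (@gdist_min x y [:: y]); rewrite //= xy. Qed.

Lemma graph_distE (R : realType) x y :
  graph_dist R x y = (gdist x y)%:R%:E.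
Proof.
apply/eqP; rewrite eq_le; apply/andP; split.
  have [p [xp py <-]] := gdist_path x y.
  by apply: ereal_inf_lbound; exists p.
apply: le_ereal_inf_tmp => _ [p [xp py] <-].
by rewrite lee_fin ler_nat gdist_min.
Qed.

End GraphDistance.

Lemma connected_graph_adj (G : graph) : connected_graph G -> (1 < #|G|)%N ->
  forall v : G, exists w, adj v w.
Proof.
move=> [_ cG] G1 v; have [w vw] : exists w, w != v.
  have : (0 < #|[set~ v]%SET|)%N by rewrite cardsC1; lia.
  by case/card_gt0P => w; rewrite !inE => wv; exists w.
have [p [vp pw _]] := gdist_path cG v w.
case: p vp pw => [_ vw'|u p /= /andP[vu _] _]; first by rewrite -vw' eqxx in vw.
by exists u.
Qed.

(** For girth [g = 2 k + 8] the graphs have at most [2 ^ (b g)] vertices, and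
    therefore diameter at most [4 D b g]. *)
Lemma expander_high_girth : exists D K : nat, exists L : nat -> graph, forall k,
  [/\ connected_graph (L k) /\ (k.+1 < #|L k|)%N,
      forall v : L k, (degree v <= D)%N,
      girth_ge (L k) (2 * k + 8),
      edge_expander (L k) &
      forall x y : L k, (gdist x y <= K * k.+1)%N].
Proof.
have [D [b [D0 b0 HG]]] := sparse_expanding_graph.
exists D, (32 * D * b)%N.
suff H k : exists L : graph,
  [/\ connected_graph L /\ (k.+1 < #|L|)%N,
      forall v : L, (degree v <= D)%N,
      girth_ge L (2 * k + 8), edge_expander L &
      forall x y : L, (gdist x y <= 32 * D * b * k.+1)%N].
  by have [L LP] := choice H; exists L.
have [//|G [nG gG dG cG]] := HG (2 * k + 8)%N; first by rewrite addn_gt0 orbT.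
have [U [nU eU]] := expander_core cG.
pose L := induced_graph U.
have nL : #|L| = #|U| by rewrite card_sig; apply: eq_card => x; rewrite inE.
have Lm : (#|L| <= 2 ^ (b * (2 * k + 8)))%N by rewrite nL -nG max_card.
have dL := @degree_induced G U D dG.
have short x y : exists p, [/\ path (@adj L) x p, last x p = y &
    (size p <= 32 * D * b * k.+1)%N].
  have [p [xp py pm]] := @expander_short_paths L D dL eU x y _ Lm D0.
  exists p; split=> //; apply: leq_trans pm _; clear.
  apply: (@leq_trans (4 * D * (b * (8 * k.+1)))).
    by apply: leq_mul => //; apply: leq_mul => //; lia.
  by rewrite (_ : 4 * D * (b * (8 * k.+1)) = 32 * D * b * k.+1)%N//; ring.
have big : (k.+1 < #|L|)%N.
  have : (2 ^ (2 * k + 8) <= 2 * #|L|)%N.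
    by rewrite nL; apply: leq_trans nU; rewrite nG leq_pexp2l// leq_pmull.
  have := ltn_expl (2 * k + 7) (ltnSn 1).
  rewrite (_ : 2 * k + 8 = (2 * k + 7).+1)%N; last by rewrite addnS.
  by rewrite expnS; set u := (2 ^ _)%N; lia.
exists L; split=> //; last 2 first.
- exact: girth_induced.
- by move=> x y; have [p [xp py pK]] := short x y; apply: leq_trans (gdist_min xp py) pK.
split=> //; split; first exact: leq_trans big.
by move=> x y; have [p [xp py _]] := short x y; apply/connectP; exists p.
Qed.

(** * Hilbert space valued functions *)

Section HilbertPoincare.
Context (R : realType) (E : completeNormedModType R).
Hypothesis hE : hilbert E.

(** Splitting off the component along one unit vector, which makes one value of
    [f] vanish, reduces the inequality for [E]-valued maps to the real one. *)
Lemma hilbert_poincare (G : graph) (C : R) (f : G -> E) : poincare G C ->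
  \sum_v `|f v - vertex_mean f| ^+ 2 <=
  C * \sum_v \sum_(w | adj v w) `|f v - f w| ^+ 2.
Proof.
case: hE => dot dotE pG.
have [k] := ubnP #|[set v | f v != 0]%SET|.
elim: k f => // k IH f; set S := [set v | f v != 0]%SET => kS.
have [S0|/finset.set0Pn[v0 v0S]] := eqVneq S finset.set0.
  have f0 v : f v = 0.
    by move/setP/(_ v): S0; rewrite !inE => /negbFE/eqP.
  have m0 : vertex_mean f = 0.
    by rewrite /vertex_mean big1 ?scaler0// => v _; exact: f0.
  rewrite big1 => [|v _]; last by rewrite f0 m0 subr0 normr0 expr0n.
  rewrite big1 ?mulr0// => v _; rewrite big1// => w _.
  by rewrite !f0 subr0 normr0 expr0n.
have fv0 : `|f v0| != 0 by rewrite normr_eq0; move: v0S; rewrite inE.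
pose e := `|f v0|^-1 *: f v0.
have e1 : dot e e = 1.
  by rewrite dotE normrZ normfV normr_id mulVf// expr1n.
have fe : f v0 = `|f v0| *: e by rewrite scalerA mulfV// scale1r.
move: e e1 fe => e e1 fe.
have dotC x y : dot x y = dot y x by rewrite hermC expr0 mul1r.
pose p x : E := x - dot x e *: e.
have pythagoras x : `|x| ^+ 2 = dot x e ^+ 2 + `|p x| ^+ 2.
  rewrite -!dotE /p linearBl !linearBr !linearZl_LR !linearZr_LR /= e1 mulr1.
  by rewrite [dot e x]dotC /GRing.scale /=; ring.
have pB x y : p (x - y) = p x - p y.
  by rewrite /p linearBl scalerBl [- (_ - _)]opprD addrACA -opprD.
have pf_mean : p (vertex_mean f) = vertex_mean (p \o f).
  rewrite /p /vertex_mean linearZl_LR /= linear_sumlz -scalerA -scalerBr.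
  congr (_ *: _); rewrite scaler_suml -sumrB; exact: eq_bigr.
have cf_mean : dot (vertex_mean f) e = mean (fun v => dot (f v) e).
  by rewrite /vertex_mean linearZl_LR linear_sumlz mulrC.
have lt : (#|[set v | ((p \o f) v != 0)%R]%SET| < #|S|)%N.
  apply: (@leq_ltn_trans #|(S :\ v0)%SET|).
    apply: subset_leq_card; apply/fintype.subsetP => v.
    rewrite in_setD1 !inE /=; apply: contraR; rewrite negb_and !negbK.
    case/orP => /eqP E0; last by rewrite E0 /p linear0l scale0r subr0.
    by rewrite E0 /p {1 2}fe linearZl_LR /= e1 mulr1 subrr.
  by rewrite [ltnRHS](cardsD1 v0) v0S.
have := IH (p \o f) (leq_trans lt kS).
have := pG (fun v => dot (f v) e); rewrite /dirichlet => h1 h2.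
have := lerD h1 h2; rewrite -mulrDr -!big_split /=.
rewrite (eq_bigr (fun v => `|f v - vertex_mean f| ^+ 2)); last first.
  move=> v _; rewrite [RHS]pythagoras pB pf_mean linearBl.
  by congr ((_ - _) ^+ 2 + _); exact: esym cf_mean.
congr (_ <= C * _); apply: eq_bigr => v _; rewrite -big_split.
by apply: eq_bigr => w _ /=; rewrite [RHS]pythagoras pB linearBl.
Qed.

End HilbertPoincare.

Lemma expander_family_poincare (R : realType) (G : nat -> graph) (C : R) :
  (forall l, connected_graph (G l)) -> bounded_degree G ->
  (forall l, (l <= #|G l|)%N) -> 0 < C ->
  (forall l, poincare (G l) C) -> expander_family R G.
Proof.
move=> cG bG nG C0 pG; split=> // [|E hE].
  apply/cvgnyPge => A; exists A => // l /= Al; exact: leq_trans (nG l).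
(* The energy counts every edge once, the double sum twice. *)
exists (2 * C); first by rewrite mulr_gt0.
move=> l f; apply: le_trans (hilbert_poincare hE f (pG l)) _.
rewrite /edge_energy le_eqVlt; apply/orP; left; apply/eqP.
by rewrite [2 * C]mulrC -mulrA [2 * _]mulrA mulfV ?mul1r// pnatr_eq0.
Qed.

(** * Square integrable functions *)

Section L2Poincare.
Context (R : realType).
Local Notation L2 := (LfunType (@lebesgue01 R) (lee1n 2)).
Local Notation mu := (@lebesgue01 R).

Lemma L2_norm_ge0 (f : L2) : 0 <= L2_norm f.
Proof. by apply: fine_ge0; exact: Lnorm_ge0. Qed.

Lemma L2_measurable (f : L2) : measurable_fun setT (f : R -> R).
Proof. exact: (@measurable_funPT _ _ _ _ f). Qed.

Lemma L2_sqr_measurable (f : L2) :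
  measurable_fun setT (EFin \o (fun x => f x ^+ 2 : R)).
Proof. by apply/measurable_EFinP; apply: measurable_funX; exact: L2_measurable. Qed.

Lemma L2_norm_sqr (f : L2) :
  ((L2_norm f ^+ 2)%:E = \int[mu]_x ((f x ^+ 2)%:E))%E.
Proof.
have r20 : (2%:R : R) != 0 by rewrite pnatr_eq0.
rewrite -powR_mulrn ?L2_norm_ge0// -poweR_EFin /L2_norm finite_norm_fine.
rewrite poweR_Lnorm//; apply: eq_integral => x _.
rewrite -[(EFin \o f) x]/((f x)%:E) abse_EFin poweR_EFin powR_mulrn//.
by rewrite real_normK ?num_real.
Qed.

Lemma L2_sum (I : Type) (r : seq I) (P : pred I) (F : I -> L2) (x : R) :
  (\sum_(i <- r | P i) F i) x = \sum_(i <- r | P i) F i x.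
Proof. by elim/big_ind2 : _ => // f a g b <- <-. Qed.

Lemma L2_integral_sum (I : Type) (r : seq I) (P : pred I) (F : I -> L2) :
  ((\sum_(i <- r | P i) L2_norm (F i) ^+ 2)%:E =
   \int[mu]_x (\sum_(i <- r | P i) F i x ^+ 2)%:E)%E.
Proof.
rewrite -big_filter -sumEFin (eq_bigr _ (fun i _ => L2_norm_sqr (F i))).
rewrite -ge0_integral_sum//.
- by apply: eq_integral => x _; rewrite sumEFin big_filter.
- by move=> i; exact: L2_sqr_measurable.
- by move=> i x _; rewrite lee_fin sqr_ge0.
Qed.

(** The squared norm of a square integrable function is the integral of its
    squared values, so the real inequality can be integrated. *)
Lemma L2_poincare (G : graph) (C : R) (f : G -> L2) : (0 < #|G|)%N -> 0 <= C ->
  poincare G C ->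
  \sum_v L2_norm (f v) ^+ 2 <=
  #|G|%:R * L2_norm (#|G|%:R^-1 *: \sum_v f v) ^+ 2 +
  C * \sum_v \sum_(w | adj v w) L2_norm (f v - f w) ^+ 2.
Proof.
move=> G0 C0 pG; set m := _ *: _.
have mE x : m x = mean (fun v => f v x).
  by rewrite /mean mulrC -L2_sum.
suff h : ((\sum_v L2_norm (f v) ^+ 2)%:E <= #|G|%:R%:E * (L2_norm m ^+ 2)%:E +
    C%:E * (\sum_(vw : G * G | adj vw.1 vw.2) L2_norm (f vw.1 - f vw.2) ^+ 2)%:E)%E.
  by move: h; rewrite -!EFinM -EFinD lee_fin pair_big_dep.
have msum (I : Type) (r : seq I) (P : pred I) (F : I -> L2) :
    measurable_fun setT (EFin \o (fun x => \sum_(i <- r | P i) F i x ^+ 2 : R)).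
  apply/measurable_EFinP.
  rewrite [X in measurable_fun _ X](_ : _ =
      fun x => \sum_(i <- [seq i <- r | P i]) F i x ^+ 2); last first.
    by apply/funext => x; rewrite big_filter.
  apply: measurable_sum => i.
  by apply: measurable_funX; exact: L2_measurable.
have sum0 (I : Type) (r : seq I) (P : pred I) (F : I -> L2) x :
    (0 <= (\sum_(i <- r | P i) F i x ^+ 2)%:E)%E.
  by rewrite lee_fin; apply: sumr_ge0 => i _; exact: sqr_ge0.
rewrite !L2_integral_sum L2_norm_sqr.
rewrite -ge0_integralZl_EFin//; last 2 first.
  by move=> x _; rewrite lee_fin sqr_ge0.
  exact: L2_sqr_measurable.
rewrite -ge0_integralZl_EFin//; last exact: msum.
rewrite -ge0_integralD//.
- apply: ge0_le_integral => //.
  + exact: msum.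
  + apply: emeasurable_funD; apply: measurable_funeM; last exact: msum.
    exact: L2_sqr_measurable.
  move=> x _; rewrite -!EFinM -EFinD lee_fin mE.
  have := sum_sqr_mean (fun v => f v x) 0 G0.
  under eq_bigr do rewrite subr0; rewrite subr0 => ->; rewrite addrC lerD2l.
  by apply: le_trans (pG _) _; rewrite /dirichlet pair_big_dep.
- by move=> x _; rewrite -EFinM lee_fin mulr_ge0 ?sqr_ge0.
- by apply: measurable_funeM; exact: L2_sqr_measurable.
- by move=> x _; rewrite mule_ge0// lee_fin.
- by apply: measurable_funeM; exact: msum.
Qed.

End L2Poincare.

(** * Concentration in CAT(0) spaces with invariant less than one *)

(** For graphs of bounded degree with a uniform Poincare inequality, Lipschitz
    maps bring half of the vertices into a ball whose radius depends on the
    constants only. As large graphs of bounded degree have no small part with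
    half of the vertices, this prevents uniform embeddings. *)
Definition concentrates (R : realType) (M : metricType R) : Prop :=
  forall (C L : R) (D : nat), 0 <= C -> exists r : R,
    forall (G : graph) (phi : G -> M), (0 < #|G|)%N ->
      (forall v : G, (degree v <= D)%N) -> poincare G C ->
      (forall v w, adj v w -> mdist (phi v) (phi w) <= L) ->
      exists x, (#|G| <= 2 * #|[set v | (mdist (phi v) x <= r)%R]%SET|)%N.

Lemma markov (R : realFieldType) (T : finType) (f : T -> R) (t : R) :
  0 <= t -> #|[set v | (t <= f v)%R]%SET|%:R * t ^+ 2 <= \sum_v f v ^+ 2.
Proof.
move=> t0; set S := [set v | _]%SET.
rewrite mulr_natl -sumr_const [leRHS](bigID (mem S)) /= -[leLHS]addr0 lerD//.
  by apply: ler_sum => v; rewrite inE => h; rewrite lerXn2r ?nnegrE ?(le_trans t0).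
by apply: sumr_ge0 => v _; exact: sqr_ge0.
Qed.

Lemma markov_half (R : realFieldType) (T : finType) (f : T -> R) (B : R) :
  0 <= B -> (forall v, 0 <= f v) -> \sum_v f v ^+ 2 <= #|T|%:R * B ->
  (#|T| <= 2 * #|[set v | (f v <= 2 * B + 1)%R]%SET|)%N.
Proof.
move=> B0 f0 sB; set S := [set v | _]%SET.
have t0 : 0 <= 2 * B + 1 by lra.
have : (#|~: S|%:R : R) * (2 * B + 1) ^+ 2 <= #|T|%:R * B.
  apply: le_trans (le_trans (markov f t0) sB).
  apply: ler_wpM2r; first exact: sqr_ge0.
  rewrite ler_nat; apply: subset_leq_card; apply/fintype.subsetP => v.
  by rewrite !inE -ltNge => /ltW.
rewrite -(cardsC S) => h; suff : (#|~: S| <= #|S|)%N by clear; lia.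
rewrite -(ler_nat R); move: h; rewrite natrD.
have := ler0n R #|~: S|; have := ler0n R #|S|.
move: (#|~: S|%:R : R) (#|S|%:R : R) => a b b0 a0 h.
rewrite leNgt; apply/negP => ba.
(* The radius is chosen so that its square exceeds [2 * B]. *)
have : a * (2 * B + 1) ^+ 2 <= (a + a) * B by apply: le_trans h _; nra.
have -> : a * (2 * B + 1) ^+ 2 = a * (4 * B ^+ 2 + 2 * B + 1) + (a + a) * B by ring.
rewrite gerDr leNgt => /negP; apply; apply: mulr_gt0; first lra.
by have := sqr_ge0 B; nra.
Qed.

Section IzekiNayatani.
Context (R : realType).
Local Notation L2 := (LfunType (@lebesgue01 R) (lee1n 2)).

Lemma lebesgue01_setT : lebesgue01 R setT = 1%E.
Proof.
rewrite -[LHS]/(lebesgue_measure ([set: R] `&` `[0, 1])%classic).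
by rewrite classical_sets.setTI lebesgue_measure_itv /= lte_fin ltr01 sube0.
Qed.

Lemma L2_unit : exists u : L2, forall a : R, L2_norm (a *: u) = `|a|.
Proof.
have h : (cst 1 : measurableTypeR R -> R) \in
    Lfun (@lebesgue01 R) (2%:R%:E).
  rewrite inE/=; apply/andP; split; rewrite inE//=.
  rewrite /finite_norm Lnorm_cst1 lebesgue01_setT poweR1r ltry//.
exists (Lfun_Sub (lee1n 2) h) => a.
apply/eqP; rewrite -(@eqrXn2 _ 2) ?L2_norm_ge0//; apply/eqP.
apply: EFin_inj; rewrite L2_norm_sqr real_normK ?num_real//.
rewrite (eq_integral (cst (a ^+ 2)%:E)) => [|x _]; last first.
  by congr ((_ ^+ 2)%:E); exact: mulr1.
by rewrite integral_cst// -[X in (_ * X)%E]/(lebesgue01 R setT) lebesgue01_setT mule1.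
Qed.

(** The weights on the left are those of the push-forward under [idx] of the
    uniform measure. *)
Lemma sum_fibres (V : lmodType R) (G I : finType) (idx : G -> I) (F : I -> V) :
  \sum_i (#|[set v | idx v == i]%SET|%:R / #|G|%:R) *: F i =
  #|G|%:R^-1 *: \sum_v F (idx v).
Proof.
rewrite scaler_sumr (partition_big idx xpredT)//=; apply: eq_bigr => i _.
rewrite (eq_bigr (fun=> #|G|%:R^-1 *: F i)) => [|v /eqP <-//].
rewrite sumr_const -[RHS]scaler_nat scalerA; congr ((_%:R * _) *: _).
by apply: eq_card => v; rewrite inE.
Qed.

Lemma jensen_sqr (I : finType) (w d : I -> R) :
  (forall i, 0 <= w i) -> \sum_i w i = 1 ->
  (\sum_i w i * d i) ^+ 2 <= \sum_i w i * d i ^+ 2.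
Proof.
move=> w0 w1; set m := \sum_i w i * d i.
have : 0 <= \sum_i w i * (d i - m) ^+ 2.
  by apply: sumr_ge0 => i _; rewrite mulr_ge0 ?sqr_ge0.
have -> : \sum_i w i * (d i - m) ^+ 2 =
    \sum_i w i * d i ^+ 2 - 2 * m * m + (\sum_i w i) * m ^+ 2.
  rewrite /m mulr_sumr mulr_suml -/m -sumrB -big_split /=.
  by apply: eq_bigr => i _; ring.
by rewrite w1; move: (\sum_i w i * d i ^+ 2) => s; nra.
Qed.

Section Measure.
Variables (M : metricType R) (mu : fs_prob M).

(** The set of which [IN_delta_measure mu] is the infimum. *)
Definition IN_values : set R := [set r : R | exists f : 'I_(fs_n mu).+2 -> L2,
    [/\ forall i, L2_norm (f i) = mdist (fs_point i) (barycenter mu),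
        forall i j,
          L2_norm (f i - f j) <= mdist (fs_point i) (fs_point j) &
        r = L2_norm (\sum_i fs_weight i *: f i) ^+ 2
            / \sum_i fs_weight i * L2_norm (f i) ^+ 2]]%classic.

Lemma IN_values_ge0 r : IN_values r -> 0 <= r.
Proof.
move=> [f [_ _ ->]]; rewrite divr_ge0 ?sqr_ge0//; apply: sumr_ge0 => i _.
by rewrite mulr_ge0 ?sqr_ge0 ?ltW ?fs_weight_gt0.
Qed.

(** Placing all points on one ray, at their distances from the barycentre, is an
    admissible choice. *)
Lemma IN_values_le1 : exists2 r, IN_values r & r <= 1.
Proof.
have [u hu] := L2_unit.
pose d (i : 'I_(fs_n mu).+2) := mdist (fs_point i) (barycenter mu).
pose f i : L2 := d i *: u.
have fn i : L2_norm (f i) = d i by rewrite hu ger0_norm// mdist_ge0.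
eexists; first exists f; first split=> [//|i j|//].
  rewrite -scalerBl hu ler_norml; apply/andP; split.
    rewrite lerNl opprB lerBlDr /d [mdist (fs_point i) (fs_point j)]metric_sym.
    exact: metric_triangle.
  by rewrite lerBlDr; exact: metric_triangle.
rewrite (eq_bigr (fun i => (fs_weight i * d i) *: u)) => [|i _]; last first.
  by rewrite scalerA.
rewrite -scaler_suml hu real_normK ?num_real//.
under [X in _ / X]eq_bigr do rewrite fn.
have := @jensen_sqr _ (@fs_weight _ _ mu) d (fun i => ltW (fs_weight_gt0 i))
  (fs_weight_sum mu).
move: (_ ^+ 2) (sqr_ge0 (\sum_i fs_weight i * d i)) => a a0.
move: (\sum_i _) => b ab; have [b0|b0] := eqVneq b 0.
  by rewrite b0 invr0 mulr0.
by rewrite ler_pdivrMr ?mul1r// lt_neqAle eq_sym b0 (le_trans a0).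
Qed.

Lemma IN_delta_measure_le1 : IN_delta_measure mu <= 1.
Proof.
have [r hr r1] := IN_values_le1; apply: le_trans r1.
by apply: ge_inf hr; exists 0 => x /IN_values_ge0.
Qed.

End Measure.

(** The values at all measures are bounded by one, so that the supremum
    [IN_delta M] is an upper bound for them. *)
Lemma IN_delta_witness (M : metricType R) (mu : fs_prob M) (c : R) :
  IN_delta M < c -> exists2 r, IN_values mu r & r < c.
Proof.
move=> h; have [r hr _] := IN_values_le1 mu.
apply: inf_lt; first by exists r.
apply: le_lt_trans h; apply: ub_le_sup; last by exists mu.
by exists 1 => _ [nu _ <-]; exact: IN_delta_measure_le1.
Qed.

(** Take the push-forward of the uniform measure and an almost optimal
    configuration of vectors for it. The norm of its mean is small compared to
    its mean squared norm, which is the mean squared distance from the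
    barycentre, and its edges are not longer than those of [phi]. The Poincare
    inequality thus bounds the mean squared distance from the barycentre. *)
Lemma CAT0_lt1_concentrates (M : metricType R) : CAT0_lt1 M -> concentrates M.
Proof.
move=> [_ d1] C L D C0.
have [c dc c1] : exists2 c, IN_delta M < c & c < 1.
  by exists ((1 + IN_delta M) / 2); lra.
pose B := C * D%:R * L ^+ 2 / (1 - c).
have B0 : 0 <= B.
  by apply: divr_ge0; [rewrite mulr_ge0 ?sqr_ge0// mulr_ge0 | rewrite subr_ge0 ltW].
exists (2 * B + 1) => G phi G0 degD pG phiL.
have /card_gt0P[v0 _] := G0.
pose s := undup (map phi (enum G)).
have phis v : phi v \in s by rewrite mem_undup map_f ?mem_enum.
have [const|] := boolP [forall v, phi v == phi v0].
  exists (phi v0).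
  rewrite (_ : [set v | _]%SET = [set: G]%SET) ?cardsT ?leq_pmull//.
  apply/setP => v; rewrite !inE (eqP (forallP const v)) mdistxx.
  by rewrite addr_ge0// mulr_ge0.
rewrite negb_forall => /existsP[v1 v10].
have [k sk] : exists k, size s = k.+2.
  have : (1 < size s)%N.
    have : uniq [:: phi v0; phi v1] by rewrite /= inE eq_sym v10.
    by move/uniq_leq_size; apply => x; rewrite !inE => /orP[]/eqP->.
  by case: (size s) => [|[|k]]// _; exists k.
pose p (i : 'I_k.+2) := nth (phi v0) s i.
have p_inj : injective p.
  move=> i j /eqP; rewrite nth_uniq ?sk ?ltn_ord ?undup_uniq// => /eqP.
  exact: val_inj.
have idxP v : (index (phi v) s < k.+2)%N by rewrite -sk index_mem.
pose idx v := Ordinal (idxP v).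
have pidx v : p (idx v) = phi v by rewrite /p nth_index.
have nG : #|G|%:R != 0 :> R by rewrite pnatr_eq0 -lt0n.
have nG0 : 0 < #|G|%:R :> R by rewrite ltr0n.
pose w (i : 'I_k.+2) : R := #|[set v | idx v == i]%SET|%:R / #|G|%:R.
have w_gt0 i : 0 < w i.
  rewrite divr_gt0// ltr0n card_gt0; apply/finset.set0Pn.
  have : p i \in s by rewrite mem_nth ?sk.
  rewrite mem_undup => /mapP[v _ pv]; exists v; rewrite inE; apply/eqP.
  by apply: p_inj; rewrite pidx.
have sumw (F : 'I_k.+2 -> R) : \sum_i w i * F i = #|G|%:R^-1 * \sum_v F (idx v).
  exact: (@sum_fibres R^o).
have w1 : \sum_i w i = 1.
  have := sumw (fun=> 1); rewrite sumr_const mulVf//.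
  by under eq_bigr do rewrite mulr1.
pose mu := FsProb p_inj w_gt0 w1.
have [_ [f [fb fL ->]]] := @IN_delta_witness _ mu _ dc.
rewrite -/w; set S := (X in _ / X) => h; exists (barycenter mu).
apply: markov_half => // [v|]; first exact: mdist_ge0.
have SE : \sum_v mdist (phi v) (barycenter mu) ^+ 2 = #|G|%:R * S.
  rewrite /S (sumw (fun i => L2_norm (f i) ^+ 2)) mulrA mulfV// mul1r.
  by apply: eq_bigr => v _; rewrite fb -[X in mdist X _]pidx.
rewrite SE ler_pM2l//.
have S0 : 0 <= S.
  by apply: sumr_ge0 => i _; rewrite mulr_ge0 ?sqr_ge0// ltW// w_gt0.
have [->//|SN0] := eqVneq S 0.
have {}S0 : 0 < S by rewrite lt_neqAle eq_sym SN0.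
move: h; rewrite ltr_pdivrMr// => h.
rewrite /B ler_pdivlMr ?subr_gt0//.
have := @L2_poincare R G C (f \o idx) G0 C0 pG.
have -> : \sum_v L2_norm ((f \o idx) v) ^+ 2 = #|G|%:R * S.
  by rewrite /S (sumw (fun i => L2_norm (f i) ^+ 2)) mulrA mulfV// mul1r.
rewrite -(@sum_fibres _ _ _ idx f) -/w => /le_trans hh.
have : #|G|%:R * S <= #|G|%:R * (c * S) + C * (#|G|%:R * (D%:R * L ^+ 2)).
  apply: hh; apply: lerD; first by rewrite ler_pM2l// ltW.
  apply: ler_wpM2l => //.
  rewrite mulr_natl -sumr_const; apply: ler_sum => v _.
  apply: (@le_trans _ _ (\sum_(w0 | adj v w0) L ^+ 2)).
    apply: ler_sum => x vx; have h0 := fL (idx v) (idx x).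
    have h1 : L2_norm (f (idx v) - f (idx x)) <= mdist (phi v) (phi x).
      by rewrite -!pidx.
    have := le_trans h1 (phiL _ _ vx) => h2.
    by rewrite lerXn2r ?nnegrE ?(le_trans _ h2) ?L2_norm_ge0.
  rewrite sumr_const -[leLHS]mulr_natl ler_wpM2r ?sqr_ge0// ler_nat.
  by apply: leq_trans (degD v); rewrite /degree cardsE.
have -> : C * (#|G|%:R * (D%:R * L ^+ 2)) = #|G|%:R * (C * D%:R * L ^+ 2) by ring.
by rewrite -mulrDr ler_pM2l//; lra.
Qed.

End IzekiNayatani.

(** * Concentration in Banach spaces sphere equivalent to a Hilbert space *)

Section Radial.
Context (R : realType).

(** The homogeneous extension of [Phi] with norms cut off at 2. The cut-off
    makes it uniformly continuous on the whole space and not only on bounded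
    sets. *)
Definition radial (E F : normedModType R) (Phi : E -> F) (x : E) : F :=
  Num.min `|x| 2 *: Phi (`|x|^-1 *: x).

Lemma unit_normalized (E : normedModType R) (x : E) : x != 0 ->
  unit_sphere (`|x|^-1 *: x).
Proof.
by move=> x0; rewrite /unit_sphere /= normrZ normfV normr_id mulVf// normr_eq0.
Qed.

Section Radial1.
Variables (E F : normedModType R) (Phi : E -> F).
Hypothesis PhiS : forall x, unit_sphere x -> unit_sphere (Phi x).

Lemma radial0 : radial Phi 0 = 0.
Proof. by rewrite /radial normr0 min_l// scale0r. Qed.

Lemma norm_radial x : `|radial Phi x| = Num.min `|x| 2.
Proof.
have [->|x0] := eqVneq x 0; first by rewrite radial0 !normr0 min_l.
by rewrite normrZ (PhiS (unit_normalized x0)) mulr1 ger0_norm.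
Qed.

(** Near the origin both values are small. Away from it, normalization is a
    Lipschitz map. *)
Lemma radial_unif_continuous : unif_continuous_on (@unit_sphere R E) Phi ->
  forall e : R, 0 < e -> exists2 delta : R, 0 < delta &
    forall x y, `|x - y| < delta -> `|radial Phi x - radial Phi y| < e.
Proof.
move=> uc e e0; have e4 : 0 < e / 4 by lra.
have [d d0 hd] := uc _ e4.
exists (Num.min (e / 8) (d * e / 8)).
  by rewrite lt_min divr_gt0//= divr_gt0// mulr_gt0.
move=> x y; rewrite lt_min => /andP[xy1 xy2].
have xyn := ler_dist_dist x y.
have [xe|xe] := ltP `|x| (e / 4).
  apply: le_lt_trans (ler_normB _ _) _; rewrite !norm_radial.
  have : Num.min `|x| 2 <= `|x| by rewrite ge_min lexx.
  have : Num.min `|y| 2 <= `|y| by rewrite ge_min lexx.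
  by move: xyn; rewrite ler_norml; lra.
have x0 : 0 < `|x| by lra.
have y0 : 0 < `|y| by move: xyn; rewrite ler_norml; lra.
have ux : unit_sphere (`|x|^-1 *: x).
  by apply: unit_normalized; rewrite -normr_gt0.
have uy : unit_sphere (`|y|^-1 *: y).
  by apply: unit_normalized; rewrite -normr_gt0.
have uxy : `| `|x|^-1 *: x - `|y|^-1 *: y| < d.
  have -> : `|x|^-1 *: x - `|y|^-1 *: y =
      `|x|^-1 *: ((x - y) + (`|y| - `|x|) *: (`|y|^-1 *: y)).
    rewrite scalerBl scalerA mulfV ?gt_eqF// scale1r addrA subrK scalerBr.
    by rewrite [in X in _ = _ - X]scalerA mulVf ?gt_eqF// scale1r.
  rewrite normrZ normfV normr_id ltr_pdivrMl//.
  apply: le_lt_trans (ler_normD _ _) _.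
  rewrite normrZ uy mulr1 [X in _ + X]distrC.
  have := ler_wpM2r (ltW d0) xe; rewrite mulrC; lra.
have := hd _ _ ux uy uxy.
set a := Phi _; set b := Phi _ => hab.
have -> : radial Phi x - radial Phi y =
    (Num.min `|x| 2 - Num.min `|y| 2) *: a + Num.min `|y| 2 *: (a - b).
  by rewrite scalerBl scalerBr addrA subrK.
apply: le_lt_trans (ler_normD _ _) _; rewrite !normrZ (PhiS ux) mulr1.
have h1 : `|Num.min `|x| 2 - Num.min `|y| 2| <= `| `|x| - `|y| |.
  rewrite /Num.min; case: ltP => h1; case: ltP => h2; rewrite ?subrr ?normr0//.
  - by rewrite !ler0_norm//; lra.
  - by rewrite !ger0_norm//; lra.
have h2 : `|Num.min `|y| 2| * `|a - b| <= 2 * (e / 4).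
  apply: ler_pM => //; last exact: ltW.
  by rewrite ger0_norm ?ge_min ?lexx ?orbT// le_min normr_ge0/=.
lra.
Qed.

End Radial1.

Lemma radialK (E F : normedModType R) (Phi : E -> F) (Psi : F -> E) :
  (forall x, unit_sphere x -> unit_sphere (Phi x) /\ Psi (Phi x) = x) ->
  forall x, `|x| <= 2 -> radial Psi (radial Phi x) = x.
Proof.
move=> PP x x2; have [->|x0] := eqVneq x 0; first by rewrite !radial0.
have [u1 u2] := PP _ (unit_normalized x0).
rewrite {1}/radial norm_radial; last by move=> z /PP[].
rewrite !(min_l x2) /radial (min_l x2) scalerA mulVf ?normr_eq0// scale1r u2.
by rewrite scalerA mulfV ?normr_eq0// scale1r.
Qed.

End Radial.

Section SphereEquivalent.
Context (R : realType) (E H : completeNormedModType R).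
Hypotheses (hH : hilbert H) (EH : sphere_equivalent E H).

Definition ball_count (G : finType) (f : G -> E) (x : E) (r : R) : nat :=
  #|[set v | (`|f v - x| <= r)%R]%SET|.

(** Rescale the ball to the unit ball and transport [f] to the Hilbert space by
    the radial extension of the sphere equivalence. If [r] is large, the
    rescaled edges are short and so are the transported ones, and by the
    Poincare inequality most vertices are mapped close to the mean. Going back,
    most vertices are mapped close to some point [c]. Many of them belong to the
    unit ball, so that [c] is not far from it, and the points close to [c] are
    not affected by the cut-off. *)
Lemma ball_count_half (C L : R) (D : nat) : 0 <= C -> exists2 r0 : R, 0 < r0 &
  forall (G : graph) (f : G -> E), (0 < #|G|)%N ->
    (forall v : G, (degree v <= D)%N) -> poincare G C ->
    (forall v w, adj v w -> `|f v - f w| <= L) ->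
    forall r x, r0 <= r -> (3 * #|G| <= 4 * ball_count f x r)%N ->
    exists y, (3 * #|G| <= 4 * ball_count f y (r / 2))%N.
Proof.
move=> C0; have [Phi [Psi [PhiK PsiK uPhi uPsi]]] := EH.
have PhiS z : unit_sphere z -> unit_sphere (Phi z) by move=> /PhiK[].
have PsiS z : unit_sphere z -> unit_sphere (Psi z) by move=> /PsiK[].
have q0 : 0 < 1 / 4 :> R by lra.
have [eta eta0 hPsi] := radial_unif_continuous PsiS uPsi q0.
pose K := 8 * C * D%:R; have K0 : 0 <= K by rewrite !mulr_ge0.
pose e := eta / (1 + K); have e0 : 0 < e by rewrite divr_gt0//; lra.
have Ke : K * e ^+ 2 <= eta ^+ 2.
  rewrite expr_div_n mulrA ler_pdivrMr ?exprn_gt0//; last lra.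
  by rewrite mulrC ler_pM2l ?exprn_gt0//; nra.
have [d d0 hPhi] := radial_unif_continuous PhiS uPhi e0.
have L0 : 0 < `|L| + 1 by have := normr_ge0 L; lra.
exists ((`|L| + 1) / d); first by rewrite divr_gt0.
move=> G f G0 degD pG fL r x r0 hA.
have rp : 0 < r by apply: lt_le_trans r0; rewrite divr_gt0.
pose g v := r^-1 *: (f v - x).
have gn v y : `|g v - y| = r^-1 * `|f v - (x + r *: y)|.
  rewrite -[X in _ = X * _]gtr0_norm ?invr_gt0// -normrZ; congr `|_|.
  by rewrite /g opprD addrA [RHS]scalerBr scalerA mulVf ?gt_eqF// scale1r.
have gL v w : adj v w -> `|g v - g w| < d.
  move=> vw; rewrite -scalerBr normrZ gtr0_norm ?invr_gt0//.
  rewrite opprB addrA subrK ltr_pdivrMl//.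
  apply: le_lt_trans (fL _ _ vw) _; have := ler_norm L.
  by move: r0; rewrite ler_pdivrMr//; lra.
pose F v := radial Phi (g v); pose m := vertex_mean F; pose c := radial Psi m.
pose near := [set v | (`|F v - m| < eta)%R]%SET.
have far : (8 * #|~: near| <= #|G|)%N.
  have h := hilbert_poincare hH F pG.
  have := markov (fun v => `|F v - m|) (ltW eta0).
  rewrite (_ : [set v | _]%SET = ~: near)%SET; last first.
    by apply/setP => v; rewrite !inE -leNgt.
  move=> /le_trans/(_ h).
  have : C * (\sum_v \sum_(w | adj v w) `|F v - F w| ^+ 2) <=
      C * (#|G|%:R * (D%:R * e ^+ 2)).
    apply: ler_wpM2l => //; rewrite mulr_natl -sumr_const; apply: ler_sum => v _.
    apply: (@le_trans _ _ (\sum_(w | adj v w) e ^+ 2)).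
      apply: ler_sum => w vw; rewrite lerXn2r ?nnegrE ?(ltW e0)// ltW//.
      exact/hPhi/gL.
    rewrite sumr_const -[leLHS]mulr_natl ler_wpM2r ?sqr_ge0// ler_nat.
    by apply: leq_trans (degD v); rewrite /degree cardsE.
  move=> h1 /le_trans/(_ h1) h2; rewrite -(ler_nat R) natrM.
  rewrite -(@ler_pM2r _ (eta ^+ 2)) ?exprn_gt0//.
  apply: (@le_trans _ _ (#|G|%:R * (K * e ^+ 2))); last by rewrite ler_wpM2l.
  rewrite /K; move: h2; move: (#|~: near|%:R : R) (#|G|%:R : R) (eta ^+ 2) (e ^+ 2).
  move=> a b x2 y2 h2.
  rewrite (_ : b * _ = 8 * (C * (b * (D%:R * y2)))); last by ring.
  by rewrite -mulrA ler_pM2l.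
have nearP v : v \in near -> `|radial Psi (F v) - c| < 1 / 4.
  by rewrite inE => h; exact: hPsi.
pose A := [set v | (`|f v - x| <= r)%R]%SET.
have AP v : (v \in A) = (`|g v| <= 1).
  by rewrite inE -[g v]subr0 gn scaler0 addr0 ler_pdivrMl// mulr1.
have c_small : `|c| <= 5 / 4.
  have : (0 < #|A :&: near|)%N.
    have := cardsC near; have := cardsUI A near.
    have := max_card (mem (A :|: near)%SET); move: hA; rewrite /ball_count -/A.
    move: far G0; set a := #|A|; set b := #|near|; set n := #|G|.
    move: (#|A :|: near|) (#|A :&: near|) (#|~: near|); clearbody a b n; clear.
    lia.
  case/card_gt0P => v; rewrite inE AP => /andP[vA /nearP].
  rewrite /F (radialK PhiK); last by lra.
  move=> h; have := ler_distD (g v) 0 c; rewrite !sub0r !normrN; lra.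
exists (x + r *: c).
apply: leq_trans (_ : 4 * #|near| <= _)%N.
  by have := cardsC near; move: far; clear; lia.
rewrite leq_mul2l /=; apply: subset_leq_card; apply/fintype.subsetP => v /nearP h.
have gv2 : `|g v| <= 2.
  have : `|radial Psi (F v)| <= 3 / 2.
    have := ler_distD c 0 (radial Psi (F v)); rewrite !sub0r !normrN.
    by rewrite [`|c - _|]distrC; lra.
  rewrite (norm_radial PsiS) (norm_radial PhiS) !ge_min.
  by case/orP => [/orP[]|]; lra.
move: h; rewrite /F (radialK PhiK)// gn inE ltr_pdivrMl// => h.
by lra.
Qed.

(** Starting from a ball that contains all images, halve the radius as long as
    it is large. *)
Lemma sphere_equivalent_concentrates : concentrates (banach_metric E).
Proof.
move=> C L D C0; have [r0 r0p h] := ball_count_half L D C0.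
exists r0 => G f G0 degD pG fL.
suff [y hy] : exists y, (3 * #|G| <= 4 * ball_count (f : G -> E) y r0)%N.
  exists y; rewrite -[#|[set v | _]%SET|]/(ball_count (f : G -> E) y r0).
  by move: hy; clear; lia.
pose r1 := \sum_v `|(f : G -> E) v|.
have r1P : (3 * #|G| <= 4 * ball_count (f : G -> E) 0%R r1)%N.
  rewrite /ball_count (_ : [set v | _]%SET = [set: G]%SET) ?cardsT ?leq_mul//.
  apply/setP => v; rewrite !inE subr0 /r1 (bigD1 v)//= lerDl.
  by apply: sumr_ge0 => w _.
have [k] : exists k, r1 <= r0 * 2 ^+ k.
  exists (Num.bound (r1 / r0)).
  by rewrite mulrC -ler_pdivrMr// ltW// upper_nthrootP.
elim: k r1 (0 : E) r1P => [|k IH] r x hr.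
  rewrite expr0 mulr1 => rr0; exists x; apply: leq_trans hr _.
  rewrite leq_mul2l /=; apply: subset_leq_card; apply/fintype.subsetP => v.
  by rewrite !inE => /le_trans; apply.
have [r0r|rr0] := leP r0 r.
  have [y hy] := h G f G0 degD pG fL r x r0r hr.
  by rewrite exprS => h1; apply: (IH _ y hy); rewrite ler_pdivrMr//; lra.
move=> _; apply: (IH r x hr); apply: le_trans (ltW rr0) _.
by rewrite ler_peMr ?(ltW r0p)// exprn_ege1// ler1n.
Qed.

End SphereEquivalent.

(** * Distances in box products and the obstruction to fibred embeddings *)

Lemma card_gdist_ball (G : graph) (D : nat) (x : G) (n : nat) :
  (forall u v : G, connect (@adj G) u v) ->
  (forall v : G, (degree v <= D)%N) ->
  (#|[set y | (gdist x y <= n)%N]%SET| <= D.+1 ^ n)%N.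
Proof.
move=> cG degD; elim: n => [|n IH].
  rewrite expn0 -(cards1 x); apply: subset_leq_card; apply/fintype.subsetP => y.
  by rewrite !inE leqn0 => /eqP/(gdist_eq0 cG) ->.
set S := [set y | (gdist x y <= n)%N]%SET in IH.
apply: (@leq_trans #|\bigcup_(v in S) (v |: [set w | adj v w])%SET|).
  apply: subset_leq_card; apply/fintype.subsetP => y; rewrite inE => hy.
  have [p [xp py sp]] := gdist_path cG x y.
  case/lastP: p => [|p z] in xp py sp.
    move: py => /= <-; apply/bigcupP; exists x; last by rewrite !inE eqxx.
    by rewrite inE gdistxx.
  rewrite last_rcons in py; rewrite rcons_path py in xp; case/andP: xp => xp pz.
  apply/bigcupP; exists (last x p); last by rewrite !inE pz orbT.
  rewrite inE; apply: leq_trans (gdist_min xp erefl) _.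
  by rewrite -ltnS -(size_rcons p z) sp.
apply: leq_trans (card_bigcup_le _ _) _.
apply: (@leq_trans (\sum_(v in S) D.+1)).
  apply: leq_sum => v _; apply: leq_trans (leq_card_setU _ _) _.
  by rewrite cards1 add1n ltnS degD.
by rewrite sum_nat_const expnSr leq_mul.
Qed.

Lemma gdist_lipschitz (G H : graph) (f : G -> H) (x y : G) :
  (forall u v : G, connect (@adj G) u v) ->
  (forall u v : H, connect (@adj H) u v) ->
  (forall u v, adj u v -> (gdist (f u) (f v) <= 1)%N) ->
  (gdist (f x) (f y) <= gdist x y)%N.
Proof.
move=> cG cH fL; have [p [xp py <-]] := gdist_path cG x y.
elim: p x xp py => [|z p IH] x /= xp py; first by rewrite py gdistxx.
case/andP: xp => xz zp; apply: leq_trans (gdist_triangle cH (f z) _ _) _.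
by rewrite -add1n leq_add ?fL// IH.
Qed.

Section BoxDistance.
Variables A B : graph.
Hypotheses (cA : connected_graph A) (cB : connected_graph B).

Lemma box_adj_l (a a' : A) (b : B) :
  adj a a' -> @adj (box_graph A B) (a, b) (a', b).
Proof. by move=> aa; rewrite /adj /= /box_adj /= aa eqxx. Qed.

Lemma box_adj_r (a : A) (b b' : B) :
  adj b b' -> @adj (box_graph A B) (a, b) (a, b').
Proof. by move=> bb; rewrite /adj /= /box_adj /= bb eqxx orbT. Qed.

Lemma box_connected : connected_graph (box_graph A B).
Proof.
case: cA cB => A0 hA [B0 hB]; split=> [|[a b] [a' b']].
  by rewrite card_prod muln_gt0 A0.
apply: (@connect_trans _ _ ((a', b) : box_graph A B)).
  have [p pa ->] := connectP (hA a a').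
  elim: p a pa => [|c p IH] a /= => [_|/andP[ac cp]]; first exact: connect0.
  by apply: connect_trans (IH _ cp); apply/connect1/box_adj_l.
have [p pa ->] := connectP (hB b b').
elim: p b pa => [|c p IH] b /= => [_|/andP[ac cp]]; first exact: connect0.
by apply: connect_trans (IH _ cp); apply/connect1/box_adj_r.
Qed.

Lemma box_degree (D : nat) : (forall a : A, (degree a <= D)%N) ->
  (forall b : B, (degree b <= D)%N) ->
  forall x : box_graph A B, (degree x <= 2 * D)%N.
Proof.
move=> dA dB [a b]; rewrite /degree.
apply: (@leq_trans #|((fun c => (c, b)) @: [set c | adj a c] :|:
    (fun c => (a, c)) @: [set c | adj b c])%SET|).
  apply: subset_leq_card; apply/fintype.subsetP => -[c d].
  rewrite !inE {1}/adj /= /box_adj /= => /orP[/andP[ac /eqP <-]|/andP[/eqP <- bd]].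
    by rewrite imset_f ?inE.
  by rewrite (imset_f (fun c => (a, c))) ?inE ?orbT.
apply: leq_trans (leq_card_setU _ _) _; rewrite mul2n -addnn.
by apply: leq_add; apply: leq_trans (leq_imset_card _ _) _; [exact: dA|exact: dB].
Qed.

Lemma gdist_box_fst (x y : box_graph A B) : (gdist x.1 y.1 <= gdist x y)%N.
Proof.
apply: (@gdist_lipschitz (box_graph A B) A fst x y box_connected.2 cA.2).
move=> u v /orP[/andP[uv _]|/andP[/eqP -> _]]; first exact: gdist_adj.
by rewrite gdistxx.
Qed.

Lemma gdist_box_snd (x y : box_graph A B) : (gdist x.2 y.2 <= gdist x y)%N.
Proof.
apply: (@gdist_lipschitz (box_graph A B) B snd x y box_connected.2 cB.2).
move=> u v /orP[/andP[_ /eqP ->]|/andP[_ uv]]; last exact: gdist_adj.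
by rewrite gdistxx.
Qed.

Lemma gdist_box_le (x y : box_graph A B) :
  (gdist x y <= gdist x.1 y.1 + gdist x.2 y.2)%N.
Proof.
case: x y => [a b] [a' b'].
apply: leq_trans (gdist_triangle box_connected.2 (a', b) _ _) _.
apply: leq_add.
- apply: (@gdist_lipschitz A (box_graph A B) (fun c => (c, b)) a a') => //.
  + exact: cA.2.
  + exact: box_connected.2.
  by move=> u v uv; apply/gdist_adj/box_adj_l.
apply: (@gdist_lipschitz B (box_graph A B) (fun c => (a', c)) b b') => //.
+ exact: cB.2.
+ exact: box_connected.2.
by move=> u v uv; apply/gdist_adj/box_adj_r.
Qed.

End BoxDistance.

Lemma disj_dist_same (R : realType) (X : nat -> Type)
    (d : forall m, X m -> X m -> \bar R) l (x y : X l) :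
  disj_dist d (existT _ l x) (existT _ l y) = d l x y.
Proof.
rewrite /disj_dist eqxx /tagged_as; case: eqP => //= e.
by rewrite (eq_axiomK e).
Qed.

Section Obstruction.
Variables (R : realType) (Kd : Type) (U : Kd -> metricType R)
  (iso : forall A B : Kd, (U A -> U B) -> Prop).
Variables (D K : nat) (L A : nat -> graph) (kappa : nat -> nat).
Hypothesis cA : forall l, connected_graph (A l).
Hypothesis cL : forall k, connected_graph (L k).
Hypothesis nL : forall k, (k < #|L k|)%N.
Hypothesis degL : forall k (v : L k), (degree v <= D)%N.
Hypothesis pL : forall k, poincare (L k) (4 * D%:R : R).
Hypothesis diamL : forall k (x y : L k), (gdist x y <= K * k.+1)%N.
Hypothesis kappaP : forall k m, exists2 l, (m <= l)%N & kappa l = k.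

(** A trivialization over one copy of a fixed factor, which is found arbitrarily
    far out, embeds this factor with the given controls. *)
Lemma fibred_embedding_obstruction (M : Kd) : concentrates (U M) ->
  ~ fibred_coarse_embedding_of iso
      (fun l => @graph_dist R (box_graph (A l) (L (kappa l)))) M.
Proof.
move=> conc [rho [omega [Mx [s [[rho0 rhoI rhoy] [om0 omI _] _ hR]]]]].
have C0 : 0 <= 4 * D%:R :> R by rewrite mulr_ge0.
have [r0 hr0] := conc (4 * D%:R) (omega 1) D C0.
have [n hn] : exists n : nat, 2 * r0 < rho n%:R.
  have /cvgryPgt/(_ (2 * r0)) [N [_ hN]] := rhoy.
  exists (Num.bound `|N|); apply: hN; apply: le_lt_trans (ler_norm N) _.
  by rewrite archi_boundP.
pose k := (2 * D.+1 ^ n)%N.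
have [m [m0 [t [tP _]]]] := hR (K * k.+1)%:R (ler0n R _).
have [l ml lk] := kappaP k m.
have [/card_gt0P[a0 _] _] := cA l.
pose pt (v : L (kappa l)) : {l : nat & box_graph (A l) (L (kappa l))} :=
  existT _ l (a0, v).
have cbox := box_connected (cA l) (cL (kappa l)).
pose C := range pt.
have dE v w : disj_dist (fun l => @graph_dist R (box_graph (A l) (L (kappa l))))
    (pt v) (pt w) = (gdist ((a0, v) : box_graph (A l) (L (kappa l))) (a0, w))%:R%:E.
  by rewrite /pt disj_dist_same graph_distE//; exact: cbox.2.
have gE v w : gdist ((a0, v) : box_graph (A l) (L (kappa l))) (a0, w) = gdist v w.
  apply/eqP; rewrite eqn_leq (gdist_box_snd (cA l) (cL _) (a0, v) (a0, w)) andbT.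
  by apply: leq_trans (gdist_box_le (cA l) (cL _) _ _) _; rewrite gdistxx.
have [|isoC contC] := tP C.
  split; first by have /card_gt0P[v _] := (cL (kappa l)).1; exists (pt v), v.
    by move=> _ [v _ <-].
  move=> _ _ [v _ <-] [w _ <-]; rewrite dE gE lee_fin ler_nat -lk.
  exact: diamL.
pose phi v := t C (pt v) (s (pt v)).
have phiP v w : rho (gdist v w)%:R <= mdist (phi v) (phi w) <= omega (gdist v w)%:R.
  have := contC (pt v) (pt w) (ex_intro2 _ _ v I erefl) (ex_intro2 _ _ w I erefl).
  by rewrite dE gE.
have [v w vw|x hx] := hr0 (L (kappa l)) phi (cL _).1 (@degL _) (@pL _).
  have /andP[_ h] := phiP v w; apply: le_trans h _.
  by apply: omI => //; rewrite (ler_nat _ _ 1) gdist_adj.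
set S := [set v | _]%SET in hx.
have : (0 < #|S|)%N by have := (cL (kappa l)).1; move: hx; clear; lia.
case/card_gt0P => v vS; move: (vS); rewrite inE => hv.
have : (#|S| <= D.+1 ^ n)%N.
  apply: leq_trans (card_gdist_ball v n (cL (kappa l)).2 (@degL _)).
  apply: subset_leq_card; apply/fintype.subsetP => w; rewrite !inE => hw.
  rewrite leqNgt; apply/negP => nw; have /andP[h _] := phiP v w.
  have : rho n%:R <= rho (gdist v w)%:R by apply: rhoI; rewrite // ler_nat ltnW.
  have := metric_triangle (phi v) x (phi w); rewrite [mdist x _]metric_sym; lra.
have : (k < #|L (kappa l)|)%N by rewrite -[X in (X < _)%N]lk.
by rewrite /k; move: hx; clear; lia.
Qed.

End Obstruction.

(** * CAT(0) spaces as quotients of pseudometric spaces *)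

(** Vertices of a metric graph lie on several edges, and the apex of a cone has
    an arbitrary direction. Working with pseudometrics, such points are
    identified only once, at the end. *)
Record pmetric (R : realType) := PMetric {
  pm_sort :> Type;
  pdist : pm_sort -> pm_sort -> R;
  pdistxx : forall x, pdist x x = 0;
  pdist_sym : forall x y, pdist x y = pdist y x;
  pdist_triangle : forall y x z, pdist x z <= pdist x y + pdist y z }.

Arguments pdist {R p}.

Section PseudoMetrics.
Context (R : realType).
Implicit Type P : pmetric R.

Lemma pdist_ge0 P (x y : P) : 0 <= pdist x y.
Proof.
have := pdist_triangle y x x; rewrite pdistxx [pdist y x]pdist_sym; lra.
Qed.

Definition seq_limit P (u : nat -> P) (x : P) : Prop :=
  forall e, 0 < e -> exists N, forall n, (N <= n)%N -> pdist (u n) x < e.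

Definition seq_cauchy P (u : nat -> P) : Prop :=
  forall e, 0 < e -> exists N, forall m n, (N <= m)%N -> (N <= n)%N ->
    pdist (u m) (u n) < e.

Definition seq_complete P : Prop :=
  forall u : nat -> P, seq_cauchy u -> exists x, seq_limit u x.

(** The inequality of Bruhat and Tits, for all points that divide a segment from
    [x] to [y]. It characterizes CAT(0) spaces among complete spaces. *)
Definition bruhat_tits (T : Type) (d : T -> T -> R) : Prop :=
  forall x y l, 0 <= l <= 1 -> exists u, forall z,
    d z u ^+ 2 <=
    (1 - l) * d z x ^+ 2 + l * d z y ^+ 2 - l * (1 - l) * d x y ^+ 2.

(** Points at distance zero from each other have the same distance function, so
    the distance functions form the metric quotient. *)
Definition metric_quotient P := {f : P -> R | exists x, f = pdist x}.

Section Quotient.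
Variable P : pmetric R.

HB.instance Definition _ := gen_eqMixin (metric_quotient P).
HB.instance Definition _ := gen_choiceMixin (metric_quotient P).

Definition quotient_class (x : P) : metric_quotient P :=
  exist _ (pdist x) (ex_intro _ x erefl).

Definition quotient_repr (f : metric_quotient P) : P := sval (cid (svalP f)).

Lemma quotient_reprK f : quotient_class (quotient_repr f) = f.
Proof.
case: f => f Pf; rewrite /quotient_class /quotient_repr; case: cid => x /= fx.
by move: Pf; rewrite fx => Pf; congr exist; exact: Prop_irrelevance.
Qed.

Definition quotient_dist (f g : metric_quotient P) : R :=
  pdist (quotient_repr f) (quotient_repr g).

Lemma quotient_class_dist x z :
  pdist (quotient_repr (quotient_class x)) z = pdist x z.
Proof.
by rewrite /quotient_repr; case: cid => y /= ->.
Qed.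

Lemma quotient_distE x y :
  quotient_dist (quotient_class x) (quotient_class y) = pdist x y.
Proof.
by rewrite /quotient_dist quotient_class_dist pdist_sym quotient_class_dist
  pdist_sym.
Qed.

Let quotient_distxx f : quotient_dist f f = 0.
Proof. exact: pdistxx. Qed.

Let quotient_positivity f g : quotient_dist f g = 0 -> f = g.
Proof.
rewrite /quotient_dist => fg0.
rewrite -(quotient_reprK f) -(quotient_reprK g).
suff E : pdist (quotient_repr f) = pdist (quotient_repr g).
  by rewrite /quotient_class; move: (ex_intro _ _ _) (ex_intro _ _ _);
    rewrite E => p q; congr exist; exact: Prop_irrelevance.
apply/funext => z; apply/eqP; rewrite eq_le; apply/andP; split.
  have := pdist_triangle (quotient_repr g) (quotient_repr f) z.
  by rewrite fg0 add0r.
have := pdist_triangle (quotient_repr f) (quotient_repr g) z.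
by rewrite [pdist (quotient_repr g) (quotient_repr f)]pdist_sym fg0 add0r.
Qed.

Let quotient_sym f g : quotient_dist f g = quotient_dist g f.
Proof. exact: pdist_sym. Qed.

Let quotient_triangle g f h :
  quotient_dist f h <= quotient_dist f g + quotient_dist g h.
Proof. exact: pdist_triangle. Qed.

HB.instance Definition _ := isMetric.Build R (metric_quotient P)
  quotient_distxx quotient_positivity quotient_sym quotient_triangle.

Lemma mdist_quotient (x y : P) :
  mdist (quotient_class x : metric_quotient P) (quotient_class y) = pdist x y.
Proof. exact: quotient_distE. Qed.

Lemma quotient_complete : seq_complete P -> complete_metric (metric_quotient P : metricType R).
Proof.
move=> cP F FF /cauchyP cF.
have pos n : 0 < n.+1%:R^-1 :> R by rewrite invr_gt0 ltr0n.
have [f fP] := choice (fun n => cF _ (pos n)).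
pose u n := quotient_repr (f n).
have F_ball n : F [set g | quotient_dist (f n) g < n.+1%:R^-1]%classic.
  by have := fP n; rewrite ballEmdist.
have small e : 0 < e -> exists N, forall n, (N <= n)%N -> n.+1%:R^-1 < e :> R.
  move=> e0; exists (Num.truncn e^-1) => n Nn.
  rewrite invf_plt ?posrE ?ltr0n//; apply: lt_le_trans (truncnS_gt _) _.
  by rewrite ler_nat ltnS.
have [|x xP] := cP u _.
  move=> e e0; have [N NP] := small (e / 2) (divr_gt0 e0 (ltr0n _ 2)).
  exists N => m n Nm Nn.
  have [g [gm gn]] := filter_ex (filterI (F_ball m) (F_ball n)).
  apply: le_lt_trans (quotient_triangle g (f m) (f n)) _.
  rewrite [quotient_dist g _]quotient_sym (splitr e).
  by apply: ltrD; [exact: lt_trans gm (NP _ Nm)|exact: lt_trans gn (NP _ Nn)].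
exists (quotient_class x).
apply/metricType_numDomainType.fcvgrPdist_lt => e e0.
have e2 : 0 < e / 2 by rewrite divr_gt0.
have [N NP] := small _ e2; have [N' NP'] := xP _ e2.
pose n := maxn N N'.
apply: filterS (F_ball n) => g /= gn.
apply: le_lt_trans (quotient_triangle (f n) (quotient_class x) g) _.
rewrite (splitr e); apply: ltrD; last exact: lt_trans gn (NP n (leq_maxl _ _)).
by rewrite /quotient_dist quotient_class_dist pdist_sym; apply: NP'; exact: leq_maxr.
Qed.

Lemma quotient_bruhat_tits : bruhat_tits (@pdist R P) ->
  bruhat_tits (@mdist R (metric_quotient P)).
Proof.
move=> bt f g l l01; have [u uP] := bt (quotient_repr f) (quotient_repr g) l l01.
exists (quotient_class u) => h.
rewrite -[h]quotient_reprK -[f]quotient_reprK -[g]quotient_reprK !mdist_quotient.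
exact: uP.
Qed.

End Quotient.
End PseudoMetrics.

Section BruhatTits.
Context (R : realType).

Lemma euclid_distE (a b : 'rV[R]_2) :
  euclid_dist a b ^+ 2 = (a 0 0 - b 0 0) ^+ 2 + (a 0 1 - b 0 1) ^+ 2.
Proof.
rewrite /euclid_dist sqr_sqrtr; last by apply: sumr_ge0 => i _; exact: sqr_ge0.
rewrite big_ord_recl big_ord_recl big_ord0 addr0; congr (_ + (_ - _) ^+ 2).
  by congr (a 0 _); apply: val_inj.
by congr (b 0 _); apply: val_inj.
Qed.

Lemma euclid_stewart (z a b : 'rV[R]_2) l :
  euclid_dist z ((1 - l) *: a + l *: b) ^+ 2 =
  (1 - l) * euclid_dist z a ^+ 2 + l * euclid_dist z b ^+ 2
  - l * (1 - l) * euclid_dist a b ^+ 2.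
Proof. by rewrite !euclid_distE !mxE; ring. Qed.

Lemma euclid_dist_sym (a b : 'rV[R]_2) : euclid_dist a b = euclid_dist b a.
Proof.
by rewrite /euclid_dist; congr Num.sqrt; apply: eq_bigr => i _; ring.
Qed.

Lemma euclid_distxx (a : 'rV[R]_2) : euclid_dist a a = 0.
Proof.
by apply/eqP; rewrite -[_ == _](expf_eq0 _ 2) euclid_distE !subrr expr0n addr0.
Qed.

Lemma euclid_dist_ge0 (a b : 'rV[R]_2) : 0 <= euclid_dist a b.
Proof. exact: sqrtr_ge0. Qed.

Lemma euclid_dist_segment (a b : 'rV[R]_2) l : 0 <= l ->
  euclid_dist a ((1 - l) *: a + l *: b) = l * euclid_dist a b.
Proof.
move=> l0; apply/eqP; rewrite -(@eqrXn2 _ 2)// ?euclid_dist_ge0//; last first.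
  by rewrite mulr_ge0 ?euclid_dist_ge0.
by rewrite euclid_stewart euclid_distxx; apply/eqP; ring.
Qed.

Variable M : metricType R.
Hypothesis bt : bruhat_tits (@mdist R M).

(** The inequality at the point of the geodesic forces this point to be the
    given one. *)
Lemma bruhat_tits_geodesic (x y : M) c l : geodesic x y c -> 0 <= l <= 1 ->
  forall z, mdist z (c (l * mdist x y)) ^+ 2 <=
    (1 - l) * mdist z x ^+ 2 + l * mdist z y ^+ 2
    - l * (1 - l) * mdist x y ^+ 2.
Proof.
move=> [c0 cL cI] l01 z; have [u uP] := bt x y l01.
have L0 : 0 <= mdist x y by apply: mdist_ge0.
have lL : 0 <= l * mdist x y <= mdist x y by nra.
suff -> : c (l * mdist x y) = u by [].
apply: mdist_positivity; apply/eqP; rewrite -[_ == _](expf_eq0 _ 2).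
rewrite eq_le sqr_ge0 andbT; apply: le_trans (uP _) _.
have := cI _ _ lL (_ : 0 <= 0 <= mdist x y); rewrite c0 => ->; last by rewrite lexx.
have := cI _ _ lL (_ : 0 <= mdist x y <= mdist x y); rewrite cL => ->; last first.
  by rewrite L0 lexx.
rewrite !real_normK ?num_real// le_eqVlt; apply/orP; left; apply/eqP; ring.
Qed.

(** The inequality at the end points and at other points of the same kind bounds
    the distances from above, and the triangle inequality forces equality. *)
Lemma bruhat_tits_exists_geodesic (x y : M) : exists c : R -> M, geodesic x y c.
Proof.
have h (l : R) : exists u, 0 <= l <= 1 -> forall z, mdist z u ^+ 2 <=
    (1 - l) * mdist z x ^+ 2 + l * mdist z y ^+ 2 - l * (1 - l) * mdist x y ^+ 2.
  have [l01|nl] := pselect (is_true (0 <= l <= 1)); last by exists x.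
  by have [u uP] := bt x y l01; exists u.
have [u uP] := choice h.
have L0 : 0 <= mdist x y by apply: mdist_ge0.
have ux l : 0 <= l <= 1 -> mdist x (u l) <= l * mdist x y.
  move=> l01; rewrite -(@ler_pXn2r _ 2) ?nnegrE ?mdist_ge0//; last by nra.
  by apply: le_trans (uP _ l01 _) _; rewrite mdistxx; nra.
have uy l : 0 <= l <= 1 -> mdist y (u l) <= (1 - l) * mdist x y.
  move=> l01; rewrite -(@ler_pXn2r _ 2) ?nnegrE ?mdist_ge0//; last by nra.
  by apply: le_trans (uP _ l01 _) _; rewrite mdistxx (metric_sym y x); nra.
have uu l m : 0 <= l <= 1 -> 0 <= m <= 1 ->
    mdist (u l) (u m) <= `|l - m| * mdist x y.
  move=> l01 m01; rewrite -(@ler_pXn2r _ 2) ?nnegrE ?mdist_ge0//; last first.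
    by rewrite mulr_ge0.
  apply: le_trans (uP _ m01 _) _; rewrite exprMn real_normK ?num_real//.
  have h1 := ux _ l01; have h2 := uy _ l01; rewrite metric_sym in h1.
  rewrite metric_sym in h2.
  have k1 : mdist (u l) x ^+ 2 <= (l * mdist x y) ^+ 2.
    by apply: lerXn2r; rewrite ?nnegrE ?mdist_ge0//; nra.
  have k2 : mdist (u l) y ^+ 2 <= ((1 - l) * mdist x y) ^+ 2.
    by apply: lerXn2r; rewrite ?nnegrE ?mdist_ge0//; nra.
  apply: (@le_trans _ _ ((1 - m) * (l * mdist x y) ^+ 2 +
    m * ((1 - l) * mdist x y) ^+ 2 - m * (1 - m) * mdist x y ^+ 2)).
    by rewrite lerD2r lerD// ler_wpM2l//; lra.
  by rewrite le_eqVlt; apply/orP; left; apply/eqP; ring.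
have [L00|Lpos] := eqVneq (mdist x y) 0.
  have xy := mdist_positivity _ _ L00.
  exists (fun=> x); split=> // s t; rewrite L00 => /andP[s0 s1] /andP[t0 t1].
  have -> : s = 0 by lra.
  have -> : t = 0 by lra.
  by rewrite mdistxx subrr normr0.
have {}Lpos : 0 < mdist x y by rewrite lt0r Lpos.
have r01 s : 0 <= s <= mdist x y -> 0 <= s / mdist x y <= 1.
  by move=> /andP[s0 s1]; rewrite divr_ge0//= ler_pdivrMr// mul1r.
exists (fun s => u (s / mdist x y)); split.
- apply/esym/mdist_positivity/eqP; rewrite eq_le mdist_ge0 andbT mul0r.
  by apply: le_trans (ux 0 _) _; rewrite ?mul0r ?lexx ?ler01.
- apply/esym/mdist_positivity/eqP; rewrite eq_le mdist_ge0 andbT divff ?gt_eqF//.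
  by apply: le_trans (uy 1 _) _; rewrite ?subrr ?mul0r ?lexx ?ler01.
have upper s t : 0 <= s <= mdist x y -> 0 <= t <= mdist x y ->
    mdist (u (s / mdist x y)) (u (t / mdist x y)) <= `|s - t|.
  move=> sL tL; apply: le_trans (uu _ _ (r01 _ sL) (r01 _ tL)) _.
  by rewrite -mulrBl normrM normfV (ger0_norm L0) divfK// gt_eqF.
suff lower s t : 0 <= s <= mdist x y -> 0 <= t <= mdist x y -> s <= t ->
    mdist (u (s / mdist x y)) (u (t / mdist x y)) = t - s.
  move=> s t sL tL; have [st|/ltW ts] := leP s t.
    by rewrite lower// distrC ger0_norm ?subr_ge0.
  by rewrite metric_sym lower// ger0_norm ?subr_ge0.
move=> sL tL st; apply/eqP; rewrite eq_le; apply/andP; split.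
  by rewrite -[leRHS]ger0_norm ?subr_ge0// distrC upper.
have h1 := ux _ (r01 _ sL); have h2 := uy _ (r01 _ tL).
rewrite divfK ?gt_eqF// in h1; rewrite mulrBl mul1r divfK ?gt_eqF// metric_sym in h2.
have := metric_triangle x (u (s / mdist x y)) y.
have := metric_triangle (u (s / mdist x y)) (u (t / mdist x y)) y.
lra.
Qed.

(** In the comparison triangle the inequality becomes the equality of Stewart.
    Apply it first on the side of one point and then on the side of the other
    one. *)
Lemma cat0_bruhat_tits : cat0 M.
Proof.
split=> [x y|v c w vc wv i j s t x y sL tL [l l01 ->] xs [m m01 ->] yt].
  exact: bruhat_tits_exists_geodesic.
have [l0 _] := andP l01; have [m0 _] := andP m01.
rewrite euclid_dist_segment// wv in xs; rewrite euclid_dist_segment// wv in yt.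
rewrite -(@ler_pXn2r _ 2) ?nnegrE ?mdist_ge0 ?euclid_dist_ge0//.
rewrite euclid_stewart -xs -yt.
apply: le_trans (bruhat_tits_geodesic (vc j) m01 _) _.
have h k : mdist (c i (l * mdist (v i) (v (ordS i)))) (v k) ^+ 2 <=
    euclid_dist ((1 - l) *: w i + l *: w (ordS i)) (w k) ^+ 2.
  rewrite metric_sym euclid_dist_sym euclid_stewart !wv.
  exact: bruhat_tits_geodesic (vc i) l01 _.
rewrite !wv lerD2r lerD// ler_wpM2l//; lra.
Qed.

End BruhatTits.

Lemma complete_cat0_quotient (R : realType) (P : pmetric R) :
  seq_complete P -> bruhat_tits (@pdist R P) ->
  complete_cat0 (metric_quotient P : metricType R).
Proof.
move=> cP btP; split; first exact: quotient_complete.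
exact/cat0_bruhat_tits/quotient_bruhat_tits.
Qed.

(** * Plane trigonometry *)

Section Trigonometry.
Context (R : realType).
Implicit Types x a b : R.

Lemma cos_decr x y : 0 <= x -> x <= y -> y <= pi -> cos y <= cos x :> R.
Proof.
move=> x0 xy ypi; rewrite leNgt ltr_cos -?leNgt// in_itv /= ?x0 ?ypi ?andbT.
  exact: le_trans x0 xy.
exact: le_trans xy ypi.
Qed.

Lemma sin_mvt x : 0 < x -> exists2 c : R, 0 < c < x & sin x = cos c * x.
Proof.
move=> x0.
have sin_cont : {within `[0, x], continuous (@sin R)}%classic.
  by apply: continuous_subspaceT; exact: continuous_sin.
have [c] := MVT x0 (fun z _ => is_derive_sin z) sin_cont.
by rewrite in_itv /= sin0 !subr0 => c0x ->; exists c.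
Qed.

Lemma oneBcosE x : 1 - cos x = 2 * sin (x / 2) ^+ 2.
Proof.
have {1}-> : x = (x / 2) *+ 2 by rewrite -mulr_natr divfK.
by rewrite cos_mulr2n sin2cos2; ring.
Qed.

Lemma sin_le x : 0 <= x -> sin x <= x.
Proof.
rewrite le_eqVlt => /predU1P[<-|x0]; first by rewrite sin0.
by have [c _ ->] := sin_mvt x0; rewrite ler_piMl ?(ltW x0) ?cos_le1.
Qed.

Lemma oneBcos_le x : 0 <= x <= pi -> 1 - cos x <= x ^+ 2 / 2.
Proof.
move=> /andP[x0 xpi]; rewrite oneBcosE.
have h1 : sin (x / 2) <= x / 2 by apply: sin_le; lra.
have h2 : 0 <= sin (x / 2) by apply: sin_ge0_pi; lra.
by nra.
Qed.

Lemma oneBcos_ge x : 0 <= x <= pi -> x ^+ 2 / 8 <= 1 - cos x.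
Proof.
move=> /andP[]; rewrite le_eqVlt => /predU1P[<- _|x0 xpi].
  by rewrite cos0 expr0n mul0r subrr.
rewrite oneBcosE.
have {1}-> : x / 2 = (x / 4) *+ 2 by rewrite -mulr_natr; field.
rewrite sin_mulr2n.
have q : 2 * cos (pi / 4 : R) ^+ 2 = 1.
  have := cos_pihalf R; have -> : pi / 2 = (pi / 4 : R) *+ 2.
    by rewrite -mulr_natr; field.
  by rewrite cos_mulr2n; lra.
have cq : 0 <= cos (pi / 4 : R).
  by apply: cos_ge0_pihalf; have := pi_ge0 R; lra.
have c1 : cos (pi / 4) <= cos (x / 4) by apply: cos_decr; lra.
have [|c /andP[c0 cx] ->] := @sin_mvt (x / 4); first lra.
have c2 : cos (pi / 4) <= cos c by apply: cos_decr; lra.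
have h : 1 / 2 <= cos (x / 4) * cos c by nra.
have -> : (cos (x / 4) * (cos c * (x / 4))) *+ 2 = (cos (x / 4) * cos c) * (x / 2).
  by rewrite -mulr_natr; field.
rewrite exprMn; set k := cos (x / 4) * cos c in h *.
have k2 : 1 / 4 <= k ^+ 2 by nra.
have : 0 <= (k ^+ 2 - 1 / 4) * x ^+ 2 by rewrite mulr_ge0 ?sqr_ge0 ?subr_ge0.
by clear; lra.
Qed.

End Trigonometry.

Section PlanePolar.
Context (R : realType).
Implicit Types a b c t : R.

(** The squared third side of a triangle, by the law of cosines. *)
Definition chord2 a b t : R := a ^+ 2 + b ^+ 2 - 2 * a * b * cos t.

Lemma chord2E a b t s : chord2 a b (t - s) =
  (a * cos t - b * cos s) ^+ 2 + (a * sin t - b * sin s) ^+ 2.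
Proof.
rewrite /chord2 cosB.
have h1 := cos2Dsin2 t; have h2 := cos2Dsin2 s.
have -> : a ^+ 2 = a ^+ 2 * (cos t ^+ 2 + sin t ^+ 2) by rewrite h1 mulr1.
have -> : b ^+ 2 = b ^+ 2 * (cos s ^+ 2 + sin s ^+ 2) by rewrite h2 mulr1.
ring.
Qed.

Lemma chord2_ge0 a b t : 0 <= chord2 a b t.
Proof. by rewrite -(subr0 t) chord2E addr_ge0 ?sqr_ge0. Qed.

Lemma chord2N a b t : chord2 a b (- t) = chord2 a b t.
Proof. by rewrite /chord2 cosN. Qed.

Lemma chord2_sym a b t : chord2 a b t = chord2 b a t.
Proof. by rewrite /chord2; ring. Qed.

Lemma chord2_le a b t s : 0 <= a -> 0 <= b -> cos s <= cos t ->
  chord2 a b t <= chord2 a b s.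
Proof.
move=> a0 b0 st; rewrite /chord2 lerD2l lerN2 ler_wpM2l//.
by rewrite !mulr_ge0.
Qed.

Lemma sqrt_triangle (x y u v : R) :
  Num.sqrt ((x + u) ^+ 2 + (y + v) ^+ 2) <=
  Num.sqrt (x ^+ 2 + y ^+ 2) + Num.sqrt (u ^+ 2 + v ^+ 2).
Proof.
have p0 (a b : R) : 0 <= a ^+ 2 + b ^+ 2 by rewrite addr_ge0 ?sqr_ge0.
set p := Num.sqrt (x ^+ 2 + y ^+ 2); set q := Num.sqrt (u ^+ 2 + v ^+ 2).
have pE : p ^+ 2 = x ^+ 2 + y ^+ 2 by rewrite sqr_sqrtr.
have qE : q ^+ 2 = u ^+ 2 + v ^+ 2 by rewrite sqr_sqrtr.
have p_ge0 : 0 <= p by apply: sqrtr_ge0.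
have q_ge0 : 0 <= q by apply: sqrtr_ge0.
have cs : x * u + y * v <= p * q.
  rewrite leNgt; apply/negP => h.
  have : (p * q) ^+ 2 < (x * u + y * v) ^+ 2.
    by rewrite ltr_pXn2r ?nnegrE ?mulr_ge0// ltW// (le_lt_trans _ h)// mulr_ge0.
  by rewrite exprMn pE qE; have := sqr_ge0 (x * v - y * u); nra.
rewrite -[leRHS]ger0_norm ?addr_ge0// -sqrtr_sqr; apply: ler_wsqrtr.
have -> : (p + q) ^+ 2 = p ^+ 2 + q ^+ 2 + 2 * (p * q) by ring.
by rewrite pE qE; move: cs; move: (p * q) => k; clear; nra.
Qed.

Lemma chord_triangle a b c t s :
  Num.sqrt (chord2 a c (t + s)) <=
  Num.sqrt (chord2 a b t) + Num.sqrt (chord2 b c s).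
Proof.
have -> : t + s = t - (- s) by rewrite opprK.
rewrite -{2}[t]subr0 -[s in chord2 b c s]add0r -[X in 0 + X]opprK !chord2E.
apply: le_trans (sqrt_triangle _ _ _ _).
by rewrite le_eqVlt; apply/orP; left; apply/eqP; congr Num.sqrt; ring.
Qed.

(** Polar coordinates of the point that divides, in the ratio given by [l], the
    segment from the point with coordinates [(a, 0)] to the one with coordinates
    [(b, g)]. *)
Lemma polar_point a b g l : 0 <= a -> 0 <= b -> 0 <= g < pi -> 0 <= l <= 1 ->
  exists r u, [/\ 0 <= r, 0 <= u <= g,
    r * cos u = (1 - l) * a + l * (b * cos g) & r * sin u = l * (b * sin g)].
Proof.
move=> a0 b0 /andP[g0 gpi] /andP[l0 l1].
set X := (1 - l) * a + _; set Y := l * (b * sin g).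
have sg0 : 0 <= sin g by apply: sin_ge0_pi; rewrite g0 ltW.
have Y0 : 0 <= Y by rewrite !mulr_ge0.
pose r := Num.sqrt (X ^+ 2 + Y ^+ 2).
have r2 : r ^+ 2 = X ^+ 2 + Y ^+ 2 by rewrite sqr_sqrtr// addr_ge0 ?sqr_ge0.
have r0 : 0 <= r by apply: sqrtr_ge0.
have [rz|rn0] := eqVneq r 0.
  move: r2; rewrite rz expr0n /= => /esym/eqP.
  rewrite paddr_eq0 ?sqr_ge0// !expf_eq0 /= => /andP[/eqP-> /eqP->].
  by exists 0, 0; rewrite !mul0r lexx; split=> //; rewrite lexx.
have rp : 0 < r by rewrite lt0r rn0.
have Xr : -1 <= X / r <= 1.
  rewrite ler_pdivlMr// ler_pdivrMr// mulN1r mul1r -ler_norml.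
  by rewrite -(@ler_pXn2r _ 2) ?nnegrE// real_normK ?num_real// r2 lerDl sqr_ge0.
pose u := acos (X / r).
have cu : cos u = X / r by rewrite acosK// in_itv.
have u0 : 0 <= u by apply: acos_ge0.
have upi : u <= pi by apply: acos_lepi.
have su0 : 0 <= sin u by apply: sin_ge0_pi; rewrite u0.
have rc : r * cos u = X by rewrite cu mulrC divfK.
have rs : r * sin u = Y.
  apply/eqP; rewrite -(@eqrXn2 _ 2) ?mulr_ge0// exprMn sin2cos2 mulrBr mulr1 r2.
  by rewrite -r2 -exprMn rc r2 addrAC subrr add0r.
exists r, u; split=> //; rewrite u0 /= leNgt; apply/negP => gu.
have h : r * sin (g - u) = (1 - l) * a * sin g.
  by rewrite sinB mulrBr mulrCA rc [r * (_ * _)]mulrCA rs /X /Y; ring.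
have h0 : 0 <= r * sin (g - u) by rewrite h !mulr_ge0// subr_ge0.
rewrite pmulr_rge0// -(opprB u g) sinN oppr_ge0 in h0.
have [ug|] := ltP (u - g) pi.
  by have := @sin_gt0_pi _ (u - g); rewrite ug subr_gt0 gu => /(_ isT); lra.
move=> piug; have gz : g = 0 by lra.
have uz : u = pi by lra.
move: rc; rewrite uz cospi mulrN1 /X gz cos0 mulr1 => E.
have : 0 <= (1 - l) * a + l * b by rewrite addr_ge0 ?mulr_ge0// subr_ge0.
by rewrite -E; lra.
Qed.

End PlanePolar.

(** * Euclidean cones over links *)

Lemma real_seq_complete (R : realType) (u : nat -> R) :
  (forall e, 0 < e -> exists N, forall m n, (N <= m)%N -> (N <= n)%N ->
    `|u m - u n| < e) ->
  exists l, forall e, 0 < e -> exists N, forall n, (N <= n)%N -> `|u n - l| < e.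
Proof.
move=> cu; have : cauchy (u @ \oo)%classic.
  apply/cauchyP => e e0; have [N NP] := cu e e0.
  exists (u N); exists N => //= n Nn; rewrite -ball_normE /=.
  exact: NP.
move/cauchy_cvg => /cvg_ex[l /cvgrPdist_lt ul]; exists l => e /ul[N _ NP].
by exists N => n Nn; rewrite distrC; exact: NP.
Qed.

Section Cone.
Context (R : realType) (P : pmetric R).
Hypothesis P_le_pi : forall x y : P, pdist x y <= pi.

(** The absolute values allow all real numbers as radii. *)
Definition cone_dist (p q : P * R) : R :=
  Num.sqrt (chord2 `|p.2| `|q.2| (pdist p.1 q.1)).

Let d_ge0 (x y : P) : 0 <= pdist x y.
Proof. exact: pdist_ge0. Qed.

Lemma cone_dist2 p q : cone_dist p q ^+ 2 = chord2 `|p.2| `|q.2| (pdist p.1 q.1).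
Proof. by rewrite sqr_sqrtr ?chord2_ge0. Qed.

Lemma cone_distxx p : cone_dist p p = 0.
Proof.
rewrite /cone_dist pdistxx /chord2 cos0 (_ : _ - _ = 0) ?sqrtr0//; ring.
Qed.

Lemma cone_dist_sym p q : cone_dist p q = cone_dist q p.
Proof. by rewrite /cone_dist pdist_sym chord2_sym. Qed.

(** Triangles with apex angles [a] and [t - a], where [t] is the smaller one of
    [a + b] and [pi], are put side by side in the plane. *)
Lemma cone_dist_triangle q p r :
  cone_dist p r <= cone_dist p q + cone_dist q r.
Proof.
pose a := pdist p.1 q.1; pose b := pdist q.1 r.1.
pose t := Num.min (a + b) pi.
have tab : t <= a + b by rewrite /t ge_min lexx.
have tpi : t <= pi by rewrite /t ge_min lexx orbT.
have at' : a <= t by rewrite /t le_min P_le_pi lerDl d_ge0.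
apply: (@le_trans _ _ (Num.sqrt (chord2 `|p.2| `|r.2| (a + (t - a))))).
  apply: ler_wsqrtr; apply: chord2_le => //; rewrite addrC subrK.
  apply: cos_decr => //; rewrite /t le_min P_le_pi andbT.
  exact: pdist_triangle.
apply: le_trans (chord_triangle _ `|q.2| _ _ _) _; rewrite lerD2l.
apply: ler_wsqrtr; apply: chord2_le => //; apply: cos_decr => //.
- by rewrite subr_ge0.
- by rewrite lerBlDl.
Qed.

Definition cone : pmetric R :=
  PMetric cone_distxx cone_dist_sym cone_dist_triangle.

Lemma cone_dist_radius p q : `| `|p.2| - `|q.2| | <= cone_dist p q.
Proof.
rewrite -(@ler_pXn2r _ 2) ?nnegrE ?sqrtr_ge0// cone_dist2 real_normK ?num_real//.
have := cos_le1 (pdist p.1 q.1); rewrite /chord2.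
have := mulr_ge0 (normr_ge0 p.2) (normr_ge0 q.2).
by set a := `|p.2|; set b := `|q.2|; nra.
Qed.

(** If the radii tend to zero, the limit is the apex. Otherwise they are bounded
    below, and the directions form a Cauchy sequence. *)
Lemma cone_complete (x0 : P) : seq_complete P -> seq_complete cone.
Proof.
move=> cP u cu; pose r n := `|(u n).2|.
have [e /cu[N NP]|l lP] := @real_seq_complete R r.
  exists N => m n Nm Nn; apply: le_lt_trans (cone_dist_radius (u m) (u n)) _.
  exact: NP.
have l0 : 0 <= l.
  rewrite leNgt; apply/negP => l0; have [|N NP] := lP (- l); first by rewrite oppr_gt0.
  have := NP N (leqnn _); rewrite ltr_norml => /andP[_].
  have : 0 <= r N by apply: normr_ge0.
  by lra.
have [l00|lpos] := eqVneq l 0.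
  exists (x0, 0) => e e0; have [N NP] := lP e e0; exists N => n Nn.
  rewrite /pdist /= /cone_dist /= /chord2 normr0 mulr0 mul0r subr0 expr0n addr0.
  rewrite sqrtr_sqr normr_id; have := NP n Nn; rewrite l00 subr0.
  by rewrite /r normr_id.
have {}lpos : 0 < l by rewrite lt0r lpos.
have [N1 N1P] := lP (l / 2) (divr_gt0 lpos (ltr0n _ 2)).
have rl n : (N1 <= n)%N -> l / 2 < r n < 2 * l.
  by move/N1P; rewrite ltr_norml => /andP[h1 h2]; apply/andP; split; lra.
have [e e0|x xP] := cP (fun n => (u n).1).
  have [N NP] := cu (e * l / 4) (divr_gt0 (mulr_gt0 e0 lpos) (ltr0n _ 4)).
  exists (maxn N N1) => m n; rewrite !geq_max => /andP[Nm N1m] /andP[Nn N1n].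
  have := NP _ _ Nm Nn; rewrite -[pdist (u m) (u n)]/(cone_dist (u m) (u n)) => h.
  have {h} : cone_dist (u m) (u n) ^+ 2 < (e * l / 4) ^+ 2.
    by rewrite ltr_pXn2r ?nnegrE ?sqrtr_ge0// ltW// (le_lt_trans _ h)// sqrtr_ge0.
  rewrite cone_dist2 -/(r m) -/(r n); set t := pdist _ _ => h.
  have tpi : 0 <= t <= pi by rewrite d_ge0 P_le_pi.
  have h8 := oneBcos_ge tpi.
  rewrite ltNge; apply/negP => et.
  have /andP[m1 _] := rl _ N1m; have /andP[n1 _] := rl _ N1n.
  have rr : l ^+ 2 / 4 <= r m * r n by nra.
  have e2 : e ^+ 2 <= t ^+ 2 by rewrite lerXn2r ?nnegrE ?(ltW e0)// d_ge0.
  have : (r m - r n) ^+ 2 + 2 * (r m * r n) * (1 - cos t) < (e * l / 4) ^+ 2.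
    by apply: le_lt_trans h; rewrite /chord2 le_eqVlt; apply/orP; left; apply/eqP; ring.
  have c0 : 0 <= 1 - cos t by rewrite subr_ge0 cos_le1.
  have k1 : 2 * (l ^+ 2 / 4) * (e ^+ 2 / 8) <= 2 * (r m * r n) * (1 - cos t).
    by apply: ler_pM; rewrite ?mulr_ge0 ?divr_ge0 ?sqr_ge0//; lra.
  have := sqr_ge0 (r m - r n); move: k1; clear; lra.
exists (x, l) => e e0.
have e2 : 0 < e / 2 by rewrite divr_gt0.
have e4 : 0 < e / (4 * l) by rewrite divr_gt0 ?mulr_gt0.
have [N2 N2P] := lP _ e2; have [N3 N3P] := xP _ e4.
exists (maxn N1 (maxn N2 N3)) => n; rewrite !geq_max => /and3P[n1 n2 n3].
have := N2P _ n2; have := N3P _ n3; have /andP[_ r2] := rl _ n1.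
rewrite -[X in _ -> _ -> X < e]/(cone_dist (u n) (x, l)); set t := pdist _ _ => te re.
have tpi : 0 <= t <= pi by rewrite d_ge0 P_le_pi.
have [t0 _] := andP tpi; have h2 := oneBcos_le tpi.
apply: (@le_lt_trans _ _ (`|r n - l| + 2 * l * t)); last first.
  have : 2 * l * t < e / 2.
    move: te; rewrite ltr_pdivlMr ?mulr_gt0// => te.
    by rewrite -(ltr_pM2r (ltr0n _ 2)) divfK//; lra.
  by lra.
rewrite -(@ler_pXn2r _ 2) ?nnegrE ?sqrtr_ge0 ?addr_ge0 ?mulr_ge0 ?normr_ge0//.
rewrite cone_dist2 /= -/(r n) -/t (ger0_norm l0).
have -> : chord2 (r n) l t = (r n - l) ^+ 2 + 2 * (r n * l) * (1 - cos t).
  by rewrite /chord2; ring.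
rewrite -[(r n - l) ^+ 2]real_normK ?num_real//; set a := `|r n - l|.
have a0 : 0 <= a by apply: normr_ge0.
have r0 : 0 <= r n by apply: normr_ge0.
have k : 2 * (r n * l) * (1 - cos t) <= 2 * (2 * l * l) * (t ^+ 2 / 2).
  apply: ler_pM => //; rewrite ?mulr_ge0 ?subr_ge0 ?cos_le1//.
  by rewrite ler_wpM2l// ler_wpM2r// ltW.
have : 0 <= a * (l * t) by rewrite !mulr_ge0.
have : 0 <= (l * t) ^+ 2 by apply: sqr_ge0.
by move: k; clear; lra.
Qed.

(** Stewart's equality in a plane configuration whose distances compare to those
    of the cone as stated. *)
Lemma cone_comparison p q (u : P) (r l g v w : R) (z : P * R) :
  0 <= l <= 1 -> 0 <= r ->
  r * cos v = (1 - l) * `|p.2| + l * (`|q.2| * cos g) ->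
  r * sin v = l * (`|q.2| * sin g) ->
  cos (pdist p.1 q.1) = cos g ->
  cos (pdist z.1 p.1) <= cos w -> cos (pdist z.1 q.1) <= cos (w - g) ->
  cos (w - v) <= cos (pdist z.1 u) ->
  cone_dist z (u, r) ^+ 2 <= (1 - l) * cone_dist z p ^+ 2
    + l * cone_dist z q ^+ 2 - l * (1 - l) * cone_dist p q ^+ 2.
Proof.
move=> /andP[l0 l1] r0 rc rs pq zp zq zu; rewrite !cone_dist2 /= (ger0_norm r0).
set a := `|p.2| in rc rs *; set b := `|q.2| in rc rs *; set t := `|z.2|.
have [a0 [b0 t0]] : 0 <= a /\ 0 <= b /\ 0 <= t by rewrite !normr_ge0.
apply: le_trans (chord2_le t0 r0 zu) _.
apply: (@le_trans _ _ ((1 - l) * chord2 t a (w - 0) + l * chord2 t b (w - g)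
    - l * (1 - l) * chord2 a b (0 - g))); last first.
  rewrite sub0r chord2N subr0 [chord2 a b g]/chord2 -pq.
  by rewrite lerD2r lerD// ler_wpM2l ?subr_ge0//; apply: chord2_le.
rewrite !chord2E rc rs cos0 sin0 le_eqVlt; apply/orP; left; apply/eqP.
set C := cos w; set S := sin w; set c := cos g; set s := sin g.
by ring.
Qed.

End Cone.

Section Links.
Context (R : realType).
Implicit Types P Q : pmetric R.

(** The distance in a circle of length [2 * pi] of the end points of an arc of
    length [s]. *)
Definition circle_arc (s : R) : R := Num.min s (2 * pi - s).

(** A link is a geodesic space of diameter at most [pi] in which a geodesic
    arriving at an interior point of another one continues, as a local geodesic,
    along at least one of its two halves, and in which no local geodesic closes
    up before length [2 * pi]. *)
Definition is_link P : Prop :=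
  (forall x y : P, pdist x y <= pi) /\
  forall x y : P, pdist x y < pi -> forall l, 0 <= l <= 1 ->
    exists u, [/\ pdist x u = l * pdist x y, pdist u y = (1 - l) * pdist x y &
      forall w, pdist w u < pi ->
        circle_arc (pdist w u + pdist u x) <= pdist w x \/
        circle_arc (pdist w u + pdist u y) <= pdist w y].

Lemma cos_arc s t : 0 <= s <= 2 * pi -> circle_arc s <= t -> t <= pi ->
  cos t <= cos s :> R.
Proof.
rewrite /circle_arc /Num.min => /andP[s0 s2]; case: ltP => h st tpi.
  by apply: cos_decr => //; lra.
rewrite -[s]opprK cosN -[cos (- s)](cosD2pi (- s)) -mulr_natr mulrC.
by apply: cos_decr; lra.
Qed.

(** If the directions of [p] and [q] have distance [pi], the segment passes
    through the apex. Otherwise its points have directions on the geodesic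
    between them. By the link condition, the geodesic from the direction of [z]
    continues along one half of this geodesic; unfolding along it gives a
    configuration in the plane in which the distances from [z] to both ends are
    at most those in the cone. *)
Lemma cone_bruhat_tits P (hP : is_link P) :
  bruhat_tits (@pdist R (cone (proj1 hP))).
Proof.
have [le_pi geo] := hP.
move=> p q l l01; rewrite -[@pdist _ (cone _)]/(@cone_dist R P).
set g := pdist p.1 q.1; have g0 : 0 <= g by apply: pdist_ge0.
have d0 (x y : P) : 0 <= pdist x y by apply: pdist_ge0.
have [gpi|] := ltP g pi; last first.
  move=> pig; have {pig}gE : g = pi by apply/eqP; rewrite eq_le pig le_pi.
  have tri z : pi <= pdist z p.1 + pdist z q.1.
    rewrite -gE [pdist z p.1]pdist_sym; exact: pdist_triangle.
  have [m0|m0] := leP 0 ((1 - l) * `|p.2| - l * `|q.2|).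
    exists (p.1, (1 - l) * `|p.2| - l * `|q.2|) => z.
    apply: (@cone_comparison _ _ _ _ _ _ _ g 0 (pdist z.1 p.1)) => //.
    - by rewrite cos0 gE cospi; ring.
    - by rewrite sin0 gE sinpi !mulr0.
    - rewrite gE -opprB cosN; apply: cos_decr; rewrite ?subr_ge0 ?le_pi//.
      by rewrite lerBlDl.
    - by rewrite subr0.
  exists (q.1, l * `|q.2| - (1 - l) * `|p.2|) => z.
  apply: (@cone_comparison _ _ _ _ _ _ _ g pi (pi - pdist z.1 q.1)) => //.
  - by lra.
  - by rewrite gE cospi; ring.
  - by rewrite gE sinpi !mulr0.
  - by apply: cos_decr; rewrite ?subr_ge0 ?le_pi// lerBlDr.
  - by rewrite gE addrAC subrr add0r cosN.
  - by rewrite addrAC subrr add0r cosN.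
have [|r [v [r0 /andP[v0 vg] rc rs]]] :=
    polar_point (normr_ge0 p.2) (normr_ge0 q.2) _ l01 (g := g).
  by rewrite g0.
pose k := if g == 0 then 0 else v / g.
have kg : k * g = v.
  rewrite /k; case: eqP => [g00|/eqP gn0]; last by rewrite divfK.
  by rewrite mul0r; move: vg; rewrite g00; lra.
have k01 : 0 <= k <= 1.
  rewrite /k; case: eqP => [_|/eqP gn0]; first by rewrite lexx ler01.
  have gp : 0 < g by rewrite lt0r gn0.
  by rewrite divr_ge0//= ler_pdivrMr// mul1r.
have [u [xu uy uw]] := geo p.1 q.1 gpi k k01.
rewrite -/g kg in xu; rewrite -/g mulrBl mul1r kg in uy.
exists (u, r) => z.
have ux : pdist u p.1 = v by rewrite pdist_sym.
have [zu|zu] := ltP (pdist z.1 u) pi; last first.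
  have {zu}zuE : pdist z.1 u = pi by apply/eqP; rewrite eq_le zu le_pi.
  apply: (cone_comparison l01 r0 rc rs (w := v + pi)) => //.
  - rewrite cosDpi -[- cos v](cosDpi) -(cosN (v + pi)) -(cosD2pi (- (v + pi))).
    have -> : - (v + pi) + pi *+ 2 = pi - v by ring.
    apply: cos_decr; rewrite ?le_pi//; first by lra.
    by have := pdist_triangle p.1 z.1 u; rewrite zuE xu; lra.
  - have -> : v + pi - g = pi - (g - v) by ring.
    apply: cos_decr; rewrite ?le_pi//; first by lra.
    by have := pdist_triangle q.1 z.1 u; rewrite zuE [pdist q.1 u]pdist_sym uy; lra.
  - by rewrite addrAC subrr add0r zuE.
set a := pdist z.1 u in zu; have a0 : 0 <= a by apply: d0.
(* The direction of [z] is unfolded to the angle [v + a] or [v - a] from the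
   direction of [p], on the side along which the geodesic from [z] continues. *)
have [zx|zy] := uw z.1 zu.
  apply: (cone_comparison l01 r0 rc rs (w := v + a)) => //.
  - rewrite addrC; apply: cos_arc; rewrite ?le_pi//; last by move: zx; rewrite ux.
    by rewrite addr_ge0//; lra.
  - have -> : v + a - g = a - (g - v) by ring.
    rewrite -(cos_norm (a - _)); apply: cos_decr; rewrite ?le_pi//.
    rewrite ler_norml; have := pdist_triangle z.1 u q.1.
    have := pdist_triangle q.1 z.1 u.
    rewrite [pdist q.1 u]pdist_sym [pdist u z.1]pdist_sym uy -/a => h1 h2.
    have := pdist_triangle u z.1 q.1.
    by move: h1 h2; lra.
  - by rewrite addrAC subrr add0r.
apply: (cone_comparison l01 r0 rc rs (w := v - a)) => //.
- rewrite -(cos_norm (v - a)); apply: cos_decr; rewrite ?le_pi//.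
  rewrite ler_norml; have := pdist_triangle z.1 u p.1.
  have := pdist_triangle p.1 z.1 u.
  rewrite ux xu [pdist u z.1]pdist_sym -/a => h1 h2.
  by move: h1 h2; lra.
- have -> : v - a - g = - (a + (g - v)) by ring.
  rewrite cosN; apply: cos_arc; rewrite ?le_pi//; last by move: zy; rewrite uy.
  by rewrite addr_ge0//; lra.
- by rewrite addrAC subrr add0r cosN.
Qed.

End Links.

(** * Disjoint unions of links and products of cones *)

Section LinkSum.
Context (R : realType) (P : nat -> pmetric R).
Hypothesis linkP : forall k, is_link (P k).

(** Taking different links at distance [pi] from each other amounts to gluing
    their cones at the apex. *)
Definition sum_dist (x y : {k : nat & P k}) : R :=
  if tag y == tag x then pdist (tagged x) (tagged_as x y) else pi.

Lemma sum_dist_same k (a b : P k) :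
  sum_dist (existT _ k a) (existT _ k b) = pdist a b.
Proof. by rewrite /sum_dist eqxx tagged_asE. Qed.

Lemma sum_dist_diff x y : tag x != tag y -> sum_dist x y = pi.
Proof. by rewrite /sum_dist eq_sym => /negbTE ->. Qed.

Lemma sum_dist_le_pi x y : sum_dist x y <= pi.
Proof.
case: x y => i a [j b]; have [E|ij] := eqVneq i j; last first.
  by rewrite sum_dist_diff.
by case: _ / E b => b; rewrite sum_dist_same; exact: (linkP i).1.
Qed.

Lemma sum_dist_ge0 x y : 0 <= sum_dist x y.
Proof.
case: x y => i a [j b]; have [E|ij] := eqVneq i j; last first.
  by rewrite sum_dist_diff// pi_ge0.
by case: _ / E b => b; rewrite sum_dist_same pdist_ge0.
Qed.

Lemma sum_distxx x : sum_dist x x = 0.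
Proof. by case: x => i a; rewrite sum_dist_same pdistxx. Qed.

Lemma sum_dist_sym x y : sum_dist x y = sum_dist y x.
Proof.
case: x y => i a [j b]; have [E|ij] := eqVneq i j; last first.
  by rewrite !sum_dist_diff// eq_sym.
by case: _ / E b => b; rewrite !sum_dist_same pdist_sym.
Qed.

Lemma sum_dist_triangle y x z : sum_dist x z <= sum_dist x y + sum_dist y z.
Proof.
case: x y z => i a [j b] [k c].
have [E|ij] := eqVneq i j; last first.
  rewrite [sum_dist _ (existT _ j b)]sum_dist_diff//.
  by apply: le_trans (sum_dist_le_pi _ _) _; rewrite lerDl sum_dist_ge0.
case: _ / E b => b; have [E|ik] := eqVneq i k; last first.
  by rewrite 2?[sum_dist _ (existT _ k c)]sum_dist_diff// lerDr sum_dist_ge0.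
by case: _ / E c => c; rewrite !sum_dist_same; exact: pdist_triangle.
Qed.

Definition link_sum : pmetric R :=
  PMetric sum_distxx sum_dist_sym sum_dist_triangle.

Lemma link_sum_link : is_link link_sum.
Proof.
split=> [x y|]; first exact: sum_dist_le_pi.
case=> i a [j b]; rewrite -[@pdist _ link_sum]/sum_dist.
have [E|ij] := eqVneq i j; last by rewrite sum_dist_diff// ltxx.
case: _ / E b => b; rewrite sum_dist_same => ab l l01.
have [u [au ub uw]] := (linkP i).2 a b ab l l01.
exists (existT _ i u); rewrite !sum_dist_same; split=> // -[k w].
have [E|ik] := eqVneq i k; last by rewrite sum_dist_diff ?ltxx// eq_sym.
by case: _ / E w => w; rewrite !sum_dist_same; exact: uw.
Qed.

Lemma link_sum_complete :
  (forall k, seq_complete (P k)) -> seq_complete link_sum.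
Proof.
move=> cP u cu; have [N0 N0P] := cu pi (pi_gt0 R).
pose i := tag (u N0); pose v n := tagged_as (u N0) (u n).
have uv n : (N0 <= n)%N -> u n = existT _ i (v n).
  move=> Nn; have := N0P _ _ (leqnn N0) Nn.
  rewrite -[@pdist _ link_sum]/sum_dist /sum_dist; case: eqP => [E _|]; last by rewrite ltxx.
  rewrite /v /i; case: (u n) E => j b /= E; case: (u N0) E => k a /= E.
  by case: _ / E a => a; rewrite tagged_asE.
have [e e0|x xP] := cP i v.
  have [N NP] := cu e e0; exists (maxn N N0) => m n.
  rewrite !geq_max => /andP[Nm N0m] /andP[Nn N0n].
  have := NP _ _ Nm Nn; rewrite -[@pdist _ link_sum]/sum_dist (uv _ N0m) (uv _ N0n).
  by rewrite sum_dist_same.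
exists (existT _ i x) => e e0; have [N NP] := xP e e0; exists (maxn N N0) => n.
rewrite geq_max => /andP[Nn N0n].
by rewrite -[@pdist _ link_sum]/sum_dist (uv _ N0n) sum_dist_same NP.
Qed.

End LinkSum.

Section Product.
Context (R : realType) (P Q : pmetric R).

Definition prod_dist (x y : P * Q) : R :=
  Num.sqrt (pdist x.1 y.1 ^+ 2 + pdist x.2 y.2 ^+ 2).

Lemma prod_dist2 x y :
  prod_dist x y ^+ 2 = pdist x.1 y.1 ^+ 2 + pdist x.2 y.2 ^+ 2.
Proof. by rewrite sqr_sqrtr// addr_ge0 ?sqr_ge0. Qed.

Lemma prod_distxx x : prod_dist x x = 0.
Proof. by rewrite /prod_dist !pdistxx expr0n addr0 sqrtr0. Qed.

Lemma prod_dist_sym x y : prod_dist x y = prod_dist y x.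
Proof. by rewrite /prod_dist pdist_sym [pdist x.2 _]pdist_sym. Qed.

Lemma prod_dist_triangle y x z : prod_dist x z <= prod_dist x y + prod_dist y z.
Proof.
apply: le_trans (sqrt_triangle _ _ _ _); apply: ler_wsqrtr.
by apply: lerD; apply: lerXn2r; rewrite ?nnegrE ?addr_ge0 ?pdist_ge0//;
  exact: pdist_triangle.
Qed.

Definition prod_pmetric : pmetric R :=
  PMetric prod_distxx prod_dist_sym prod_dist_triangle.

Lemma prod_dist_ge x y :
  pdist x.1 y.1 <= prod_dist x y /\ pdist x.2 y.2 <= prod_dist x y.
Proof.
by split; rewrite -(@ler_pXn2r _ 2) ?nnegrE ?sqrtr_ge0 ?pdist_ge0// prod_dist2
  ?lerDl ?lerDr sqr_ge0.
Qed.

Lemma prod_dist_le x y : prod_dist x y <= pdist x.1 y.1 + pdist x.2 y.2.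
Proof.
rewrite -(@ler_pXn2r _ 2) ?nnegrE ?sqrtr_ge0 ?addr_ge0 ?pdist_ge0// prod_dist2.
by have := mulr_ge0 (pdist_ge0 x.1 y.1) (pdist_ge0 x.2 y.2); nra.
Qed.

Lemma prod_complete : seq_complete P -> seq_complete Q ->
  seq_complete prod_pmetric.
Proof.
move=> cP cQ u cu.
have [e e0|x xP] := cP (fun n => (u n).1).
  have [N NP] := cu e e0; exists N => m n Nm Nn.
  exact: le_lt_trans (prod_dist_ge _ _).1 (NP _ _ Nm Nn).
have [e e0|y yP] := cQ (fun n => (u n).2).
  have [N NP] := cu e e0; exists N => m n Nm Nn.
  exact: le_lt_trans (prod_dist_ge _ _).2 (NP _ _ Nm Nn).
exists (x, y) => e e0; have e2 : 0 < e / 2 by rewrite divr_gt0.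
have [N NP] := xP _ e2; have [N' NP'] := yP _ e2.
exists (maxn N N') => n; rewrite geq_max => /andP[Nn Nn'].
apply: le_lt_trans (prod_dist_le _ _) _; rewrite (splitr e).
by apply: ltrD; [exact: NP|exact: NP'].
Qed.

Lemma prod_bruhat_tits : bruhat_tits (@pdist R P) -> bruhat_tits (@pdist R Q) ->
  bruhat_tits (@pdist R prod_pmetric).
Proof.
move=> bP bQ x y l l01; have [u uP] := bP x.1 y.1 l l01.
have [v vP] := bQ x.2 y.2 l l01; exists (u, v) => z.
rewrite -[@pdist _ prod_pmetric]/prod_dist !prod_dist2 /=.
by apply: le_trans (lerD (uP z.1) (vP z.2)) _; rewrite le_eqVlt; apply/orP; left;
  apply/eqP; ring.
Qed.

End Product.

(** * Non-backtracking walks *)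

Section NonBacktracking.
Variables (G : graph) (g : nat).
Hypothesis cG : forall x y : G, connect (@adj G) x y.
Hypothesis girthG : girth_ge G g.

(** Walks are maps on [nat], of which only the first [n + 1] values matter. In
    this way pieces of walks, reversed walks and concatenations are obtained by
    reindexing. *)
Definition nb_walk (p : nat -> G) (n : nat) : Prop :=
  (forall i, (i < n)%N -> adj (p i) (p i.+1)) /\
  (forall i, (i.+2 <= n)%N -> p i != p i.+2).

Lemma nb_walk_sub p n i j : nb_walk p n -> (i + j <= n)%N ->
  nb_walk (fun k => p (i + k)%N) j.
Proof.
move=> [pa pn] ijn; split=> k kj; rewrite !addnS; first by apply: pa; lia.
by apply: pn; lia.
Qed.

Fixpoint down_walk (p : nat -> G) (n : nat) : seq G :=
  if n is m.+1 then p m :: down_walk p m else [::].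

Lemma size_down_walk p n : size (down_walk p n) = n.
Proof. by elim: n => //= n ->. Qed.

Lemma last_down_walk p n : last (p n) (down_walk p n) = p 0%N.
Proof. by elim: n => //= n ->. Qed.

Lemma path_down_walk (e : rel G) p n :
  (forall i, (i < n)%N -> e (p i.+1) (p i)) -> path e (p n) (down_walk p n).
Proof.
elim: n => //= n IH pe; rewrite pe// IH// => i im; apply: pe.
exact: leqW.
Qed.

Lemma path_vertex_dist (x y : G) p : path (@adj G) x p -> y \in x :: p ->
  y != last x p -> (gdist x y < size p)%N.
Proof.
move=> xp yp; case/splitPl: yp xp => p1 p2 yE.
rewrite cat_path last_cat size_cat yE => /andP[xp1 _].
case: p2 => [|z p2]; first by rewrite eqxx.
by move=> _; rewrite /= addnS ltnS (leq_trans (gdist_min xp1 yE))// leq_addr.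
Qed.

(** A shortcut between the ends of a shortest counterexample avoids the last
    edge. Going back along the walk and then along the shortcut joins the ends
    of this edge, in contradiction to the girth. *)
Lemma nb_walk_geodesic p n : nb_walk p n -> (2 * n < g + 2)%N ->
  gdist (p 0%N) (p n) = n.
Proof.
elim/ltn_ind: n => -[|n] IH pn ng; first by rewrite gdistxx.
have sub m : (m <= n)%N -> gdist (p 0%N) (p m) = m.
  move=> mn; apply: IH; [by []| |lia].
  by apply: (nb_walk_sub (i := 0) pn); lia.
have [pa pb] := pn.
have adjn := pa n (ltnSn n).
apply/eqP; rewrite eqn_leq; apply/andP; split.
  apply: leq_trans (gdist_triangle cG (p n) _ _) _.
  by rewrite sub// -[leqRHS]addn1 leq_add2l gdist_adj.
rewrite leqNgt ltnS; apply/negP => short.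
have [q [xq qy qs]] := gdist_path cG (p 0%N) (p n.+1).
have qn : p n \notin p 0%N :: q.
  apply/negP => pq; have := path_vertex_dist xq pq; rewrite qy.
  have -> : p n != p n.+1 by apply: contraTneq adjn => <-; rewrite adj_irr.
  by move=> /(_ isT); rewrite sub// qs ltnNge short.
have := girthG adjn (p := down_walk p n ++ q).
rewrite last_cat last_down_walk size_cat size_down_walk cat_path last_down_walk.
suff -> : path (fun x y => adj x y && ([set x; y]%SET != [set p n; p n.+1]%SET))
    (p n) (down_walk p n) && path (fun x y => adj x y &&
    ([set x; y]%SET != [set p n; p n.+1]%SET)) (p 0%N) q.
  by move=> /(_ isT qy); rewrite qs; lia.
apply/andP; split; last first.
  apply: (sub_in_path (P := fun x => x != p n)) xq => [x y|].
    move=> xn yn -> /=; apply: contraNneq xn => E.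
    have : p n \in [set x; y]%SET by rewrite E !inE eqxx.
    by rewrite !inE ![p n == _]eq_sym => /orP[//|]; rewrite (negbTE (yn : y != p n)).
  by apply/allP => x xq0; apply: contraNneq qn => <-.
apply: path_down_walk => i im; rewrite adj_sym pa ?leqW//=.
apply/eqP => E.
have ne j : (j < n)%N -> p j != p n.
  by move=> jn; apply/eqP => pj; have := sub j (ltnW jn); rewrite pj sub//; lia.
have : p n \in [set p i.+1; p i]%SET by rewrite E !inE eqxx.
rewrite !inE => /orP[/eqP iE|]; last by rewrite eq_sym (negbTE (ne i im)).
have iN : i.+1 = n.
  have : (i.+1 <= n)%N by [].
  by rewrite leq_eqVlt => /orP[/eqP//|/ne]; rewrite -iE eqxx.
have : p n.+1 \in [set p i.+1; p i]%SET by rewrite E !inE eqxx orbT.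
rewrite !inE iN => /orP[/eqP nE|/eqP nE].
  by move: adjn; rewrite nE adj_irr.
by have := pb i; rewrite iN nE eqxx => /(_ (ltnSn _)).
Qed.

End NonBacktracking.

(** * Metric graphs *)

Section MetricGraph.
Context (R : realType).
Variables (G : graph) (k : nat).
Hypothesis cG : forall x y : G, connect (@adj G) x y.
Hypothesis girthG : girth_ge G (2 * k + 8).

(** [(v, w, t)] stands for the point at distance [t] from [v] on the edge from
    [v] to [w]. *)
Definition edge_point := (G * G * R)%type.

Definition on_edge (x : edge_point) : bool := adj x.1.1 x.1.2 && (0 <= x.2 <= 1).

Definition flip (x : edge_point) : edge_point := (x.1.2, x.1.1, 1 - x.2).

Definition vertex_dist (x : edge_point) (a : G) : R :=
  Num.min (x.2 + (gdist x.1.1 a)%:R) (1 - x.2 + (gdist x.1.2 a)%:R).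

(** The Kuratowski distance: the supremum distance of the functions measuring
    distances to the vertices. That it is a pseudometric is clear from the
    definition, and it agrees with the path metric at the distances that matter.
    *)
Definition edge_dist (x y : edge_point) : R :=
  \big[Num.max/0]_(a : G) `|vertex_dist x a - vertex_dist y a|.

Lemma vertex_dist_flip x : vertex_dist (flip x) = vertex_dist x.
Proof.
apply/funext => a; rewrite /vertex_dist /= minC; congr Num.min; ring.
Qed.

Lemma edge_dist_ge x y a : `|vertex_dist x a - vertex_dist y a| <= edge_dist x y.
Proof. exact: le_bigmax. Qed.

Lemma edge_dist_le x y c : 0 <= c ->
  (forall a, `|vertex_dist x a - vertex_dist y a| <= c) -> edge_dist x y <= c.
Proof. by move=> c0 h; apply: bigmax_le. Qed.

Lemma edge_dist_ge0 x y : 0 <= edge_dist x y.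
Proof. exact: bigmax_ge_id. Qed.

Lemma edge_distxx x : edge_dist x x = 0.
Proof.
apply/eqP; rewrite eq_le edge_dist_ge0 andbT; apply: edge_dist_le => // a.
by rewrite subrr normr0.
Qed.

Lemma edge_dist_sym x y : edge_dist x y = edge_dist y x.
Proof. by apply: eq_bigr => a _; rewrite distrC. Qed.

Lemma edge_dist_triangle y x z : edge_dist x z <= edge_dist x y + edge_dist y z.
Proof.
apply: edge_dist_le => [|a]; first by rewrite addr_ge0 ?edge_dist_ge0.
apply: le_trans (lerD (edge_dist_ge x y a) (edge_dist_ge y z a)).
by rewrite (le_trans _ (ler_normD _ _))// addrA subrK.
Qed.

Lemma edge_distE x x' y y' : vertex_dist x = vertex_dist x' ->
  vertex_dist y = vertex_dist y' -> edge_dist x y = edge_dist x' y'.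
Proof. by rewrite /edge_dist => -> ->. Qed.

Definition walk_point (p : nat -> G) (i : nat) (t : R) : edge_point :=
  (p i, p i.+1, t).

Lemma gdist_adj_le (v w a : G) : adj v w ->
  (gdist v a)%:R <= 1 + (gdist w a)%:R :> R.
Proof.
move=> vw; rewrite addrC natr1 ler_nat.
apply: leq_trans (gdist_triangle cG w _ _) _.
by rewrite -addn1 addnC leq_add2l gdist_adj.
Qed.

Lemma edge_dist_same_edge v w t t' :
  edge_dist (v, w, t) (v, w, t') <= `|t - t'|.
Proof.
apply: edge_dist_le => // a; rewrite /vertex_dist /=.
move: (gdist v a)%:R (gdist w a)%:R => b c.
rewrite ler_norml; case: (lerP (t - t') 0) => h.
  rewrite (ler0_norm h) /Num.min; case: ltP => h1; case: ltP => h2; lra.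
rewrite (gtr0_norm h) /Num.min; case: ltP => h1; case: ltP => h2; lra.
Qed.

Lemma vertex_dist_tail v w a : adj v w -> vertex_dist (v, w, 0) a = (gdist v a)%:R.
Proof.
move=> vw; rewrite /vertex_dist /= add0r subr0; apply/min_idPl.
exact: gdist_adj_le.
Qed.

Lemma vertex_dist_head v w a : adj v w -> vertex_dist (v, w, 1) a = (gdist w a)%:R.
Proof.
move=> vw; rewrite -(vertex_dist_flip (v, w, 1)) /flip /= subrr.
by rewrite vertex_dist_tail// adj_sym.
Qed.

Lemma walk_point_dist_le p n i j t t' : nb_walk p n -> (i < n)%N -> (j < n)%N ->
  0 <= t <= 1 -> 0 <= t' <= 1 -> i%:R + t <= j%:R + t' ->
  edge_dist (walk_point p i t) (walk_point p j t') <= (j%:R + t') - (i%:R + t).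
Proof.
move=> [pa _] + + /andP[t0 t1].
have [ji|ij] := ltnP j i.
  move=> im jn /andP[t'0 t'1] h.
  have ji' : j%:R + 1 <= i%:R :> R by rewrite natr1 ler_nat.
  have E : i%:R = j%:R + 1 :> R by lra.
  have Ei : i = j.+1 by apply/eqP; rewrite -(@eqr_nat R) -natr1 E.
  have -> : t = 0 by lra.
  have -> : t' = 1 by lra.
  rewrite Ei; apply: edge_dist_le => [|a]; first lra.
  rewrite vertex_dist_head ?vertex_dist_tail ?pa//; last by rewrite -Ei.
  by rewrite subrr normr0; lra.
elim: j ij t' => [|j IH] ij t' im jn /andP[t'0 t'1] h.
  move: ij h; rewrite leqn0 => /eqP -> h.
  by apply: le_trans (edge_dist_same_edge _ _ _ _) _; rewrite ler0_norm; lra.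
move: ij; rewrite leq_eqVlt => /predU1P[E|ij].
  rewrite E in h *.
  by apply: le_trans (edge_dist_same_edge _ _ _ _) _; rewrite ler0_norm; lra.
have ij' : i%:R <= j%:R :> R by rewrite ler_nat.
apply: le_trans (edge_dist_triangle (walk_point p j 1) _ _) _.
have h1 := IH ij 1 im (ltnW jn) _ _.
have {}h1 := h1 (introT andP (conj ler01 (lexx 1))) (lerD ij' t1).
have h2 : edge_dist (walk_point p j 1) (walk_point p j.+1 0) <= 0.
  apply: edge_dist_le => // a.
  by rewrite vertex_dist_head ?vertex_dist_tail ?pa// 1?ltnW// subrr normr0.
have h3 := edge_dist_same_edge (p j.+1) (p j.+2) 0 t'.
have := edge_dist_triangle (walk_point p j.+1 0) (walk_point p j 1)
  (walk_point p j.+1 t').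
move: h1 h2 h3; rewrite sub0r normrN (ger0_norm t'0) -/(walk_point p j.+1 0)
  -/(walk_point p j.+1 t') -[j.+1%:R]natr1.
by lra.
Qed.

(** As the walk is a geodesic, the distances to its end vertex differ as much as
    possible. *)
Lemma walk_point_dist p n i j t t' : nb_walk p n -> (i < n)%N -> (j < n)%N ->
  0 <= t <= 1 -> 0 <= t' <= 1 -> i%:R + t <= j%:R + t' ->
  (j <= i + k + 2)%N ->
  edge_dist (walk_point p i t) (walk_point p j t') = (j%:R + t') - (i%:R + t).
Proof.
move=> pn im jn t01 t'01 h jk.
apply/eqP; rewrite eq_le (walk_point_dist_le pn)//=.
have [ji|ij] := ltnP j i.
  apply: le_trans (edge_dist_ge0 _ _).
  have : j%:R + 1 <= i%:R :> R by rewrite natr1 ler_nat.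
  lra.
have d a b : (i <= a)%N -> (a <= b)%N -> (b <= j.+1)%N ->
    gdist (p a) (p b) = (b - a)%N.
  move=> ia ab bj; have := @nb_walk_geodesic G (2 * k + 8) cG girthG
    (fun l => p (a + l)%N) (b - a).
  rewrite addn0 subnKC// => -> //; last lia.
  by apply: nb_walk_sub pn _; lia.
apply: le_trans (edge_dist_ge _ _ (p j.+1)); apply: le_trans (ler_norm _).
rewrite /vertex_dist /= !d ?leqnn// ?ltnS// ?(leqW ij)//.
rewrite subSS subSn// subSn ?leqnn// subnn natrB// -natr1 natrB//.
have ij' : i%:R <= j%:R :> R by rewrite ler_nat.
move: t01 t'01 h => /andP[t0 t1] /andP[t'0 t'1] h.
rewrite subnn /Num.min; case: ltP => h1; case: ltP => h2; lra.
Qed.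

End MetricGraph.

(** * Non-backtracking walks between points of a metric graph *)

Section GraphLink.
Context (R : realType).
Variables (G : graph) (k : nat).
Hypothesis cG : forall x y : G, connect (@adj G) x y.
Hypothesis girthG : girth_ge G (2 * k + 8).

Notation edge_point := (edge_point R G).
Implicit Types x y : edge_point.

Lemma walk_position (n : nat) (s : R) : 0 <= s <= n.+1%:R ->
  exists i t, [/\ (i < n.+1)%N, 0 <= t <= 1 & i%:R + t = s].
Proof.
elim: n s => [|n IH] s /andP[s0 sn].
  by exists 0%N, s; rewrite s0 sn add0r.
have [sn'|ns] := leP s n.+1%:R.
  have [|i [t [im t01 st]]] := IH s; first by rewrite s0.
  by exists i, t; split=> //; exact: ltnW.
exists n.+1, (s - n.+1%:R); split=> //; last by rewrite addrC subrK.
by move: sn; rewrite -natr1; move: ns; lra.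
Qed.

Lemma walk_gdist_le (p : nat -> G) n a b :
  (forall i, (i < n)%N -> adj (p i) (p i.+1)) -> (a <= b)%N -> (b <= n)%N ->
  (gdist (p a) (p b) <= b - a)%N.
Proof.
move=> pa; elim: b => [|b IH] ab bn.
  by move: ab; rewrite leqn0 => /eqP ->; rewrite gdistxx.
move: ab; rewrite leq_eqVlt => /predU1P[->|ab]; first by rewrite gdistxx.
apply: leq_trans (gdist_triangle cG (p b) _ _) _.
by rewrite subSn// -[leqRHS]addn1 leq_add ?IH ?gdist_adj ?pa// ltnW.
Qed.

Definition same_point x y : Prop := x = y \/ flip x = y.

Lemma same_point_dist x y : same_point x y -> vertex_dist x = vertex_dist y.
Proof. by case=> <- //; rewrite vertex_dist_flip. Qed.

Lemma flipK : involutive (@flip R G).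
Proof. by case=> -[v w] t; rewrite /flip /= subKr. Qed.

Lemma on_edge_flip x : on_edge (flip x) = on_edge x.
Proof.
rewrite /on_edge /= adj_sym; congr (_ && _).
by rewrite subr_ge0 lerBlDr lerDl andbC.
Qed.

Lemma same_point_on_edge x y : same_point x y -> on_edge y = on_edge x.
Proof. by case=> <- //; rewrite on_edge_flip. Qed.

(** A geodesic from [a] to [b] extended by an edge at both ends. *)
Lemma nb_walk_of_geodesic (v a b w : G) : adj v a -> adj b w -> ~ (a = b /\ v = w) ->
  (gdist a b <= gdist v b)%N -> (gdist a b <= gdist a w)%N ->
  exists p, [/\ nb_walk p (gdist a b).+2, p 0%N = v, p 1%N = a,
    p (gdist a b).+1 = b & p (gdist a b).+2 = w].
Proof.
move=> va bw ne vb aw; have [q [aq qb qm]] := gdist_path cG a b.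
pose m := gdist a b; pose p := nth w (v :: a :: rcons q w).
have pm1 : p m.+1 = b.
  by rewrite /p /= -rcons_cons nth_rcons /m -qm ltnSn -qb (last_nth w).
have pm2 : p m.+2 = w by rewrite /p /= nth_rcons /m -qm ltnn eqxx.
have pa i : (i < m.+2)%N -> adj (p i) (p i.+1).
  move=> im; have : path (@adj G) v (a :: rcons q w).
    by rewrite /= va rcons_path aq qb.
  by move/(pathP w)/(_ i); rewrite /= size_rcons qm; apply.
exists p; split=> //; split=> // i im; apply/eqP => E.
have d1 := @walk_gdist_le p m.+2 _ _ pa.
have p0 : p 0%N = v by []. have p1 : p 1%N = a by [].
case: i im E => [_ E|i im E].
  have [m0|m0] := posnP m.
    by apply: ne; split; [rewrite -pm1 m0 p1|rewrite -pm2 m0 -E p0].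
  by have := d1 2%N m.+1 m0 (leqnSn _); rewrite -E p0 pm1; move: vb; rewrite -/m; lia.
have hm : gdist (p 1%N) (p m.+1) = m by rewrite p1 pm1.
move: im; rewrite !ltnS leq_eqVlt => /orP[/eqP iE|im].
  have := d1 1%N i.+1 isT _; rewrite E iE pm2 p1.
  by move=> /(_ (leq_trans (leqnSn _) (leqnSn _))); move: aw; rewrite -/m; lia.
have h1 : (gdist (p 1%N) (p i.+1) <= i.+1 - 1)%N by apply: d1 => //; lia.
have h2 : (gdist (p i.+3) (p m.+1) <= m.+1 - i.+3)%N by apply: d1 => //; lia.
have := gdist_triangle cG (p i.+1) (p 1%N) (p m.+1).
by rewrite hm {2}E; lia.
Qed.

(** Unless both points lie on the same edge, choose the closest ones among the
    end points of the two edges. A geodesic between them can be extended through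
    both edges without backtracking. *)
Lemma common_nb_walk x y : on_edge x -> on_edge y ->
  edge_dist x y < k.+1%:R ->
  exists p n tx ty, [/\ nb_walk p n.+1 /\ (n <= k + 2)%N,
    same_point x (walk_point p 0 tx), same_point y (walk_point p n ty),
    0 <= tx <= 1 /\ 0 <= ty <= 1 & tx <= n%:R + ty].
Proof.
move=> ex ey xy.
have [[t yt]|nsame] := pselect (exists t, same_point y (x.1, t)).
  have : on_edge (x.1, t) by rewrite (same_point_on_edge yt).
  case: x ex xy yt => -[v w] s /= /andP[/= vw s01] _ yt /andP[/= _ t01].
  have nb (v' w' : G) : adj v' w' -> nb_walk (fun i => if i == 0%N then v' else w') 1.
    by move=> a'; split=> -[|i].
  have [st|ts] := leP s t.
    exists (fun i => if i == 0%N then v else w), 0%N, s, t.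
    split=> //; [split=> //; exact: nb|by left|by rewrite add0r].
  exists (fun i => if i == 0%N then w else v), 0%N, (1 - s), (1 - t).
  split=> //.
  - by split=> //; apply: nb; rewrite adj_sym.
  - by right.
  - case: yt => yt; first by right; rewrite yt.
    by left; rewrite -[y]flipK yt.
  - by move: s01 t01; rewrite -!(rwP andP); lra.
  - by rewrite add0r; lra.
pose X (b : bool) := if b then x else flip x.
pose Y (b : bool) := if b then y else flip y.
have Xs b : same_point x (X b) by case: b; [left|right].
have Ys b : same_point y (Y b) by case: b; [left|right].
pose f (bc : bool * bool) := gdist (X bc.1).1.2 (Y bc.2).1.1.
have [[b c] _ fmin] := arg_minnP f (isT : xpredT (true, true)).
have := same_point_on_edge (Xs b); have := same_point_on_edge (Ys c).
rewrite ex ey => /andP[adjy y01] /andP[adjx x01].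
have f1 : (f (b, c) <= gdist (X b).1.1 (Y c).1.1)%N.
  by have := fmin (~~ b, c) isT; rewrite /f /X; case: (b).
have f2 : (f (b, c) <= gdist (X b).1.2 (Y c).1.2)%N.
  by have := fmin (b, ~~ c) isT; rewrite /f /Y; case: (c).
have ne : ~ ((X b).1.2 = (Y c).1.1 /\ (X b).1.1 = (Y c).1.2).
  move=> [h1 h2]; apply: nsame.
  have sf z z' : same_point z z' -> same_point z (flip z').
    by case=> <-; [right|left; rewrite flipK].
  have : same_point y ((X b).1, 1 - (Y c).2).
    have := sf _ _ (Ys c); congr (same_point y _).
    by rewrite /flip -h1 -h2 -surjective_pairing.
  rewrite /X; case: (b) => h; first by exists (1 - (Y c).2).
  exists (1 - (1 - (Y c).2)); have := sf _ _ h; congr (same_point y _).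
  by rewrite /flip /= -surjective_pairing.
have [p [pnb p0 p1 pm1 pm2]] := nb_walk_of_geodesic adjx adjy ne f1 f2.
set m := gdist _ _ in pnb pm1 pm2.
have mk : (m <= k + 1)%N.
  rewrite -ltnS -addnS -(@ltr_nat R); apply: le_lt_trans (_ : _ <= 1 + edge_dist x y) _.
    rewrite -lerBlDl; apply: le_trans (edge_dist_ge x y (Y c).1.1).
    apply: le_trans (ler_norm _).
    rewrite (same_point_dist (Xs b)) (same_point_dist (Ys c)).
    move: x01 y01 => /andP[x0 x1] /andP[y0 y1].
    have : m%:R <= vertex_dist (X b) (Y c).1.1.
      rewrite /vertex_dist le_min; apply/andP; split.
        by apply: ler_wpDl => //; rewrite ler_nat.
      by apply: ler_wpDl; rewrite ?subr_ge0.
    have : vertex_dist (Y c) (Y c).1.1 <= 1.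
      by rewrite /vertex_dist ge_min gdistxx addr0 y1.
    lra.
  by rewrite addn2 -[k.+2%:R]natr1 addrC ltrD2r.
exists p, m.+1, (X b).2, (Y c).2; split=> //.
- by split=> //; rewrite addnS ltnS.
- by rewrite /walk_point p0 p1 -!surjective_pairing.
- by rewrite /walk_point pm1 pm2 -!surjective_pairing.
- move: x01 y01 => /andP[x0 x1] /andP[y0 y1]; rewrite -natr1.
  by have : 0 <= m%:R :> R by []; lra.
Qed.

(** If the walk is longer than [k + 1], compare with its point at distance [k +
    1] from the start. *)
Lemma nb_walk_ends_dist (p : nat -> G) n (tx ty : R) : nb_walk p n.+1 ->
  0 <= tx <= 1 -> 0 <= ty <= 1 -> tx <= n%:R + ty ->
  forall s, s = n%:R + ty - tx ->
  Num.min s (2 * k.+1%:R - s) <=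
    edge_dist (walk_point p 0 tx) (walk_point p n ty).
Proof.
move=> pn tx01 ty01 h s sE; have /andP[x0 x1] := tx01; have /andP[y0 y1] := ty01.
have [sk|ks] := leP s k.+1%:R.
  rewrite (@walk_point_dist R G k cG girthG p n.+1) ?add0r//; last first.
    rewrite add0n -(@ler_nat R) addn2 -[k.+2%:R]natr1.
    by rewrite (le_trans _ (lerD sk (lexx 1)))// sE; lra.
  by apply: (@le_trans _ _ s); [rewrite ge_min lexx|rewrite sE; lra].
have [|i [t [im t01 tE]]] := @walk_position n (tx + k.+1%:R).
  rewrite addr_ge0//= -natr1; move: ks; rewrite sE; lra.
have ik : (i <= 0 + k + 2)%N.
  rewrite add0n -(@ler_nat R) addn2 -[k.+2%:R]natr1; move: t01 => /andP[]; lra.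
have d1 : edge_dist (walk_point p 0 tx) (walk_point p i t) = k.+1%:R.
  rewrite (@walk_point_dist R G k cG girthG p n.+1) ?add0r// tE; first by ring.
  by rewrite lerDl.
have h2 : i%:R + t <= n%:R + ty by rewrite tE; move: ks; rewrite sE; lra.
have d2 := walk_point_dist_le cG pn im (ltnSn n) t01 ty01 h2.
have := edge_dist_triangle (walk_point p n ty) (walk_point p 0 tx) (walk_point p i t).
rewrite d1 [edge_dist _ (walk_point p i t)]edge_dist_sym tE in d2 * => d3.
by rewrite ge_min; apply/orP; right; rewrite sE; move: d2 d3; clear; lra.
Qed.

End GraphLink.

(** * Graphs of large girth as links *)

Section GraphLinkSpace.
Context (R : realType).
Variables (G : graph) (k : nat).
Hypothesis cG : forall x y : G, connect (@adj G) x y.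
Hypothesis girthG : girth_ge G (2 * k + 8).

Definition link_point := {x : edge_point R G | on_edge x}.

Let c : R := pi / k.+1%:R.

Let c_gt0 : 0 < c.
Proof. by rewrite divr_gt0 ?pi_gt0. Qed.

Let ck : c * k.+1%:R = pi.
Proof. by rewrite /c divfK. Qed.

(** The closed geodesics have length at least [2 * pi], as they have more than
    [2 * k.+1] edges. *)
Definition link_dist (x y : link_point) : R :=
  pi / k.+1%:R * Num.min k.+1%:R (edge_dist (val x) (val y)).

Lemma link_distxx x : link_dist x x = 0.
Proof. by rewrite /link_dist edge_distxx min_r// mulr0. Qed.

Lemma link_dist_sym x y : link_dist x y = link_dist y x.
Proof. by rewrite /link_dist edge_dist_sym. Qed.

Lemma link_dist_triangle y x z : link_dist x z <= link_dist x y + link_dist y z.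
Proof.
rewrite /link_dist -mulrDr ler_wpM2l ?(ltW c_gt0)//.
have := edge_dist_triangle (val y) (val x) (val z).
have := edge_dist_ge0 (val x) (val y); have := edge_dist_ge0 (val y) (val z).
have : 0 <= k.+1%:R :> R by [].
move: (edge_dist _ _) (edge_dist _ _) (edge_dist _ _) (k.+1%:R) => d1 d2 d3 K.
move=> K0 d20 d10 h; rewrite /Num.min.
by case: (ltP K d1); case: (ltP K d2); case: (ltP K d3); lra.
Qed.

Definition graph_link : pmetric R :=
  PMetric link_distxx link_dist_sym link_dist_triangle.

Lemma link_dist_le_pi x y : link_dist x y <= pi.
Proof. by rewrite -[leRHS]ck ler_wpM2l ?(ltW c_gt0)// ge_min lexx. Qed.

Lemma link_dist_lt_pi x y : link_dist x y < pi ->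
  edge_dist (val x) (val y) < k.+1%:R /\ link_dist x y = c * edge_dist (val x) (val y).
Proof.
rewrite /link_dist -/c -{1}ck ltr_pM2l// /Num.min.
by case: (ltP k.+1%:R (edge_dist _ _)) => [_|//]; rewrite ltxx.
Qed.

Lemma link_distE x y d : edge_dist (val x) (val y) = d -> d <= k.+1%:R ->
  link_dist x y = c * d.
Proof. by move=> dE dk; rewrite /link_dist dE min_r. Qed.

Lemma arc_link_dist x y s :
  Num.min s (2 * k.+1%:R - s) <= edge_dist (val x) (val y) ->
  circle_arc (c * s) <= link_dist x y.
Proof.
move=> h; rewrite /circle_arc -{1}ck mulrCA -mulrBr -minr_pMr ?(ltW c_gt0)//.
rewrite /link_dist ler_wpM2l ?(ltW c_gt0)// le_min h andbT.
by rewrite /Num.min; case: (ltP s _); lra.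
Qed.

Lemma nb_walk_splice (p q : nat -> G) n m i : nb_walk p n.+1 -> nb_walk q m.+1 ->
  (i <= n)%N -> q m = p i -> q m.+1 = p i.+1 ->
  let r j := if (j <= m)%N then q j else p (j - m + i)%N in
  nb_walk r (m + (n - i)).+1.
Proof.
move=> [pa pb] [qa qb] ni qm qm1 r.
have rE j : (m <= j)%N -> r j = p (j - m + i)%N.
  move=> mj; rewrite /r; case: (leqP j m) => // jm.
  have -> : j = m by lia.
  by rewrite subnn qm.
have rq j : (j <= m.+1)%N -> r j = q j.
  rewrite leq_eqVlt ltnS => /predU1P[->|]; last by rewrite /r => ->.
  by rewrite rE// subSn// subnn qm1.
split=> j jm.
  have [jm'|mj] := ltnP j m.+1; first by rewrite !rq ?qa// ltnW.
  rewrite !rE ?(ltnW mj) ?(leqW (ltnW mj))// subSn ?(ltnW mj)// addSn.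
  by apply: pa; lia.
have [jm'|mj] := ltnP j m; first by rewrite !rq ?qb//; lia.
rewrite !rE ?(leq_trans mj) ?leqW// !subSn ?leqW// !addSn.
by apply: pb; lia.
Qed.

Lemma nb_walk_rev (p : nat -> G) n : nb_walk p n -> nb_walk (fun j => p (n - j)%N) n.
Proof.
move=> [pa pb]; split=> j jn.
  have -> : (n - j = (n - j.+1).+1)%N by lia.
  by rewrite adj_sym; apply: pa; lia.
have -> : (n - j = (n - j.+2).+2)%N by lia.
by rewrite eq_sym; apply: pb; lia.
Qed.

Lemma nb_walk_on_edge (p : nat -> G) n i (t : R) : nb_walk p n -> (i < n)%N ->
  0 <= t <= 1 -> on_edge (walk_point p i t).
Proof. by move=> [pa _] im t01; rewrite /on_edge /= pa. Qed.

(** The two walks cross a common edge in the same direction, so that their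
    concatenation does not backtrack. *)
Lemma concat_walk_dist (p q : nat -> G) n m i (tw tu ty : R) :
  nb_walk p n.+1 -> nb_walk q m.+1 -> (i <= n)%N ->
  q m = p i -> q m.+1 = p i.+1 ->
  0 <= tw <= 1 -> 0 <= tu <= 1 -> 0 <= ty <= 1 ->
  tw <= m%:R + tu -> i%:R + tu <= n%:R + ty ->
  forall s, s = (m%:R + tu - tw) + (n%:R + ty - (i%:R + tu)) ->
  Num.min s (2 * k.+1%:R - s) <=
    edge_dist (walk_point q 0 tw) (walk_point p n ty).
Proof.
move=> pn qn ni qm qm1 tw01 tu01 ty01 wu uy s sE.
have rn := nb_walk_splice pn qn ni qm qm1.
set r := (fun j => if (j <= m)%N then q j else p (j - m + i)%N) in rn.
have ni' : (n - i)%:R = n%:R - i%:R :> R by rewrite natrB.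
have h : tw <= (m + (n - i))%:R + ty by rewrite natrD ni'; lra.
have := nb_walk_ends_dist cG girthG rn tw01 ty01 h (s := s).
rewrite natrD ni' => /(_ _)/le_trans; apply; first by rewrite sE; ring.
have [r0 r1] : r 0%N = q 0%N /\ r 1%N = q 1%N.
  by rewrite /r; split=> //; case: (m) qm qm1 => //= -> ->; rewrite subn0.
have rl : r (m + (n - i))%N = p n.
  rewrite /r; case: leqP => [h'|_]; last by congr p; clear -ni; lia.
  have E : (n - i = 0)%N by clear -h'; lia.
  have -> : n = i by clear -E ni; lia.
  by rewrite subnn addn0 qm.
have rl1 : r (m + (n - i)).+1 = p n.+1.
  by rewrite /r ltnNge leq_addr /=; congr p; clear -ni; lia.
by rewrite /walk_point r0 r1 rl rl1.
Qed.

(** The points [x] and [y] lie on a non-backtracking walk, which contains the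
    points between them. A walk from [w] to such a point [u] crosses its edge in
    one of the two directions, and is continued in this direction to [y] or to
    [x]. *)
Lemma graph_link_link : is_link graph_link.
Proof.
split=> [x y|x y]; first exact: link_dist_le_pi.
rewrite -[@pdist _ graph_link]/link_dist => /link_dist_lt_pi[xyk xyE] l l01.
have [p [n [tx [ty [[pn nk] xp yp [tx01 ty01] txy]]]]] :=
  common_nb_walk cG (valP x) (valP y) xyk.
have [/andP[tx0 tx1] /andP[ty0 ty1]] := (conj tx01 ty01).
have [l0 l1] := andP l01.
have n1 : 0 <= tx <= n.+1%:R.
  by rewrite tx0 (le_trans tx1)// ler1n.
pose d := n%:R + ty - tx.
have d0 : 0 <= d by rewrite /d; lra.
have [|i [t [im t01 tE]]] := @walk_position R n (tx + l * d).
  rewrite addr_ge0 ?mulr_ge0//= -natr1.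
  have : l * d <= d by rewrite ler_piMl.
  rewrite {2}/d; lra.
have ld : l * d <= d by rewrite ler_piMl.
have ld0 : 0 <= l * d by rewrite mulr_ge0.
have xi : 0%:R + tx <= i%:R + t by rewrite add0r tE lerDl.
have iy : i%:R + t <= n%:R + ty by rewrite tE; move: ld; rewrite {2}/d; lra.
have ni : (i <= n)%N by rewrite -ltnS.
have dE : edge_dist (val x) (val y) = d.
  rewrite (edge_distE (same_point_dist xp) (same_point_dist yp)).
  by rewrite (walk_point_dist cG girthG pn) ?add0r// mulr0n add0r.
have dk : d < k.+1%:R by rewrite -dE.
pose u : link_point := exist _ (walk_point p i t) (nb_walk_on_edge pn im t01).
have xuE : edge_dist (val x) (val u) = l * d.
  rewrite (edge_distE (same_point_dist xp) (erefl (vertex_dist (val u)))).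
  rewrite (walk_point_dist cG girthG pn)//; last by rewrite add0n (leq_trans ni).
  by rewrite tE mulr0n; ring.
have uyE : edge_dist (val u) (val y) = (1 - l) * d.
  rewrite (edge_distE (erefl (vertex_dist (val u))) (same_point_dist yp)).
  rewrite (walk_point_dist cG girthG pn)//; last first.
    by rewrite (leq_trans nk)// -addnA leq_addl.
  by rewrite tE /d; ring.
exists u; split.
- by rewrite (link_distE xuE) ?xyE ?dE; [ring|lra].
- by rewrite (link_distE uyE) ?xyE ?dE; [ring|move: ld0; lra].
move=> w /link_dist_lt_pi[wuk wuE].
have [q [m [tw [tu [[qn mk] wq uq [tw01 tu01] twu]]]]] :=
  common_nb_walk cG (valP w) (valP u) wuk.
have wuD : edge_dist (val w) (val u) = m%:R + tu - tw.
  rewrite (edge_distE (same_point_dist wq) (same_point_dist uq)).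
  by rewrite (walk_point_dist cG girthG qn) ?add0r// mulr0n add0r.
have uyL : link_dist u y = c * ((1 - l) * d).
  by apply: link_distE uyE _; move: ld0; lra.
have uxL : link_dist u x = c * (l * d).
  by rewrite link_dist_sym; apply: link_distE xuE _; lra.
case: uq => uq; [right|left].
  rewrite wuE wuD uyL -mulrDr; apply: arc_link_dist.
  rewrite (edge_distE (same_point_dist wq) (same_point_dist yp)).
  move: uq; rewrite /u /= /walk_point => -[qm qm1 tuE].
  have := concat_walk_dist pn qn ni (esym qm) (esym qm1) tw01 tu01 ty01 twu.
  rewrite -tuE => /(_ iy _ erefl); rewrite (_ : _ + (_ - _) = m%:R + t - tw + (1 - l) * d)//.
  by rewrite tE /d; ring.
rewrite wuE wuD uxL -mulrDr; apply: arc_link_dist.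
pose p' j := p (n.+1 - j)%N.
have pn' : nb_walk p' n.+1 by exact: nb_walk_rev.
have xp' : same_point (val x) (walk_point p' n (1 - tx)).
  have -> : walk_point p' n (1 - tx) = flip (walk_point p 0 tx).
    by rewrite /walk_point /flip /p' /= subnn subSn// subnn.
  by case: xp => <-; [right|left; rewrite flipK].
rewrite (edge_distE (same_point_dist wq) (same_point_dist xp')).
move: uq; rewrite /u /walk_point /flip /= => -[qm qm1 tuE].
have ni' : (n - i <= n)%N by rewrite leq_subr.
have h1 : q m = p' (n - i)%N by rewrite -qm /p'; congr p; clear -ni; lia.
have h2 : q m.+1 = p' (n - i).+1 by rewrite -qm1 /p'; congr p; clear -ni; lia.
have tx01' : 0 <= 1 - tx <= 1 by lra.
have := concat_walk_dist pn' qn ni' h1 h2 tw01 tu01 tx01' twu.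
rewrite natrB// -tuE => h; have {h} := h _.
have hx : n%:R - i%:R + (1 - t) <= n%:R + (1 - tx).
  by move: xi; rewrite mulr0n add0r; lra.
move=> /(_ hx _ erefl); rewrite (_ : _ + (_ - _) = m%:R + (1 - t) - tw + l * d)//.
have -> : l * d = i%:R + t - tx by rewrite tE; ring.
by ring.
Qed.

End GraphLinkSpace.

(** * Completeness of graph links and vertices on a sphere of the cone *)

Section GraphLinkComplete.
Context (R : realType).
Variables (G : graph) (k : nat).
Hypothesis cG : forall x y : G, connect (@adj G) x y.

Let c : R := pi / k.+1%:R.

Let c_gt0 : 0 < c.
Proof. by rewrite divr_gt0 ?pi_gt0. Qed.

Lemma edge_dist_on_edge (v w : G) (t t' : R) : adj v w -> 0 <= t <= 1 ->
  0 <= t' <= 1 -> edge_dist (v, w, t) (v, w, t') = `|t - t'|.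
Proof.
move=> vw /andP[t0 t1] /andP[t'0 t'1]; apply/eqP; rewrite eq_le edge_dist_same_edge.
apply: le_trans (edge_dist_ge (v, w, t) (v, w, t') v).
rewrite /vertex_dist /= gdistxx.
have E s : 0 <= s -> s <= 1 -> Num.min (s + 0%:R) (1 - s + (gdist w v)%:R) = s :> R.
  move=> s0 s1; rewrite mulr0n addr0; apply/min_idPl.
  have : 1 <= (gdist w v)%:R :> R.
    rewrite ler1n lt0n; apply/eqP => /(gdist_eq0 cG) wv.
    by rewrite wv adj_irr in vw.
  by lra.
by rewrite !E.
Qed.

Lemma pigeonhole_seq (T : finType) (u : nat -> T) :
  exists a, forall N, exists n, (N <= n)%N /\ u n = a.
Proof.
apply: contrapT => /forallNP h.
have {}h a : exists N, forall n, (N <= n)%N -> u n <> a.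
  have /existsNP[N /forallNP NP] := h a; exists N => n Nn una.
  by apply: (NP n).
have [N NP] := choice h.
pose M := (\max_a N a)%N.
by apply: (NP (u M) M) => //; apply: (leq_bigmax (u M)).
Qed.

(** Infinitely many terms of a sequence lie on the same edge, which is isometric
    to an interval. *)
Lemma graph_link_complete : seq_complete (graph_link R G k).
Proof.
move=> u cu; rewrite /seq_limit -[@pdist _ _]/(@link_dist R G k) in cu *.
have [[v w] vwP] := pigeonhole_seq (fun n => (val (u n)).1).
have [h hP] := choice vwP.
have hn n : (n <= h n)%N by have [] := hP n.
have hE n : val (u (h n)) = (v, w, (val (u (h n))).2).
  by have [_ <-] := hP n; rewrite -surjective_pairing.
have on n : adj v w /\ 0 <= (val (u (h n))).2 <= 1.
  by have := valP (u (h n)); rewrite hE /on_edge /= => /andP[].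
have vw := (on 0%N).1.
pose t n := (val (u (h n))).2.
have tD m n : edge_dist (val (u (h m))) (val (u (h n))) = `|t m - t n|.
  by rewrite (hE m) (hE n) edge_dist_on_edge ?(on m).2 ?(on n).2.
have ed e : 0 < e -> exists N, forall m n, (N <= m)%N -> (N <= n)%N ->
    edge_dist (val (u m)) (val (u n)) < e.
  move=> e0; have [|N NP] := cu (Num.min pi (c * e)).
    by rewrite lt_min pi_gt0 mulr_gt0.
  exists N => m n Nm Nn; have := NP m n Nm Nn.
  rewrite lt_min => /andP[/link_dist_lt_pi[_ E]].
  by rewrite [X in X < _]E ltr_pM2l.
have [e e0|l lP] := @real_seq_complete R t.
  have [N NP] := ed e e0; exists N => m n Nm Nn; rewrite -tD.
  by apply: NP; [exact: leq_trans (hn m)|exact: leq_trans (hn n)].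
have l01 : 0 <= l <= 1.
  apply/andP; split; rewrite leNgt; apply/negP => hl.
    have [|N NP] := lP (- l); first by rewrite oppr_gt0.
    have := NP N (leqnn N); have /andP[t0 _] := (on N).2; rewrite -/(t N) in t0.
    by rewrite ger0_norm; [lra|rewrite subr_ge0; lra].
  have [|N NP] := lP (l - 1); first by rewrite subr_gt0.
  have := NP N (leqnn N); have /andP[_ t1] := (on N).2; rewrite -/(t N) in t1.
  by rewrite ler0_norm; [lra|rewrite subr_le0; lra].
have xe : on_edge (v, w, l) by rewrite /on_edge /= vw.
exists (exist _ (v, w, l) xe) => e e0.
have e2 : 0 < e / c / 2 by apply: divr_gt0 => //; exact: divr_gt0 e0 c_gt0.
have [N NP] := ed _ e2; have [N' NP'] := lP _ e2.
exists (maxn N N') => n; rewrite geq_max => /andP[Nn N'n].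
apply: (@le_lt_trans _ _ (c * edge_dist (val (u n)) (v, w, l))).
  by rewrite /link_dist ler_wpM2l ?(ltW c_gt0)// ge_min lexx orbT.
rewrite -ltr_pdivlMl// mulrC (splitr (e / c)).
apply: le_lt_trans (edge_dist_triangle (val (u (h n))) _ _) _.
apply: ltrD; first by apply: NP => //; exact: leq_trans (hn n).
rewrite hE edge_dist_on_edge ?(on n).2//; exact: NP'.
Qed.

Lemma vertex_edge_dist (v w v' w' : G) : adj v w -> adj v' w' ->
  edge_dist (v, w, 0) (v', w', 0) = (gdist v v')%:R :> R.
Proof.
move=> vw vw'; apply/eqP; rewrite eq_le; apply/andP; split.
  apply: edge_dist_le => // a; rewrite !vertex_dist_tail// ler_norml.
  have := gdist_triangle cG v' v a; have := gdist_triangle cG v v' a.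
  by rewrite [gdist v' v]gdist_sym// -!(@ler_nat R) !natrD; lra.
apply: le_trans (edge_dist_ge (v, w, 0) (v', w', 0) v').
by rewrite !vertex_dist_tail// gdistxx subr0 ger0_norm.
Qed.

End GraphLinkComplete.

(** With this radius the edges have length about one, and the cone metric and
    the graph metric agree up to the ratio of diameter and girth. *)
Lemma cone_dist_bilipschitz (R : realType) (k K d : nat) (t rho : R) :
  rho = k.+1%:R / pi -> t = pi / k.+1%:R * Num.min k.+1%:R d%:R -> (d <= K * k.+1)%N ->
  d%:R / (2 * K.+1%:R) <= Num.sqrt (chord2 `|rho| `|rho| t) <= d%:R.
Proof.
move=> rhoE tE dK.
have K0 : 0 < k.+1%:R :> R by [].
have pi0 : 0 < pi :> R := pi_gt0 R.
have rho0 : 0 < rho by rewrite rhoE divr_gt0.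
have d0 : 0 <= d%:R :> R by [].
set m : R := Num.min k.+1%:R d%:R in tE.
have m0 : 0 <= m by rewrite /m le_min ler0n.
have rt : rho * t = m.
  by rewrite tE rhoE !mulrA divfK ?divff ?mul1r ?gt_eqF.
have t0 : 0 <= t by rewrite tE mulr_ge0// divr_ge0// ltW.
have tpi : t <= pi.
  have mk : m <= k.+1%:R by rewrite /m ge_min lexx.
  by rewrite tE mulrAC ler_pdivrMr//; apply: ler_wpM2l mk; exact: ltW.
have [h1 h2] := (@oneBcos_ge R t (introT andP (conj t0 tpi)),
                 @oneBcos_le R t (introT andP (conj t0 tpi))).
rewrite gtr0_norm// (_ : chord2 rho rho t = 2 * rho ^+ 2 * (1 - cos t)); last first.
  by rewrite /chord2; ring.
have rho2 : 0 <= rho ^+ 2 by apply: sqr_ge0.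
have l1 : (m / 2) ^+ 2 <= 2 * rho ^+ 2 * (1 - cos t).
  rewrite -rt; have := ler_wpM2l rho2 h1; lra.
have l2 : 2 * rho ^+ 2 * (1 - cos t) <= m ^+ 2.
  rewrite -rt; have := ler_wpM2l rho2 h2; lra.
apply/andP; split; last first.
  rewrite -[leRHS]ger0_norm// -sqrtr_sqr; apply: ler_wsqrtr.
  apply: le_trans l2 _; apply: lerXn2r; rewrite ?nnegrE//.
  by rewrite /m ge_min lexx orbT.
apply: (@le_trans _ _ (m / 2)); last first.
  by rewrite -[leLHS]ger0_norm ?divr_ge0// -sqrtr_sqr; apply: ler_wsqrtr.
rewrite ler_pdivrMr ?mulr_gt0// mulrA divfK//.
have K1 : 1 <= K.+1%:R :> R by rewrite ler1n.
have dK' : d%:R <= k.+1%:R * K.+1%:R :> R.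
  rewrite -natrM ler_nat (leq_trans dK)// mulnC leq_mul2l.
  by rewrite leqnSn orbT.
rewrite /m /Num.min; case: (ltP k.+1%:R d%:R) => [_|_]; first exact: dK'.
by rewrite ler_peMr.
Qed.

(** * The bilipschitz embedding *)

Lemma linear_control_function (R : realType) (a : R) : 0 < a ->
  control_function (fun r => a * r).
Proof.
move=> a0; split=> [r r0|r1 r2 _ r12|].
- by rewrite mulr_ge0// ltW.
- by rewrite ler_pM2l.
apply/cvgryPge => A; exists (A / a); split; first exact: num_real.
by move=> r /ltW; rewrite ler_pdivrMr// mulrC.
Qed.

Section Embedding.
Variables (R : realType) (K : nat) (L : nat -> graph) (kappa : nat -> nat).
Hypothesis cL : forall k, connected_graph (L k).
Hypothesis nL : forall k, (1 < #|L k|)%N.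
Hypothesis girthL : forall k, girth_ge (L k) (2 * k + 8).
Hypothesis diamL : forall k (x y : L k), (gdist x y <= K * k.+1)%N.

Let links k : pmetric R := graph_link R (L k) k.

Let links_link k : is_link (links k) := graph_link_link R (cL k).2 (@girthL k).

Let cone_pt : pmetric R := @cone R (link_sum links_link) (proj1 (link_sum_link links_link)).

Lemma vertex_point_exists k (v : L k) : exists x : link_point R (L k),
  exists2 w, adj v w & val x = (v, w, 0).
Proof.
have [w vw] := connected_graph_adj (cL k) (nL k) v.
have h : on_edge (v, w, 0 : R) by rewrite /on_edge /= vw lexx ler01.
by exists (exist (fun x : edge_point R (L k) => on_edge x) _ h), w.
Qed.

Let vertex_point k (v : L k) : link_point R (L k) :=
  sval (cid (vertex_point_exists v)).

Lemma link_vertex_point k (v v' : L k) :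
  @pdist R (links k) (vertex_point v) (vertex_point v') =
  pi / k.+1%:R * Num.min k.+1%:R (gdist v v')%:R.
Proof.
rewrite -[@pdist R (links k)]/(@link_dist R (L k) k) /link_dist /vertex_point.
case: cid => x [w vw /= ->]; case: cid => x' [w' vw' /= ->].
by rewrite (vertex_edge_dist _ (cL k).2).
Qed.

Let cone_vertex k (v : L k) : cone_pt :=
  (existT _ k (vertex_point v), k.+1%:R / pi).

Lemma cone_vertex_dist k (v v' : L k) :
  (gdist v v')%:R / (2 * K.+1%:R) <= pdist (cone_vertex v) (cone_vertex v')
  <= (gdist v v')%:R.
Proof.
rewrite -[@pdist R cone_pt]/(@cone_dist R (link_sum links_link)) /cone_dist.
apply: (cone_dist_bilipschitz (k := k)) => //.
rewrite -link_vertex_point. exact: (sum_dist_same (P := links) (vertex_point v) (vertex_point v')).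
Qed.

(** The two coordinates of a vertex are mapped to two copies of the cone over
    the union of all graph links. *)
Lemma box_union_embeds : exists M : metricType R,
  complete_cat0 M /\
  bilipschitz_embeddable
    (disj_dist (fun l => @graph_dist R (box_graph (L l) (L (kappa l))))) M.
Proof.
have Tc : seq_complete cone_pt.
  have /card_gt0P[v0 _] := (cL 0%N).1.
  apply: (@cone_complete R (link_sum links_link) _
    (existT _ 0%N (vertex_point v0))).
  by apply: link_sum_complete => k; exact: graph_link_complete _ _ (cL k).2.
have Tb : bruhat_tits (@pdist R cone_pt).
  exact: (cone_bruhat_tits (hP := link_sum_link links_link)).
pose P := prod_pmetric cone_pt cone_pt.
exists (metric_quotient P : metricType R); split.
  exact: complete_cat0_quotient (prod_complete Tc Tc) (prod_bruhat_tits Tb Tb).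
pose c : R := (4 * K.+1%:R)^-1.
have c0 : 0 < c by rewrite invr_gt0 mulr_gt0.
pose f (x : {l : nat & box_graph (L l) (L (kappa l))}) : metric_quotient P :=
  quotient_class ((cone_vertex (tagged x).1, cone_vertex (tagged x).2) : P).
exists (fun r => c * r), (fun r => 2 * r), f; split; [by exists c|by exists 2|].
split; [exact: linear_control_function|exact: linear_control_function|].
case=> l x [l' y]; rewrite {1}/disj_dist /=.
case: eqP => [E _|_]; last by rewrite ltxx.
case: _ / (esym E) y => y.
rewrite disj_dist_same graph_distE; last exact: (box_connected (cL l) (cL _)).2.
rewrite /f mdist_quotient /=.
have := prod_dist_le (cone_vertex x.1, cone_vertex x.2)
  (cone_vertex y.1, cone_vertex y.2).
have := prod_dist_ge (cone_vertex x.1, cone_vertex x.2)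
  (cone_vertex y.1, cone_vertex y.2).
have := cone_vertex_dist x.1 y.1; have := cone_vertex_dist x.2 y.2.
have := gdist_box_le (cL l) (cL (kappa l)) x y.
have := gdist_box_fst (cL l) (cL (kappa l)) x y.
have := gdist_box_snd (cL l) (cL (kappa l)) x y.
rewrite -!(ler_nat R) natrD /=.
have -> : c = (2 * K.+1%:R)^-1 / 2.
  by rewrite /c -invfM; congr (_^-1); ring.
have := c0; rewrite /c; set b := (2 * K.+1%:R)^-1.
have b0 : 0 < b by rewrite invr_gt0 mulr_gt0.
move: (gdist x y)%:R (gdist x.1 y.1)%:R (gdist x.2 y.2)%:R => d d1 d2.
move: (prod_dist _ _) (cone_dist _ _) (cone_dist _ _) => p p2 p1.
move=> _ h2 h1 h /andP[a1 a2] /andP[b1 b2] [e1 e2] e3.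
have : d * b <= (d1 + d2) * b by rewrite ler_pM2r.
by move=> hb; apply/andP; split; lra.
Qed.

End Embedding.

(** * The sequence of expanders *)

(** The numbers with 2-adic valuation [k] are the odd multiples of [2 ^ k]. *)
Lemma logn2_surjective_late (k m : nat) :
  exists2 l, (m <= l)%N & logn 2 l.+1 = k.
Proof.
exists (2 ^ k * (2 * m).+1).-1.
  rewrite -ltnS prednK ?muln_gt0 ?expn_gt0//; apply: leq_trans (leq_pmull _ _).
    by clear; lia.
  by rewrite expn_gt0.
rewrite prednK ?muln_gt0 ?expn_gt0// lognM ?expn_gt0// pfactorK//.
by rewrite logn_coprime ?addn0// coprime2n /= mul2n odd_double.
Qed.

Theorem theorem1p9 (R : realType) :
  exists G : nat -> graph,
    [/\ bounded_degree G,
        expander_family R G,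
        ~ (exists M : metricType R,
             CAT0_lt1 M /\
             fibred_coarse_embedding (fun l => @graph_dist R (G l)) M)
        /\
        ~ (exists E H : completeNormedModType R,
             [/\ hilbert H, sphere_equivalent E H &
                 banach_fibred_coarse_embedding
                   (fun l => @graph_dist R (G l)) E]) &
        exists M : metricType R,
          complete_cat0 M /\
          bilipschitz_embeddable
            (disj_dist (fun l => @graph_dist R (G l))) M].
Proof.
have [D [K [L hL]]] := expander_high_girth.
have cL k : connected_graph (L k) by have [[]] := hL k.
have nL k : (k.+1 < #|L k|)%N by have [[]] := hL k.
have degL k (v : L k) : (degree v <= D)%N by have [_ /(_ v)] := hL k.
have girthL k : girth_ge (L k) (2 * k + 8) by have [] := hL k.
have diamL k (x y : L k) : (gdist x y <= K * k.+1)%N.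
  by have [_ _ _ _ /(_ x y)] := hL k.
have pL k : poincare (L k) (4 * D%:R : R).
  by have [_ _ _ eL _] := hL k; apply: poincare_expander => //; exact: (cL k).1.
pose kappa l := logn 2 l.+1.
pose G l := box_graph (L l) (L (kappa l)).
have bG : bounded_degree G.
  by exists (2 * D)%N => l v; apply: box_degree.
have obstruction := fibred_embedding_obstruction cL cL
  (fun k => ltnW (nL k)) degL pL diamL logn2_surjective_late.
exists G; split=> //.
(* The constant is increased by one to be positive. *)
- apply: (@expander_family_poincare _ _ (4 * D%:R + 1)) => //.
  + by move=> l; exact: box_connected.
  + move=> l; rewrite card_prod; apply: leq_trans (leq_pmulr _ (cL _).1).
    by apply: ltnW; apply: ltnW.
  + move=> l f; apply: le_trans (poincare_box (cL l).1 (cL _).1 _ (@pL l) (@pL _) f) _.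
    by rewrite mulr_ge0.
  apply: ler_wpM2r; last by rewrite lerDl.
  by apply: sumr_ge0 => v _; apply: sumr_ge0 => w _; exact: sqr_ge0.
- split=> [[M [/CAT0_lt1_concentrates conc]]|[E [H [hH EH]]]].
    exact: obstruction conc.
  exact: obstruction (sphere_equivalent_concentrates hH EH).
apply: (@box_union_embeds R K L kappa) => // k.
by apply: leq_trans (nL k).
Qed.
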